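(* For every $n\ge1$, the map $\Xi^{(n)}_\bullet:L_\bullet^{\mathrm{pol}}\to L_\bullet(V_{\mathrm{pol}}^{(n)})$ defined component-wise by $\Xi^{(n)}$ is a $\mathbb{B}_{q,t}^{(n)}$-module map.
   Context: Base field $\mathbb{Q}(q,t)$ with $q,t$ algebraically independent over $\mathbb{Q}$. **Positive DAHA.** $\mathscr{D}_n^{+}$ is the $\mathbb{Q}(q,t)$-algebra generated by $T_1,\dots,T_{n-1}$, $X_1,\dots,X_n$, $Y_1,\dots,Y_n$ with relations: $(T_i-1)(T_i+q)=0$; $T_iT_{i+1}T_i=T_{i+1}T_iT_{i+1}$; $T_iT_j=T_jT_i$ for $|i-j|>1$; $T_i^{-1}X_iT_i^{-1}=q^{-1}X_{i+1}$; $T_iX_j=X_jT_i$ for $j\notin\{i,i+1\}$; $X_iX_j=X_jX_i$; $T_iY_iT_i=qY_{i+1}$; $T_iY_j=Y_jT_i$ for $j\notin\{i,i+1\}$; $Y_iY_j=Y_jY_i$; $Y_1T_1X_1=X_2Y_1T_1$; $Y_1X_1\cdots X_n=tX_1\cdots X_nY_1$. Put $\pi=\pi^{(n)}=q^{-n}Y_1T_1\cdots T_{n-1}$. For $0\le k\le n$, $\epsilon_k=\frac{1}{[n-k]_q!}\sum_{\sigma\in\mathfrak{S}_{(1^k,n-k)}}q^{\binom{n-k}{2}-\ell(\sigma)}T_\sigma$, where $\mathfrak{S}_{(1^k,n-k)}\subset\mathfrak{S}_n$ is the Young subgroup of $(1^k,n-k)$, $T_\sigma=T_{i_1}\cdots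 T_{i_r}$ for a reduced expression $\sigma=s_{i_1}\cdots s_{i_r}$, $[m]_q!=\prod_{i=1}^m\frac{1-q^i}{1-q}$. **Polynomial representation of $\mathscr{D}_n^{+}$.** $V_{\mathrm{pol}}^{(n)}=\mathbb{Q}(q,t)[x_1,\dots,x_n]$ with $T_i(f)=s_i(f)+(1-q)x_i\frac{f-s_i(f)}{x_i-x_{i+1}}$, $\pi(f)(x_1,\dots,x_n)=f(x_2,\dots,x_n,tx_1)$, $X_i(f)=x_if$. **The algebra $\mathbb{B}_{q,t}$.** It is the path algebra generated by orthogonal idempotents $e_k$ ($k\in\mathbb{Z}_{\ge0}$) and, at each vertex $k$, generators $T_1,\dots,T_{k-1}$ and $z_1,\dots,z_k$ (from $k$ to $k$), $d_+$ (from $k$ to $k+1$), $d_-$ (from $k$ to $k-1$, for $k\ge1$), modulo the following relations (where $k$ denotes the source vertex, operators composing right to left): $(T_i-1)(T_i+q)=0$; $T_iT_{i+1}T_i=T_{i+1}T_iT_{i+1}$; $T_iT_j=T_jT_i$ if $|i-j|>1$; $T_i^{-1}z_{i+1}T_i^{-1}=q^{-1}z_i$ for $1\le i\le k-1$; $z_iT_j=T_jz_i$ if $i\notin\{j,j+1\}$; $z_iz_j=z_jz_i$ for $1\le i,j\le k$; $d_-^2T_{k-1}=d_-^2$ for $k\ge2$; $d_-T_i=T_id_-$ for $1\le i\le k-2$; $T_1d_+^2=d_+^2$; $d_+T_i=T_{i+1}d_+$ for $1\le i\le k-1$; $q\varphi d_-=d_-\varphi T_{k-1}$ for $k\ge2$;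 $T_1\varphi d_+=qd_+\varphi$ for $k\ge1$; $z_id_-=d_-z_i$ (for $1\le i\le k-1$); $d_+z_i=z_{i+1}d_+$ (for $1\le i\le k$); $z_1(qd_+d_--d_-d_+)=qt(d_+d_--d_-d_+)z_k$ for $k\ge1$; where $\varphi=\frac{1}{q-1}[d_+,d_-]$. $\mathbb{B}_{q,t}^{(n)}$ is the subalgebra of $\mathbb{B}_{q,t}$ given by only considering $T_i,z_i,d_-,d_+$ between the idempotents labelled $0,\dots,n$. **The module $L_\bullet(V)$.** For a graded $\mathscr{D}_n^{+}$-module $V$ put $L_k(V)=X_1\cdots X_k\,\epsilon_k(V)$ and $L_\bullet(V)=\bigoplus_{0\le k\le n}L_k(V)$. It is a $\mathbb{B}_{q,t}^{(n)}$-module with $e_k$ the projection onto $L_k(V)$ and, for $v\in L_k(V)$: $T_i(v)=T_iv$; $z_i(v)=(qt)^{-1}Y_iv$; $d_+(v)=q^kX_1T_1^{-1}\cdots T_k^{-1}v\in L_{k+1}(V)$ ($k\le n-1$); $d_-(v)=(q-1)(1+qT_k^{-1}+\cdots+q^{n-k}T_{n-1}^{-1}\cdots T_k^{-1})v\in L_{k-1}(V)$ ($k\ge1$). In particular $L_k(V_{\mathrm{pol}}^{(n)})=x_1\cdots x_k\mathbb{Q}(q,t)[x_1,\dots,x_n]^{\mathfrak{S}_{(1^k,n-k)}}$. **Almost symmetric functions.** $\Lambda$ is the ring of symmetric functions over $\mathbb{Q}(q,t)$. $\mathscr{P}_{as}^{+}=\mathbb{Q}(q,t)[x_1,x_2,\dots]\otimes\Lambda$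 is the space of almost symmetric functions, i.e. the union over $k\ge0$ of the subspaces $\mathbb{Q}(q,t)[x_1,\dots,x_k]\otimes\Lambda$ of bounded-degree series in $x_1,x_2,\dots$ that are polynomial in $x_1,\dots,x_k$ with coefficients symmetric functions in $\mathfrak{X}_k:=x_{k+1}+x_{k+2}+\cdots$. $\Xi^{(m)}:\mathscr{P}_{as}^{+}\to\mathbb{Q}(q,t)[x_1,\dots,x_m]$ is the homomorphism setting $x_{m+i}=0$ for all $i\ge1$ (restrictions of it are also denoted $\Xi^{(m)}$). Put $L_k^{\mathrm{pol}}=x_1\cdots x_k\mathbb{Q}(q,t)[x_1,\dots,x_k]\otimes\Lambda$ and $L_\bullet^{\mathrm{pol}}=\bigoplus_{k\ge0}L_k^{\mathrm{pol}}$. By known results of Ion–Wu, $L_\bullet^{\mathrm{pol}}$ is a $\mathbb{B}_{q,t}$-module (isomorphic to the Carlsson–Gorsky–Mellit polynomial representation), with $e_k$ the projection onto $L_k^{\mathrm{pol}}$ and, for $f\in L_k^{\mathrm{pol}}$: - $T_i(f)=s_i(f)+(1-q)x_i\frac{f-s_i(f)}{x_i-x_{i+1}}$ for $1\le i\le k-1$; - $d_+(f)=q^kX_1T_1^{-1}\cdots T_k^{-1}(f)\in L_{k+1}^{\mathrm{pol}}$, where $X_1$ is multiplication by $x_1$ and, for every $i\ge1$, $T_i$ is the operator $g\mapsto s_i(g)+(1-q)x_i\frac{g-s_i(g)}{x_i-x_{i+1}}$ on $\mathscr{P}_{as}^{+}$, with $s_i$ swapping $x_i$ and $x_{i+1}$;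 - $d_-:L_{k+1}^{\mathrm{pol}}\to L_k^{\mathrm{pol}}$ is given by $d_-(x_1^{a_1}\cdots x_{k+1}^{a_{k+1}}F[\mathfrak{X}_{k+1}])=-x_1^{a_1}\cdots x_k^{a_k}\,u^{a_{k+1}}F[\mathfrak{X}_k-u]\,\mathrm{Exp}[(1-q)u^{-1}\mathfrak{X}_k]\big|_{u^0}$ in plethystic notation, with $\mathrm{Exp}[X]=\sum_{r\ge0}h_r[X]$ and $|_{u^0}$ the coefficient of $u^0$; - $z_i(f)=(qt)^{-1}\lim_m\widetilde{Y}_i^{(m)}\Xi^{(m)}(f)$ for $1\le i\le k$. Here the deformed Cherednik operators $\widetilde{Y}_i^{(m)}$ on $\mathbb{Q}(q,t)[x_1,\dots,x_m]$ are $\widetilde{Y}_1^{(m)}=\rho\circ Y_1^{(m)}$, $\widetilde{Y}_{i+1}^{(m)}=q^{-1}T_i\widetilde{Y}_i^{(m)}T_i$, where $Y_1^{(m)}$ is the operator of $Y_1\in\mathscr{D}_m^+$ on $V_{\mathrm{pol}}^{(m)}$ and $\rho$ is the linear map fixing monomials divisible by $x_1$ and killing all other monomials. The Ion–Wu limit: a sequence $f_m\in\mathbb{Q}(q,t)[x_1,\dots,x_m]$ (defined for $m$ large) has limit $h+\sum_{j=1}^Nc_jg_j$ if there are $h,g_1,\dots,g_N\in\mathscr{P}_{as}^{+}$ and scalars $c_j^{(m)}\in\mathbb{Q}(q,t)$ converging $q$-adically to $c_j\in\mathbb{Q}(q,t)$ such that $f_m=\Xi^{(m)}(h)+\sum_jc_j^{(m)}\Xi^{(m)}(g_j)$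 for all large $m$. The map $\Xi^{(n)}_\bullet$ sends $f\in L_k^{\mathrm{pol}}$ to $\Xi^{(n)}(f)\in L_k(V_{\mathrm{pol}}^{(n)})$ for $k\le n$ (and to $0$ for $k>n$). *)

(* Defs.v *)
From HB Require Import structures.
From Stdlib Require Import ClassicalEpsilon.
From mathcomp Require Import all_boot all_order all_fingroup all_algebra.
From mathcomp Require Import boolp.
From mathcomp.multinomials Require Import mpoly.

Set Implicit Arguments.
Unset Strict Implicit.
Unset Printing Implicit Defensive.

Import GRing.Theory.

Local Open Scope ring_scope.

(* A monomial in countably many variables is given by its exponents, a finitely
   supported sequence of naturals.  These are encoded in {poly nat}: e`_i is the
   exponent of the variable of index i, and multiplying monomials is adding
   exponents. *)
Notation expo := {poly nat}.

Definition edeg (e : expo) : nat := (\sum_(i < size e) e`_i)%R.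

Definition splits (e : expo) : seq (expo * expo) :=
  [seq (\poly_(i < size e) (oapp (fun j => h j : nat) 0%N (insub i)),
        \poly_(i < size e) ((e`_i)%R - oapp (fun j => h j : nat) 0 (insub i))%N)
  | h : {dffun forall i : 'I_(size e), 'I_(e`_i)%R.+1}].

Lemma mem_splits e p : (p \in splits e) = (p.1 + p.2 == e).
Proof.
apply/imageP/eqP => [[h _ ->] /= |].
  apply/polyP => i; rewrite coefD !coef_poly.
  case: ltnP => [lti|lei]; last by rewrite nth_default.
  rewrite insubT /=; apply: subnKC; rewrite -ltnS; exact: ltn_ord.
case: p => a b /= Ee.
have hle (i : nat) : ((a`_i)%R <= (e`_i)%R)%N by rewrite -Ee coefD; apply: leq_addr.
have sz0 i : (size e <= i)%N -> a`_i = 0.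
  by move=> le; apply/eqP; rewrite -leqn0 -[X in (_ <= X)%N](nth_default 0 le).
exists (finfun (fun i : 'I_(size e) =>
  Ordinal (hle i : ((a`_i)%R < (e`_i)%R.+1)%N))) => //.
congr pair; apply/polyP => i; rewrite coef_poly.
  case: ltnP => [lti|lei]; last by rewrite sz0.
  by rewrite insubT /= ffunE.
case: ltnP => [lti|lei].
  by rewrite insubT /= ffunE /= -Ee coefD; apply/esym/addKn.
have := nth_default 0 lei; rewrite -Ee coefD => /eqP.
by rewrite [_ == _]addn_eq0 => /andP[_ /eqP].
Qed.

Lemma splits_uniq e : uniq (splits e).
Proof.
rewrite map_inj_uniq ?enum_uniq // => h1 h2 [/polyP E _].
apply/ffunP => i; apply/val_inj.
by have := E i; rewrite !coef_poly ltn_ord valK.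
Qed.

(* Formal power series in countably many variables. *)
Section Series.
Variable R : comNzRingType.

Definition series : Type := expo -> R.

HB.instance Definition _ := gen_eqMixin series.
HB.instance Definition _ := gen_choiceMixin series.

Implicit Types f g h : series.

Definition series_add f g : series := fun e => f e + g e.
Definition series_opp f : series := fun e => - f e.
Definition series_mul f g : series := fun e => \sum_(p <- splits e) f p.1 * g p.2.
Definition series_scale (c : R) f : series := fun e => c * f e.
Definition series_one : series := fun e => (e == 0)%:R.

Fact series_addA : associative series_add.
Proof. by move=> f g h; apply: funext => e; apply: addrA. Qed.
Fact series_addC : commutative series_add.
Proof. by move=> f g; apply: funext => e; apply: addrC. Qed.
Fact series_add0 : left_id (fun=> 0) series_add.
Proof. by move=> f; apply: funext => e; apply: add0r. Qed.
Fact series_addN : left_inverse (fun=> 0) series_opp series_add.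
Proof. by move=> f; apply: funext => e; apply: addNr. Qed.

HB.instance Definition _ :=
  GRing.isZmodule.Build series series_addA series_addC series_add0 series_addN.

Fact series_mulC : commutative series_mul.
Proof.
move=> f g; apply: funext => e; rewrite /series_mul.
pose sw (p : expo * expo) := (p.2, p.1).
rewrite [RHS](perm_big (map sw (splits e))) ?big_map /=.
  by apply: eq_bigr => p _; apply: mulrC.
have swI : injective sw by move=> [a b] [c d] [-> ->].
apply: uniq_perm; rewrite ?(map_inj_uniq swI) ?splits_uniq //.
move=> [a b]; rewrite mem_splits /=; apply/idP/mapP => [/eqP E|].
  by exists (b, a) => //; rewrite mem_splits /= addrC E.
by move=> [[c d]]; rewrite mem_splits /= => /eqP <- [-> ->]; rewrite addrC.
Qed.

Fact series_mulA : associative series_mul.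
Proof.
move=> f g h; apply: funext => e; rewrite /series_mul.
pose F (x : expo * expo * expo) := f x.1.1 * g x.1.2 * h x.2.
pose L := [seq (p.1, r.1, r.2) | p <- splits e, r <- splits p.2].
pose M := [seq (r.1, r.2, p.2) | p <- splits e, r <- splits p.1].
transitivity (\sum_(x <- L) F x).
  rewrite big_allpairs_dep; apply: eq_bigr => p _.
  by rewrite mulr_sumr; apply: eq_bigr => r _; rewrite mulrA.
transitivity (\sum_(x <- M) F x); last first.
  rewrite big_allpairs_dep; apply: eq_bigr => p _.
  by rewrite mulr_suml; apply: eq_bigr.
apply: perm_big; apply: uniq_perm.
- apply: allpairs_uniq_dep; [exact: splits_uniq|by move=> *; exact: splits_uniq|].
  move=> x y /allpairsPdep[[a b] [[c d] [_ H ->]]].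
  move=> /allpairsPdep[[a' b'] [[c' d'] [_ H' ->]]] /=; move: H H'.
  by rewrite !mem_splits /= => /eqP <- /eqP <- [-> -> ->].
- apply: allpairs_uniq_dep; [exact: splits_uniq|by move=> *; exact: splits_uniq|].
  move=> x y /allpairsPdep[[a b] [[c d] [_ H ->]]].
  move=> /allpairsPdep[[a' b'] [[c' d'] [_ H' ->]]] /=; move: H H'.
  by rewrite !mem_splits /= => /eqP <- /eqP <- [-> -> ->].
move=> [[a b] c]; apply/allpairsPdep/allpairsPdep.
  move=> [[u v] [[w x] [+ + [-> -> ->]]]].
  rewrite !mem_splits /= => /eqP <- /eqP <-.
  by exists (u + w, x), (u, w); rewrite !mem_splits /= addrA.
move=> [[u v] [[w x] [+ + [-> -> ->]]]].
rewrite !mem_splits /= => /eqP <- /eqP <-.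
by exists (w, x + v), (x, v); rewrite !mem_splits /= addrA.
Qed.

Fact series_mul1 : left_id series_one series_mul.
Proof.
move=> f; apply: funext => e; rewrite /series_mul.
rewrite (bigD1_seq (0, e)) ?splits_uniq ?mem_splits /= ?add0r //.
rewrite /series_one eqxx mul1r big1_seq ?addr0 // => -[a b].
rewrite mem_splits /= => /andP[+ /eqP Eab]; subst e.
by case: (a =P 0) => [->|_]; rewrite ?add0r ?eqxx ?mul0r.
Qed.

Fact series_mulD : left_distributive series_mul series_add.
Proof.
move=> f g h; apply: funext => e; rewrite /series_mul /series_add -big_split /=.
by apply: eq_bigr => p _; apply: mulrDl.
Qed.

Fact series_1neq0 : series_one != 0.
Proof.
apply/eqP => /(congr1 (fun f : series => f 0)) /eqP.
by rewrite /series_one eqxx oner_eq0.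
Qed.

HB.instance Definition _ :=
  GRing.Zmodule_isComNzRing.Build series
    series_mulA series_mulC series_mul1 series_mulD series_1neq0.

Fact series_scaleA a b f : series_scale a (series_scale b f) = series_scale (a * b) f.
Proof. by apply: funext => e; apply: mulrA. Qed.
Fact series_scale1 : left_id 1 series_scale.
Proof. by move=> f; apply: funext => e; apply: mul1r. Qed.
Fact series_scaleDr : right_distributive series_scale +%R.
Proof. by move=> c f g; apply: funext => e; apply: mulrDr. Qed.
Fact series_scaleDl f : {morph series_scale^~ f : a b / a + b}.
Proof. by move=> a b; apply: funext => e; apply: mulrDl. Qed.

HB.instance Definition _ := GRing.Zmodule_isLmodule.Build R series
  series_scaleA series_scale1 series_scaleDr series_scaleDl.

Fact series_scaleAl (c : R) f g : c *: (f * g) = c *: f * g.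
Proof.
apply: funext => e; rewrite /GRing.scale /GRing.mul /= /series_scale /series_mul.
by rewrite mulr_sumr; apply: eq_bigr => p _; rewrite mulrA.
Qed.

HB.instance Definition _ :=
  GRing.Lmodule_isLalgebra.Build R series series_scaleAl.
HB.instance Definition _ := GRing.Lalgebra_isComAlgebra.Build R series.

End Series.

Definition Qqt : fieldType := {fraction {mpoly rat[2]}}.
Definition q : Qqt := tofrac ('X_(@Ordinal 2 0 isT)).
Definition t : Qqt := tofrac ('X_(@Ordinal 2 1 isT)).


(* The quotient p / d when d divides p, in a ring where d is regular. *)
Definition exact_quot (A : nzRingType) (p d : A) : A :=
  epsilon (inhabits 0) (fun h => d * h = p).

(* The operator f |-> s f + (1 - q) x (f - s f) / (x - y); its inverse is obtained
   from the relation (T - 1)(T + q) = 0. *)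
Definition demazure_lusztig (A : comAlgType Qqt) (s : A -> A) (x y f : A) : A :=
  s f + (1 - q) *: (x * exact_quot (f - s f) (x - y)).

Definition demazure_lusztig_inv (A : comAlgType Qqt) (s : A -> A) (x y f : A) : A :=
  q^-1 *: (demazure_lusztig s x y f + (q - 1) *: f).

(* The indices of the variables and of T_i, Y_i, z_i start from 0, so that T_i
   involves the variables of indices i and i.+1; vertices k and numbers of variables
   are not shifted.  Formulas in comments keep the usual indices from 1. *)

Section PolynomialRepresentation.
Variable n : nat.
Implicit Types p : {mpoly Qqt[n]}.

Definition xv (i : nat) : {mpoly Qqt[n]} := oapp (fun j : 'I_n => 'X_j) 0 (insub i).

Definition transp (i : nat) : 'S_n :=
  if (insub i, insub i.+1) is (Some a, Some b) then tperm a b else 1%g.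

Definition Tv i p := demazure_lusztig (msym (transp i)) (xv i) (xv i.+1) p.
Definition Tv_inv i p := demazure_lusztig_inv (msym (transp i)) (xv i) (xv i.+1) p.

Definition piv p : {mpoly Qqt[n]} :=
  mmap (@mpolyC n Qqt)
       (fun i : 'I_n => if i.+1 == n then t *: xv 0 else xv i.+1) p.

(* Y_1 = q^n pi T_{n-1}^-1 ... T_1^-1 since pi = q^-n Y_1 T_1 ... T_{n-1}. *)
Definition Yv0 p : {mpoly Qqt[n]} := q ^+ n *: piv (foldr Tv_inv p (rev (iota 0 n.-1))).

Fixpoint Yv i p : {mpoly Qqt[n]} :=
  if i is j.+1 then q^-1 *: Tv j (Yv j (Tv j p)) else Yv0 p.

Definition is_word (s : 'S_n) (w : seq nat) : Prop :=
  all (fun i => i.+1 < n)%N w /\ s = (\prod_(i <- w) transp i)%g.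

Definition reduced_word (s : 'S_n) : seq nat :=
  epsilon (inhabits [::]) (fun w =>
    is_word s w /\ forall w', is_word s w' -> (size w <= size w')%N).

Definition perm_length (s : 'S_n) : nat := size (reduced_word s).

Definition Tv_perm (s : 'S_n) p : {mpoly Qqt[n]} := foldr Tv p (reduced_word s).

Definition qfact (m : nat) : Qqt := \prod_(1 <= i < m.+1) ((1 - q ^+ i) / (1 - q)).

Definition eps (k : nat) p : {mpoly Qqt[n]} :=
  (qfact (n - k))^-1 *:
    \sum_(s : 'S_n | [forall i : 'I_n, (i < k)%N ==> (s i == i)])
      (q ^+ 'C(n - k, 2) / q ^+ perm_length s) *: Tv_perm s p.

Definition inLV (k : nat) p : Prop :=
  exists v, p = \prod_(i < k) xv i * eps k v.

Definition zv i p : {mpoly Qqt[n]} := (q * t)^-1 *: Yv i p.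

(* From L_k to L_{k+1}. *)
Definition dplusv k p : {mpoly Qqt[n]} :=
  q ^+ k *: (xv 0 * foldr Tv_inv p (iota 0 k)).

(* From L_{k+1} to L_k. *)
Definition dminusv k p : {mpoly Qqt[n]} :=
  (q - 1) *: \sum_(j < n - k) q ^+ j *: foldr Tv_inv p (rev (iota k j)).

End PolynomialRepresentation.

Notation Sqt := (series Qqt).

Definition xs (i : nat) : Sqt := fun e => (e == 'X^i)%:R.

Definition swap_series (i : nat) (f : Sqt) : Sqt := fun e =>
  f (\poly_(j < size e + i.+2) e`_([fun j => j with i |-> i.+1, i.+1 |-> i] j)).

Definition bounded_degree (f : Sqt) : Prop :=
  exists d, forall e, (d <= edeg e)%N -> f e = 0.

(* The ring of symmetric functions in the variables of indices 0, 1, ... *)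
Definition is_symfun (F : Sqt) : Prop :=
  bounded_degree F /\ forall i, swap_series i F = F.

(* F[X_k], i.e. F in the variables of indices k, k+1, ... *)
Definition in_tail (k : nat) (F : Sqt) : Sqt := fun e =>
  if take_poly k e == 0 then F (drop_poly k e) else 0.

Definition xmon k (a : 'X_{1..k}) : Sqt := \prod_(i < k) xs i ^+ a i.

(* A finite sum of terms x_1^{a_1} ... x_k^{a_k} F[X_k]. *)
Definition expand k (s : seq ('X_{1..k} * Sqt)) : Sqt :=
  \sum_(p <- s) xmon p.1 * in_tail k p.2.

(* Q(q,t)[x_1, ..., x_k] (x) Lambda. *)
Definition inPas_k k (f : Sqt) : Prop :=
  exists s : seq ('X_{1..k} * Sqt),
    (forall p, p \in s -> is_symfun p.2) /\ f = expand s.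

Definition inPas (f : Sqt) : Prop := exists k, inPas_k k f.

Definition inLpol k (f : Sqt) : Prop :=
  exists2 g, inPas_k k g & f = \prod_(i < k) xs i * g.

Definition Ts i (f : Sqt) : Sqt :=
  demazure_lusztig (swap_series i) (xs i) (xs i.+1) f.
Definition Ts_inv i (f : Sqt) : Sqt :=
  demazure_lusztig_inv (swap_series i) (xs i) (xs i.+1) f.

Definition expo_of_mnm m (a : 'X_{1..m}) : expo := \sum_(i < m) 'X^i *+ a i.

(* Setting to 0 the variables of indices m, m+1, ... *)
Definition Xi m (f : Sqt) : {mpoly Qqt[m]} :=
  epsilon (inhabits 0) (fun p => forall a, p@_a = f (expo_of_mnm a)).

Definition psum (r : nat) : Sqt := fun e =>
  [exists i : 'I_(size e), e == 'X^i *+ r]%:R.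

Definition hsym (r : nat) : Sqt := fun e => (edeg e == r)%:R.

(* The image of the symmetric function F under the ring homomorphism from Lambda,
   the polynomial ring on the power sums, to A that is h on scalars and maps the
   r-th power sum to a r for r > 0. *)
Definition plethysm (A : comNzRingType) (h : Qqt -> A) (a : nat -> A) (F : Sqt) : A :=
  epsilon (inhabits 0) (fun y => exists N (P : {mpoly Qqt[N]}),
    F = mmap (fun c => c%:A) (fun j : 'I_N => psum j.+1) P /\
    y = mmap h (fun j : 'I_N => a j.+1) P).

(* F[X_k - u], as a polynomial in u. *)
Definition pleth_sub k (F : Sqt) : {poly Sqt} :=
  plethysm (fun c => (c%:A)%:P) (fun r => (in_tail k (psum r))%:P - 'X^r) F.

(* h_r[(1 - q) X_k]. *)
Definition pleth_h k (r : nat) : Sqt :=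
  plethysm (fun c => c%:A) (fun r => (1 - q ^+ r) *: in_tail k (psum r)) (hsym r).

(* Minus x_1^{a_1} ... x_k^{a_k} times the coefficient of u^0 in
   u^{a_{k+1}} F[X_k - u] Exp[(1 - q) u^-1 X_k], the coefficient of u^-r in the last
   factor being h_r[(1 - q) X_k]. *)
Definition dminus_term k (a : 'X_{1..k.+1}) (F : Sqt) : Sqt :=
  let U := 'X^(a ord_max) * pleth_sub k F in
  - (\prod_(i < k) xs i ^+ a (widen_ord (leqnSn k) i)
     * \sum_(r < size U) U`_r * pleth_h k r).

(* From L_{k+1} to L_k. *)
Definition dminus_s k (f : Sqt) : Sqt :=
  epsilon (inhabits 0) (fun g => exists s : seq ('X_{1..k.+1} * Sqt),
    [/\ forall p, p \in s -> (forall i, (0 < p.1 i)%N) /\ is_symfun p.2,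
        f = expand s
      & g = \sum_(p <- s) dminus_term p.1 p.2]).

(* From L_k to L_{k+1}. *)
Definition dplus_s k (f : Sqt) : Sqt :=
  q ^+ k *: (xs 0 * foldr Ts_inv f (iota 0 k)).

Definition rho m (p : {mpoly Qqt[m]}) : {mpoly Qqt[m]} :=
  \sum_(a <- msupp p | [exists i : 'I_m, (i == 0 :> nat) && (0 < a i)%N])
    p@_a *: 'X_[a].

Fixpoint Ydef m i (p : {mpoly Qqt[m]}) : {mpoly Qqt[m]} :=
  if i is j.+1 then q^-1 *: Tv j (Ydef j (Tv j p)) else rho (Yv 0 p).

(* c lies in q^N times the localization of Q[q,t] at the prime ideal (q). *)
Definition qadic_ge (N : nat) (c : Qqt) : Prop :=
  exists a b : {mpoly rat[2]},
    ~ (exists b', b = 'X_(@Ordinal 2 0 isT) * b') /\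
    c = q ^+ N * (tofrac a / tofrac b).

Definition qadic_cvg (u : nat -> Qqt) (c : Qqt) : Prop :=
  forall N, exists m0, forall m, (m0 <= m)%N -> qadic_ge N (u m - c).

Definition is_IW_limit (f : forall m, {mpoly Qqt[m]}) (l : Sqt) : Prop :=
  exists (h : Sqt) (N : nat) (g : 'I_N -> Sqt)
         (cs : 'I_N -> nat -> Qqt) (c : 'I_N -> Qqt),
    [/\ inPas h /\ (forall j, inPas (g j)),
        forall j, qadic_cvg (cs j) (c j),
        exists m0, forall m, (m0 <= m)%N ->
          f m = Xi m h + \sum_j cs j m *: Xi m (g j)
      & l = h + \sum_j c j *: g j].

Definition IW_limit (f : forall m, {mpoly Qqt[m]}) : Sqt :=
  epsilon (inhabits 0) (is_IW_limit f).

Definition zs i (f : Sqt) : Sqt :=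
  (q * t)^-1 *: IW_limit (fun m => Ydef i (Xi m f)).

(* Source and target of the generators: e_k, T_i and z_i go from k to k, d_+ from k
   to k+1, and Gdm k is the generator d_- from k+1 to k. *)
Inductive Bgen : Type :=
| Ge (k : nat)
| GT (k : nat) (i : 'I_k.-1)
| Gz (k : nat) (i : 'I_k)
| Gdp (k : nat)
| Gdm (k : nat).

Definition source (g : Bgen) : nat :=
  match g with
  | Ge k => k | GT k _ => k | Gz k _ => k | Gdp k => k | Gdm k => k.+1
  end.

Definition target (g : Bgen) : nat :=
  match g with
  | Ge k => k | GT k _ => k | Gz k _ => k | Gdp k => k.+1 | Gdm k => k
  end.

Inductive Bexpr : Type :=
| Bgenerator (g : Bgen)
| Badd (a b : Bexpr)
| Bscale (c : Qqt) (a : Bexpr)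
| Bmul (a b : Bexpr).

Declare Scope B_scope.
Delimit Scope B_scope with B.
Bind Scope B_scope with Bexpr.
Coercion Bgenerator : Bgen >-> Bexpr.
Notation "a + b" := (Badd a b) : B_scope.
Notation "a - b" := (Badd a (Bscale (- 1) b)) : B_scope.
Notation "c *: a" := (Bscale c%R a) : B_scope.
Notation "a * b" := (Bmul a b) : B_scope.

(* The inverse of T_i at vertex k, by the quadratic relation. *)
Definition BTinv k (i : 'I_k.-1) : Bexpr := (q^-1 *: (GT i + (q - 1) *: Ge k))%B.

(* d_+ d_- - d_- d_+ and phi, at the vertex k+1. *)
Definition Bcomm k : Bexpr := (Gdp k * Gdm k - Gdm k.+1 * Gdp k.+1)%B.
Definition Bphi k : Bexpr := ((q - 1)^-1 *: Bcomm k)%B.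

Reserved Notation "a =B b" (at level 70, no associativity).

Inductive Beq : Bexpr -> Bexpr -> Prop :=
| Beq_refl a : a =B a
| Beq_sym a b : a =B b -> b =B a
| Beq_trans a b c : a =B b -> b =B c -> a =B c
| Beq_add a a' b b' : a =B a' -> b =B b' -> (a + b =B a' + b')%B
| Beq_scale c a a' : a =B a' -> (c *: a =B c *: a')%B
| Beq_mul a a' b b' : a =B a' -> b =B b' -> (a * b =B a' * b')%B
| Beq_addA a b c : (a + (b + c) =B a + b + c)%B
| Beq_addC a b : (a + b =B b + a)%B
| Beq_add0 a b : (a + 0 *: b =B a)%B
| Beq_scaleA c d a : (c *: (d *: a) =B (c * d) *: a)%B
| Beq_scale1 a : (1 *: a =B a)%B
| Beq_scaleDr c a b : (c *: (a + b) =B c *: a + c *: b)%B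
| Beq_scaleDl c d a : ((c + d) *: a =B c *: a + d *: a)%B
| Beq_mulA a b c : (a * (b * c) =B a * b * c)%B
| Beq_mulDl a b c : ((a + b) * c =B a * c + b * c)%B
| Beq_mulDr a b c : (a * (b + c) =B a * b + a * c)%B
| Beq_scaleAl c a b : (c *: a * b =B c *: (a * b))%B
| Beq_scaleAr c a b : (a * (c *: b) =B c *: (a * b))%B
| Beq_orth k l : k <> l -> (Ge k * Ge l =B 0 *: Ge k)%B
| Beq_source (g : Bgen) : (g * Ge (source g) =B g)%B
| Beq_target (g : Bgen) : (Ge (target g) * g =B g)%B
| Beq_quad k (i : 'I_k.-1) :
    ((GT i - Ge k) * (GT i + q *: Ge k) =B 0 *: Ge k)%B
| Beq_braid k (i j : 'I_k.-1) : j = i.+1 :> nat ->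
    (GT i * GT j * GT i =B GT j * GT i * GT j)%B
| Beq_TT k (i j : 'I_k.-1) : (i.+1 < j)%N -> (GT i * GT j =B GT j * GT i)%B
| Beq_TzT k (i : 'I_k.-1) (j j' : 'I_k) : j = i :> nat -> j' = i.+1 :> nat ->
    (BTinv i * Gz j' * BTinv i =B q^-1 *: Gz j)%B
| Beq_zT k (i : 'I_k) (j : 'I_k.-1) : i <> j :> nat -> i <> j.+1 :> nat ->
    (Gz i * GT j =B GT j * Gz i)%B
| Beq_zz k (i j : 'I_k) : (Gz i * Gz j =B Gz j * Gz i)%B
| Beq_dmdmT k :
    (Gdm k * Gdm k.+1 * @GT k.+2 ord_max =B Gdm k * Gdm k.+1)%B
| Beq_dmT k (i : 'I_k.-1) (i' : 'I_k) : i' = i :> nat ->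
    (Gdm k * @GT k.+1 i' =B GT i * Gdm k)%B
| Beq_Tdpdp k :
    (@GT k.+2 ord0 * Gdp k.+1 * Gdp k =B Gdp k.+1 * Gdp k)%B
| Beq_dpT k (i : 'I_k.-1) (i' : 'I_k) : i' = i.+1 :> nat ->
    (Gdp k * GT i =B @GT k.+1 i' * Gdp k)%B
| Beq_phidm k :
    (q *: (Bphi k * Gdm k.+1) =B Gdm k.+1 * Bphi k.+1 * @GT k.+2 ord_max)%B
| Beq_phidp k :
    (@GT k.+2 ord0 * Bphi k.+1 * Gdp k.+1 =B q *: (Gdp k.+1 * Bphi k))%B
| Beq_zdm k (i : 'I_k) (i' : 'I_k.+1) : i' = i :> nat ->
    (Gz i * Gdm k =B Gdm k * Gz i')%B
| Beq_dpz k (i : 'I_k) (i' : 'I_k.+1) : i' = i.+1 :> nat ->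
    (Gdp k * Gz i =B Gz i' * Gdp k)%B
| Beq_zcomm k :
    (@Gz k.+1 ord0 * (q *: (Gdp k * Gdm k) - Gdm k.+1 * Gdp k.+1)
       =B (q * t) *: (Bcomm k * @Gz k.+1 ord_max))%B
where "a =B b" := (Beq a b).

(* An element of B_{q,t} is the class of an expression. *)
Definition Bqt := {b : Bexpr -> Prop | exists a, b = Beq a}.

(* Expressions in the generators between the vertices 0, ..., n. *)
Fixpoint between (n : nat) (a : Bexpr) : Prop :=
  match a with
  | Bgenerator g => (source g <= n)%N /\ (target g <= n)%N
  | Badd a b | Bmul a b => between n a /\ between n b
  | Bscale _ a => between n a
  end.

(* Operators by which the generators act on a family of subspaces L_k of a vector
   space; T_i and z_i are given by the same formula at each vertex.  The relations
   are not part of the record: being a module map does not involve them. *)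
Record Brep := {
  carrier : lmodType Qqt;
  component : nat -> carrier -> Prop;
  opT : nat -> carrier -> carrier;
  opz : nat -> carrier -> carrier;
  opdp : nat -> carrier -> carrier;
  opdm : nat -> carrier -> carrier
}.

Definition in_dsum (M : Brep) (F : nat -> carrier M) : Prop :=
  (forall k, component k (F k)) /\ exists d, forall k, (d <= k)%N -> F k = 0.

Definition op (M : Brep) (g : Bgen) : carrier M -> carrier M :=
  match g with
  | Ge _ => id
  | GT _ i => opT i
  | Gz _ i => opz i
  | Gdp k => opdp k
  | Gdm k => opdm k
  end.

Fixpoint act (M : Brep) (a : Bexpr) (F : nat -> carrier M) : nat -> carrier M :=
  match a with
  | Bgenerator g => fun k => if k == target g then op g (F (source g)) else 0
  | Badd a b => fun k => act a F k + act b F k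
  | Bscale c a => fun k => c *: act a F k
  | Bmul a b => act a (act b F)
  end.

(* Linear maps between direct sums that commute with the action of every element b
   of B_{q,t}^(n), given by any expression a of b between the vertices 0, ..., n. *)
Definition is_Bn_module_map (n : nat) (M N : Brep)
    (phi : (nat -> carrier M) -> (nat -> carrier N)) : Prop :=
  [/\ forall F, in_dsum F -> in_dsum (phi F),
      forall c F G, in_dsum F -> in_dsum G ->
        phi (fun k => c *: F k + G k) =1 (fun k => c *: phi F k + phi G k)
    & forall (b : Bqt) (a : Bexpr), sval b a -> between n a ->
        forall F, in_dsum F -> phi (act a F) =1 act a (phi F)].

Definition Lpol : Brep := {|
  carrier := Sqt; component := inLpol;
  opT := Ts; opz := zs; opdp := dplus_s; opdm := dminus_s |}.

Definition LV (n : nat) : Brep := {|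
  carrier := {mpoly Qqt[n]};
  component := fun k p => if (k <= n)%N then inLV k p else p = 0;
  opT := @Tv n; opz := @zv n; opdp := @dplusv n; opdm := @dminusv n |}.

Definition Xi_bullet (n : nat) (F : nat -> carrier Lpol) : nat -> carrier (LV n) :=
  fun k => if (k <= n)%N then Xi n (F k) else 0.

(* Main.v *)
Require Import Defs.
From HB Require Import structures.
From Stdlib Require Import ClassicalEpsilon.
From mathcomp Require Import all_boot all_order all_fingroup all_algebra.
From mathcomp Require Import boolp ring zify.
From mathcomp.multinomials Require Import mpoly.

Set Implicit Arguments.
Unset Strict Implicit.
Unset Printing Implicit Defensive.

Import GRing.Theory.
Local Open Scope ring_scope.

(* Setting variables to 0 is a ring homomorphism that commutes with the swaps, hence with
   T_i and d_+, which are given by the same formulas for series and for polynomials.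

   On a multiple of x_1 the projection rho changes nothing, so on L_k the deformed
   operators are the Y_i themselves.  There the map r setting x_{m+1} = 0 intertwines
   Y_i^(m+1) and Y_i^(m), because r pi^(m+1) T_m = pi^(m) r.  So the limit defining z_i is
   an inverse limit, and it is reached in each truncation.

   Both forms of d_- are linear over the series, or polynomials, symmetric in the variables
   of indices greater than k.  This leaves the powers x_{k+1}^b with b > 0, which the
   plethystic form, truncated, maps to -h_b[(1 - q)(x_{k+1} + ... + x_n)].  This h_b is the
   sum of the differences h_b[(1 - q)(x_{k+1} + ... + x_{k+m+1})] - h_b[(1 - q)(x_{k+1} + ...
   + x_{k+m})], and q T_{k+m+1}^-1 maps each of these differences to the next, which yields
   the sum defining d_- in finitely many variables. *)

(** * Demazure-Lusztig operators *)

(** Truncation, division by x_i - x_{i+1}, plethysm, the limit and d_- on series are all defined by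
    choice, so each is first tied to a property that controls what was chosen. For T_i this is its
    defining equation cleared of the denominator; for the limit it is uniqueness, coefficient by
    coefficient. For plethysm and d_- the expression actually chosen is kept throughout, and its
    truncation turns out to equal an operator in which the choice no longer occurs. Candidates for
    the plethysm exist because symmetric functions are polynomials in the power sums in
    characteristic 0, which is derived from Euler's identity.

    The alphabet (1 - q)(x_{k+1} + ... + x_n) is a difference of lists of letters, not a list.
    Recursions for h_b are therefore proved for L1 + m L2 with m a natural number, where they are
    statements about monomials, and carried to m = -1 as polynomial identities in m.

    A product of generators is compared factor by factor, so stability of the series components L_k
    under every generator has to be proved along with the compatibility. *)

Lemma scale_in_alg (R : nzRingType) (A : lalgType R) (c : R) (u : A) :
  c *: u = in_alg A c * u.
Proof. by rewrite in_algE mulr_algl. Qed.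

(** Series and polynomials share these properties, so the facts on T_i are proved once for both.
    [swap_div] makes the chosen quotient in [demazure_lusztig] exist and [swap_reg] makes it
    unique. *)
Record swap_datum (A : comAlgType Qqt) (s : A -> A) (x y : A) : Prop := {
  swap_linear : forall (c : Qqt) f g, s (c *: f + g) = c *: s f + s g;
  swapM : forall f g, s (f * g) = s f * s g;
  swapK : forall f, s (s f) = f;
  swap_x : s x = y;
  swap_reg : forall h, (x - y) * h = 0 -> h = 0;
  swap_div : forall f, exists h, (x - y) * h = f - s f }.

Lemma mpolyX_neq0 (R : nzRingType) n (m : 'X_{1..n}) : 'X_[R, m] != 0.
Proof. by rewrite -msupp_eq0 msuppX. Qed.

Lemma q_neq0 : q != 0.
Proof. by rewrite /q tofrac_eq0 mpolyX_neq0. Qed.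

Lemma t_neq0 : t != 0.
Proof. by rewrite /t tofrac_eq0 mpolyX_neq0. Qed.

Section DemazureLusztig.
Variables (A : comAlgType Qqt) (s : A -> A) (x y : A).
Hypothesis dl : swap_datum s x y.
Let T := demazure_lusztig s x y.
Let Ti := demazure_lusztig_inv s x y.
Implicit Types f g h : A.

Lemma swapD f g : s (f + g) = s f + s g.
Proof. by have := swap_linear dl 1 f g; rewrite !scale1r. Qed.

Lemma swap0 : s 0 = 0.
Proof. by apply: (@addrI _ (s 0)); rewrite -swapD !addr0. Qed.

Lemma swapZ c f : s (c *: f) = c *: s f.
Proof. by have := swap_linear dl c f 0; rewrite swap0 !addr0. Qed.

Lemma swapB f g : s (f - g) = s f - s g.
Proof. by rewrite swapD -scaleN1r swapZ scaleN1r. Qed.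

Lemma swap_y : s y = x.
Proof. by rewrite -(swap_x dl) (swapK dl). Qed.

Lemma swap_regI f g : (x - y) * f = (x - y) * g -> f = g.
Proof.
move=> E; apply/eqP; rewrite -subr_eq0; apply/eqP; apply: (swap_reg dl).
by rewrite mulrBr E subrr.
Qed.

(** Clearing the denominator removes the chosen quotient. As x - y is regular, this equation
    determines T f, and later identities for T are checked on it by ring computations. *)
Lemma demazure_lusztigP f :
  (x - y) * T f = (q *: x - y) * s f + (1 - q) *: (x * f).
Proof.
rewrite /T /demazure_lusztig mulrDr -scalerAr mulrCA.
have -> : (x - y) * exact_quot (f - s f) (x - y) = f - s f.
  exact: (epsilon_spec (inhabits 0) _ (swap_div dl f)).
rewrite !scale_in_alg !(rmorphB, rmorph1) /=; ring.
Qed.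

Lemma demazure_lusztigE f g :
  (x - y) * g = (q *: x - y) * s f + (1 - q) *: (x * f) -> g = T f.
Proof. by move=> E; apply: swap_regI; rewrite demazure_lusztigP. Qed.

Lemma T_linear c f g : T (c *: f + g) = c *: T f + T g.
Proof.
apply/esym/demazure_lusztigE; rewrite mulrDr -scalerAr !demazure_lusztigP.
rewrite (swap_linear dl).
rewrite !scale_in_alg !(rmorphB, rmorph1) /=.
ring.
Qed.

Lemma T_mull f g : s f = f -> T (f * g) = f * T g.
Proof.
move=> sf; apply/esym/demazure_lusztigE; rewrite mulrCA demazure_lusztigP.
rewrite (swapM dl) sf !scale_in_alg !(rmorphB, rmorph1) /=; ring.
Qed.

Lemma T_fix f : s f = f -> T f = f.
Proof.
move=> sf; apply/esym/demazure_lusztigE.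
rewrite sf !scale_in_alg !(rmorphB, rmorph1) /=; ring.
Qed.

Lemma Tinv_linear c f g : Ti (c *: f + g) = c *: Ti f + Ti g.
Proof.
rewrite /Ti /demazure_lusztig_inv -/T T_linear !scale_in_alg; ring.
Qed.

Lemma Tinv_D f g : Ti (f + g) = Ti f + Ti g.
Proof. by have := Tinv_linear 1 f g; rewrite !scale1r. Qed.

Lemma Tinv_0 : Ti 0 = 0.
Proof. by apply: (@addrI _ (Ti 0)); rewrite -Tinv_D !addr0. Qed.

Lemma Tinv_Z c f : Ti (c *: f) = c *: Ti f.
Proof. by have := Tinv_linear c f 0; rewrite Tinv_0 !addr0. Qed.

Lemma Tinv_mull f g : s f = f -> Ti (f * g) = f * Ti g.
Proof.
move=> sf; rewrite /Ti /demazure_lusztig_inv -/T T_mull // !scale_in_alg; ring.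
Qed.

Lemma qTinvP f : q *: Ti f = T f + (q - 1) *: f.
Proof. by rewrite /Ti /demazure_lusztig_inv scalerA mulfV ?q_neq0 // scale1r. Qed.

(** This is the relation T_i^-1 X_i T_i^-1 = q^-1 X_{i+1} of the double affine Hecke algebra,
    multiplied on the right by T_i. *)
Lemma Tinv_x g : Ti (x * g) = q^-1 *: (y * T g).
Proof.
apply: (scalerI q_neq0); rewrite qTinvP scalerA mulfV ?q_neq0 // scale1r.
apply: swap_regI; rewrite mulrDr demazure_lusztigP [(x - y) * (y * _)]mulrCA demazure_lusztigP.
rewrite (swapM dl) (swap_x dl).
rewrite !scale_in_alg !(rmorphB, rmorph1) /=.
ring.
Qed.

End DemazureLusztig.

(** The image under phi of the cleared equation for f is the cleared equation for phi f. Truncation,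
    inclusion of polynomials into series, restriction to one variable less and distant swaps are all
    handled by this lemma. *)
Lemma T_morph (A B : comAlgType Qqt) (sA : A -> A) (sB : B -> B) xA yA xB yB
    (phi : A -> B) :
  swap_datum sA xA yA -> swap_datum sB xB yB ->
  (forall c f g, phi (c *: f + g) = c *: phi f + phi g) ->
  (forall f g, phi (f * g) = phi f * phi g) ->
  phi xA = xB -> phi yA = yB ->
  forall f, phi (sA f) = sB (phi f) ->
  phi (demazure_lusztig sA xA yA f) = demazure_lusztig sB xB yB (phi f).
Proof.
move=> dA dB phiL phiM Ex Ey f Es; apply: (demazure_lusztigE dB).
have phiD g h : phi (g + h) = phi g + phi h by have := phiL 1 g h; rewrite !scale1r.
have phi0 : phi 0 = 0 by apply: (@addrI _ (phi 0)); rewrite -phiD !addr0.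
have phiZ c g : phi (c *: g) = c *: phi g by have := phiL c g 0; rewrite phi0 !addr0.
have phiB g h : phi (g - h) = phi g - phi h by rewrite phiD -scaleN1r phiZ scaleN1r.
rewrite -Ex -Ey -phiB -phiM (demazure_lusztigP dA).
by rewrite phiD phiM phiB !phiZ !phiM Es.
Qed.

(** * Power series in countably many variables *)

Lemma expoD (a b : expo) i : (a + b)`_i = ((a`_i)%R + (b`_i)%R)%N.
Proof. exact: coefD. Qed.

Lemma expoX i j : ('X^i : expo)`_j = nat_of_bool (j == i).
Proof. by rewrite coefXn; case: (j == i). Qed.

Lemma expo_sub (u e : expo) :
  (forall j, ((u`_j)%R <= (e`_j)%R)%N) -> exists e', e = u + e'.
Proof.
move=> le; exists (\poly_(j < size e) ((e`_j)%R - (u`_j)%R)%N).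
apply/polyP => j; rewrite coefD coef_poly; case: ltnP => [_|lej].
  by apply/esym/subnKC/le.
have := le j; rewrite (nth_default _ lej) leqn0 => /eqP ->.
by rewrite addr0.
Qed.

Lemma expo_Xn_sub i (e : expo) : (0 < (e`_i)%R)%N -> exists e', e = 'X^i + e'.
Proof.
by move=> gt; apply: expo_sub => j; rewrite expoX; case: eqP => // ->.
Qed.

Lemma expo_addI (a b c : expo) : a + b = a + c -> b = c.
Proof.
move/polyP=> E; apply/polyP => i; have := E i; rewrite !expoD; exact: addnI.
Qed.

Lemma expo_add_eq0 (a b : expo) : (a + b == 0) = (a == 0) && (b == 0).
Proof.
apply/eqP/andP => [/polyP E|[/eqP-> /eqP->]]; last by rewrite addr0.
split; apply/eqP/polyP => i; have := E i; rewrite expoD coef0 => /eqP;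
by rewrite addn_eq0 => /andP[/eqP ? /eqP ?].
Qed.

Lemma edeg_sum N (e : expo) : (size e <= N)%N -> edeg e = (\sum_(i < N) (e`_i)%R)%N.
Proof.
move=> le; rewrite /edeg (big_ord_widen _ (fun i => (e`_i)%R) le) big_mkcond /=.
apply: eq_bigr => i _; case: ltnP => // lei; exact/esym/nth_default.
Qed.

Lemma edegD (a b : expo) : edeg (a + b) = (edeg a + edeg b)%N.
Proof.
pose N := (size a + size b)%N.
have sab : (size (a + b)%R <= N)%N.
  by rewrite (leq_trans (size_polyD _ _)) // geq_max leq_addr leq_addl.
rewrite (edeg_sum sab) (@edeg_sum N a) ?leq_addr // (@edeg_sum N b) ?leq_addl //.
by rewrite -big_split; apply: eq_bigr => i _; rewrite expoD.
Qed.

Lemma edeg0 : edeg 0 = 0%N.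
Proof. by rewrite (@edeg_sum 0) ?big_ord0 // size_poly0. Qed.

Lemma edegX i : edeg 'X^i = 1%N.
Proof.
rewrite (@edeg_sum i.+1) ?size_polyXn // big_ord_recr /= big1 => [|j _].
  by rewrite expoX eqxx.
by rewrite expoX ltn_eqF.
Qed.

Lemma expo_ind (P : expo -> Prop) :
  P 0 -> (forall i e, P e -> P ('X^i + e)) -> forall e, P e.
Proof.
move=> P0 PX e; have [d le] := ubnP (edeg e).
elim: d e le => // d IH e le; have [->//|nz] := eqVneq e 0.
have : lead_coef e != 0 by rewrite lead_coef_eq0.
rewrite -lt0n => /expo_Xn_sub[e' E]; rewrite E; apply/PX/IH.
by move: le; rewrite {1}E edegD edegX.
Qed.

Lemma edeg_eq0 (e : expo) : (edeg e == 0%N) = (e == 0).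
Proof.
elim/expo_ind: e => [|i e _]; first by rewrite edeg0 !eqxx.
rewrite edegD edegX expo_add_eq0; apply/esym/negbTE.
by rewrite negb_and; apply/orP; left; apply/eqP => /polyP /(_ i); rewrite expoX eqxx coef0.
Qed.

Lemma series_mulE (f g : Sqt) e : (f * g) e = \sum_(p <- splits e) f p.1 * g p.2.
Proof. by []. Qed.
Lemma series_addE (f g : Sqt) e : (f + g) e = f e + g e. Proof. by []. Qed.
Lemma series_oppE (f : Sqt) e : (- f) e = - f e. Proof. by []. Qed.
Lemma series_scaleE c (f : Sqt) e : (c *: f) e = c * f e. Proof. by []. Qed.
Lemma series_1E e : (1 : Sqt) e = (e == 0)%:R. Proof. by []. Qed.
Lemma series_sumE I (r : seq I) (P : pred I) (F : I -> Sqt) e :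
  (\sum_(i <- r | P i) F i) e = \sum_(i <- r | P i) F i e.
Proof. by elim/big_rec2: _ => // i y z _ <-. Qed.
Section Reindex.
Variables (D : pred expo) (psi : expo -> expo).
Hypotheses (psi0 : psi 0 = 0) (D0 : D 0).
Hypothesis DD : forall a b, D (a + b) = D a && D b.
Hypothesis psiD : forall a b, psi (a + b) = psi a + psi b.
Hypothesis psi_inj : forall a b, D a -> D b -> psi a = psi b -> a = b.
Hypothesis psi_split : forall e u v, D e -> u + v = psi e ->
  exists a b, [/\ a + b = e, psi a = u & psi b = v].

Definition reindex_series (f : Sqt) : Sqt := fun e => if D e then f (psi e) else 0.

Lemma reindex_series_zmod : zmod_morphism reindex_series.
Proof.
move=> f g; apply: funext => e.
rewrite [RHS]series_addE series_oppE /reindex_series series_addE series_oppE.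
by case: ifP => _ //; rewrite subr0.
Qed.

Lemma reindex_series_scalable : scalable reindex_series.
Proof.
move=> c f; apply: funext => e.
rewrite [RHS]series_scaleE /reindex_series series_scaleE.
by case: ifP => _ //; rewrite mulr0.
Qed.

(** Swaps, shifts of variables and truncations all read coefficients through a map psi of exponents.
    Such a map is multiplicative because psi carries the decompositions of e bijectively to those of
    psi e, while for e outside D every decomposition has a part outside D. *)
Lemma reindex_series_monoid : monoid_morphism reindex_series.
Proof.
split.
  apply: funext => e; rewrite /reindex_series !series_1E; case: ifP => De.
    congr (_ : bool)%:R; apply/eqP/eqP => [E|->//].
    by apply: psi_inj => //; rewrite psi0.
  by case: eqP De => // ->; rewrite D0.
move=> f g; apply: funext => e; rewrite /reindex_series !series_mulE.
case: ifP => De; last first.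
  rewrite big1_seq // => -[a b]; rewrite mem_splits /= => /eqP E; move: De.
  by rewrite -E DD; case: (D a); rewrite ?mul0r //= => ->; rewrite mulr0.
pose ps (p : expo * expo) := (psi p.1, psi p.2).
have inD p : p \in splits e -> D p.1 && D p.2.
  by rewrite mem_splits => /eqP E; rewrite -DD E.
rewrite (perm_big (map ps (splits e))) /=.
  by rewrite big_map; apply: eq_big_seq => p /inD /andP[-> ->].
apply: uniq_perm; first exact: splits_uniq.
  rewrite map_inj_in_uniq ?splits_uniq // => -[a b] [c d] /inD /= /andP[Da Db].
  by move=> /inD /= /andP[Dc Dd] [/psi_inj-> // /psi_inj->].
move=> [u v]; rewrite mem_splits; apply/eqP/mapP => /= [E|].
  have [a [b [Eab <- <-]]] := psi_split De E.
  by exists (a, b) => //; rewrite mem_splits Eab.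
by move=> [[a b]]; rewrite mem_splits => /eqP <- [-> ->]; rewrite psiD.
Qed.

End Reindex.

Definition swap_idx i := [fun j => j with i |-> i.+1, i.+1 |-> i].
Definition swap_expo i (e : expo) : expo := \poly_(j < size e + i.+2) e`_(swap_idx i j).

Lemma swap_idxK i : involutive (swap_idx i).
Proof.
move=> j; rewrite /swap_idx /=; case: (eqVneq j i) => [->|ni].
  by rewrite gtn_eqF // eqxx.
case: (eqVneq j i.+1) => [->|ni1]; first by rewrite eqxx.
by rewrite (negbTE ni) (negbTE ni1).
Qed.

Lemma swap_idx_l i : swap_idx i i = i.+1.
Proof. by rewrite /= eqxx. Qed.

Lemma swap_idx_r i : swap_idx i i.+1 = i.
Proof. by rewrite /= eqxx gtn_eqF. Qed.

Lemma swap_idx_id i j : j != i -> j != i.+1 -> swap_idx i j = j.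
Proof. by move=> /negbTE /= -> /negbTE ->. Qed.

Lemma coef_swap_expo i (e : expo) j : (swap_expo i e)`_j = e`_(swap_idx i j).
Proof.
rewrite coef_poly; case: ltnP => // lej.
have {lej}le : (size e + i.+2 <= j)%N := lej.
rewrite swap_idx_id; last 2 first.
- by apply/eqP => E; move: le; rewrite E; lia.
- by apply/eqP => E; move: le; rewrite E; lia.
by rewrite nth_default // (leq_trans (leq_addr _ _) le).
Qed.

Lemma swap_expoK i : involutive (swap_expo i).
Proof. by move=> e; apply/polyP => j; rewrite !coef_swap_expo swap_idxK. Qed.

Lemma swap_expoD i a b : swap_expo i (a + b) = swap_expo i a + swap_expo i b.
Proof. by apply/polyP => j; rewrite coef_swap_expo !coefD !coef_swap_expo. Qed.

Lemma swap_expo0 i : swap_expo i 0 = 0.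
Proof. by apply/polyP => j; rewrite coef_swap_expo !coef0. Qed.

Lemma swap_expoX i j : swap_expo i 'X^j = 'X^(swap_idx i j).
Proof.
apply/polyP => l; rewrite coef_swap_expo !expoX; congr (nat_of_bool _).
by apply/eqP/eqP => [<-|->]; rewrite swap_idxK.
Qed.

Lemma edeg_swap i e : edeg (swap_expo i e) = edeg e.
Proof.
elim/expo_ind: e => [|j e IH]; first by rewrite swap_expo0.
by rewrite swap_expoD swap_expoX !edegD !edegX IH.
Qed.

Section Swap.
Variable i : nat.

Lemma swap_seriesE : swap_series i = reindex_series xpredT (swap_expo i).
Proof. by []. Qed.

Lemma swap_series_zmod : zmod_morphism (swap_series i).
Proof. rewrite swap_seriesE; exact: reindex_series_zmod. Qed.
Lemma swap_series_scalable : scalable (swap_series i).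
Proof. rewrite swap_seriesE; exact: reindex_series_scalable. Qed.
Lemma swap_series_monoid : monoid_morphism (swap_series i).
Proof.
rewrite swap_seriesE; apply: reindex_series_monoid => //; [exact: swap_expo0 | exact: swap_expoD | |].
  by move=> a b _ _; apply: (can_inj (@swap_expoK i)).
move=> e u v _ E; exists (swap_expo i u), (swap_expo i v).
by rewrite -swap_expoD E !swap_expoK.
Qed.
HB.instance Definition _ :=
  GRing.isZmodMorphism.Build Sqt Sqt (swap_series i) swap_series_zmod.
HB.instance Definition _ :=
  GRing.isScalable.Build Qqt Sqt Sqt *:%R (swap_series i) swap_series_scalable.
HB.instance Definition _ :=
  GRing.isMonoidMorphism.Build Sqt Sqt (swap_series i) swap_series_monoid.

End Swap.

Section Tail.
Variable k : nat.

Lemma in_tailE :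
  in_tail k = reindex_series (fun e => take_poly k e == 0) (drop_poly k).
Proof. by []. Qed.

Lemma in_tail_zmod : zmod_morphism (in_tail k).
Proof. rewrite in_tailE; exact: reindex_series_zmod. Qed.
Lemma in_tail_scalable : scalable (in_tail k).
Proof. rewrite in_tailE; exact: reindex_series_scalable. Qed.

Lemma tail_expo (e : expo) : take_poly k e == 0 -> e = drop_poly k e * 'X^k.
Proof. by move=> /eqP E; rewrite -{1}[e](poly_take_drop k) E add0r. Qed.

Lemma in_tail_monoid : monoid_morphism (in_tail k).
Proof.
rewrite in_tailE; apply: reindex_series_monoid => //; first exact: drop_poly0r.
- by rewrite take_poly0r.
- by move=> a b; rewrite take_polyD expo_add_eq0.
- by move=> a b; rewrite drop_polyD.
- by move=> a b /tail_expo Ea /tail_expo Eb E; rewrite Ea E -Eb.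
move=> e u v /tail_expo -> E; exists (u * 'X^k), (v * 'X^k).
by rewrite !drop_polyMXn_id -mulrDl E !drop_polyMXn_id.
Qed.
HB.instance Definition _ :=
  GRing.isZmodMorphism.Build Sqt Sqt (in_tail k) in_tail_zmod.
HB.instance Definition _ :=
  GRing.isScalable.Build Qqt Sqt Sqt *:%R (in_tail k) in_tail_scalable.
HB.instance Definition _ :=
  GRing.isMonoidMorphism.Build Sqt Sqt (in_tail k) in_tail_monoid.
End Tail.

(** Truncation with values in series: unlike [Xi], which is a choice and is controlled only in
    bounded degree, it is a ring endomorphism without any condition. Identities for [Xi] are proved
    for [cut] and transferred by [incl_Xi]. *)
Definition cut m : Sqt -> Sqt := reindex_series (fun e => size e <= m)%N id.

Lemma size_expoD (a b : expo) m :
  (size (a + b)%R <= m)%N = (size a <= m)%N && (size b <= m)%N.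
Proof.
apply/idP/andP => [le|[sa sb]]; last first.
  by rewrite (leq_trans (size_polyD _ _)) // geq_max sa.
split; apply/leq_sizeP => j lej; have := nth_default 0 (leq_trans le lej);
by rewrite expoD => /eqP; rewrite [_ == _]addn_eq0 => /andP[/eqP ? /eqP ?].
Qed.

Section Cut.
Variable m : nat.

Lemma cut_zmod : zmod_morphism (cut m).
Proof. exact: reindex_series_zmod. Qed.
Lemma cut_scalable : scalable (cut m).
Proof. exact: reindex_series_scalable. Qed.
Lemma cut_monoid : monoid_morphism (cut m).
Proof.
apply: reindex_series_monoid => //; first by rewrite size_poly0.
- by move=> a b; apply: size_expoD.
- by move=> e u v _ <-; exists u, v.
Qed.
HB.instance Definition _ := GRing.isZmodMorphism.Build Sqt Sqt (cut m) cut_zmod.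
HB.instance Definition _ :=
  GRing.isScalable.Build Qqt Sqt Sqt *:%R (cut m) cut_scalable.
HB.instance Definition _ := GRing.isMonoidMorphism.Build Sqt Sqt (cut m) cut_monoid.
End Cut.

Definition mono (u : expo) : Sqt := fun e => (e == u)%:R.

Lemma mono_mul_addE u f e : (mono u * f) (u + e) = f e.
Proof.
rewrite series_mulE (bigD1_seq (u, e)) ?splits_uniq ?mem_splits //= big1_seq.
  by rewrite /mono eqxx mul1r addr0.
move=> [a b]; rewrite mem_splits /mono /= => /andP[ne /eqP E].
case: (a =P u) E ne => [-> /expo_addI ->|_ _ _]; first by rewrite eqxx.
by rewrite mul0r.
Qed.

Lemma mono_mul_out u f e : (forall e', e <> u + e') -> (mono u * f) e = 0.
Proof.
move=> H; rewrite series_mulE big1_seq // => -[a b]; rewrite mem_splits /mono /=.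
by move/eqP=> E; case: eqP E => [-> /esym/H//|_ _]; rewrite mul0r.
Qed.

Lemma mono0 : mono 0 = 1. Proof. by []. Qed.

Lemma xsE i : xs i = mono 'X^i. Proof. by []. Qed.

Lemma monoD u v : mono (u + v) = mono u * mono v.
Proof.
apply: funext => e.
have [[e' ->]|H] := pselect (exists e', e = u + e').
  rewrite mono_mul_addE /mono; congr (_ : bool)%:R.
  by apply/eqP/eqP => [/expo_addI|->].
rewrite mono_mul_out /mono; last by move=> e' E; apply: H; exists e'.
by case: eqP => // E; case: H; exists v.
Qed.

Lemma xs_mulE i f e : (xs i * f) ('X^i + e) = f e.
Proof. exact: mono_mul_addE. Qed.

Lemma xs_mul_out i f (e : expo) : (e`_i)%R = 0%N -> (xs i * f) e = 0.
Proof.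
by move=> E; apply: mono_mul_out => e' E'; move: E; rewrite E' expoD expoX eqxx.
Qed.

Lemma swap_mono i u : swap_series i (mono u) = mono (swap_expo i u).
Proof.
apply: funext => e; rewrite swap_seriesE /reindex_series /mono.
by congr (_ : bool)%:R; apply/eqP/eqP => [<-|->]; rewrite swap_expoK.
Qed.

Lemma swap_xs i j : swap_series i (xs j) = xs (swap_idx i j).
Proof. by rewrite !xsE swap_mono swap_expoX. Qed.

Lemma in_tail_mono k u : in_tail k (mono u) = mono (u * 'X^k).
Proof.
apply: funext => e; rewrite /in_tail /mono; case: ifP => [/tail_expo E|nt].
  congr (_ : bool)%:R; apply/eqP/eqP => [<-//|->]; by rewrite drop_polyMXn_id.
case: (e =P u * 'X^k) => // Eu.
by move: nt; rewrite Eu take_polyMXn_0 eqxx.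
Qed.

Lemma in_tail_xs k i : in_tail k (xs i) = xs (i + k).
Proof. by rewrite !xsE in_tail_mono -exprD. Qed.

Lemma cut_mono m u : cut m (mono u) = if (size u <= m)%N then mono u else 0.
Proof.
apply: funext => e; rewrite /cut /reindex_series /mono.
case: (eqVneq e u) => [->|ne]; first by case: ifP; rewrite /mono ?eqxx.
by do 2!case: ifP => // _; rewrite /mono (negbTE ne).
Qed.

Lemma cut_xs m i : cut m (xs i) = if (i < m)%N then xs i else 0.
Proof. by rewrite xsE cut_mono size_polyXn. Qed.

Lemma bounded_degree_scale c f : bounded_degree f -> bounded_degree (c *: f).
Proof. by case=> d H; exists d => e /H E; rewrite series_scaleE E mulr0. Qed.

Lemma bounded_degreeD f g :
  bounded_degree f -> bounded_degree g -> bounded_degree (f + g).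
Proof.
move=> [d H] [d' H']; exists (maxn d d') => e; rewrite geq_max => /andP[le le'].
by rewrite series_addE H // H' // addr0.
Qed.

Lemma bounded_degree0 : bounded_degree 0.
Proof. by exists 0%N. Qed.

Lemma bounded_degreeM f g :
  bounded_degree f -> bounded_degree g -> bounded_degree (f * g).
Proof.
move=> [d H] [d' H']; exists (d + d')%N => e le; rewrite series_mulE big1_seq //.
move=> [a b]; rewrite mem_splits /= => /eqP E; move: le; rewrite -E edegD.
case: (leqP d (edeg a)) => [/H -> _|lt le]; first by rewrite mul0r.
by rewrite H' ?mulr0 //; lia.
Qed.

Lemma bounded_degree_mono u : bounded_degree (mono u).
Proof.
exists (edeg u).+1 => e; rewrite /mono; case: eqP => // ->.
by rewrite ltnn.
Qed.

Lemma bounded_degree_xs i : bounded_degree (xs i).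
Proof. exact: bounded_degree_mono. Qed.

Lemma bounded_degree1 : bounded_degree 1.
Proof. exact: bounded_degree_mono. Qed.

Lemma bounded_degree_sum I (r : seq I) (P : pred I) (F : I -> Sqt) :
  (forall i, P i -> bounded_degree (F i)) ->
  bounded_degree (\sum_(i <- r | P i) F i).
Proof.
by move=> H; elim/big_rec: _ => [|i f Pi]; [exact: bounded_degree0|apply/bounded_degreeD/H].
Qed.

Lemma bounded_degree_prod I (r : seq I) (P : pred I) (F : I -> Sqt) :
  (forall i, P i -> bounded_degree (F i)) ->
  bounded_degree (\prod_(i <- r | P i) F i).
Proof.
by move=> H; elim/big_rec: _ => [|i f Pi]; [exact: bounded_degree1|apply/bounded_degreeM/H].
Qed.

Lemma bounded_degree_swap i f : bounded_degree f -> bounded_degree (swap_series i f).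
Proof.
by case=> d H; exists d => e le; rewrite swap_seriesE /reindex_series H ?edeg_swap.
Qed.

Lemma edegMXn (e : expo) k : edeg (e * 'X^k) = edeg e.
Proof.
elim/expo_ind: e => [|j e IH]; first by rewrite mul0r.
by rewrite mulrDl -exprD !edegD !edegX IH.
Qed.

Lemma bounded_degree_in_tail k f : bounded_degree f -> bounded_degree (in_tail k f).
Proof.
case=> d H; exists d => e le; rewrite /in_tail; case: ifP => // /tail_expo E.
by rewrite H // -(edegMXn _ k) -E.
Qed.

Lemma expoMn i m j : ('X^i *+ m : expo)`_j = ((j == i) * m)%N.
Proof.
elim: m => [|m IH]; first by rewrite mulr0n coef0 muln0.
by rewrite mulrS expoD expoX IH mulnS.
Qed.

Lemma expo_sumE I (r : seq I) (P : pred I) (F : I -> expo) j :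
  (\sum_(i <- r | P i) F i)`_j = (\sum_(i <- r | P i) ((F i)`_j)%R)%N.
Proof. exact: coef_sum. Qed.

Lemma coef_expo_of_mnm m (a : 'X_{1..m}) (i : 'I_m) : (expo_of_mnm a)`_i = a i.
Proof.
rewrite /expo_of_mnm expo_sumE (bigD1 i) //= big1 ?addn0 => [|j ne].
  by rewrite expoMn eqxx mul1n.
by rewrite expoMn eq_sym val_eqE (negbTE ne).
Qed.

Lemma size_expo_of_mnm m (a : 'X_{1..m}) : (size (expo_of_mnm a) <= m)%N.
Proof.
apply/leq_sizeP => j le; rewrite /expo_of_mnm expo_sumE big1 // => i _.
by rewrite expoMn gtn_eqF // (leq_trans (ltn_ord i)).
Qed.

Definition mnm_expo m (e : expo) : 'X_{1..m} := [multinom (e`_i)%R | i < m].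

Lemma expo_of_mnmK m : cancel (@expo_of_mnm m) (mnm_expo m).
Proof. by move=> a; apply/mnmP => i; rewrite mnmE coef_expo_of_mnm. Qed.

Lemma mnm_expoK m (e : expo) : expo_of_mnm (mnm_expo m e) = take_poly m e.
Proof.
apply/polyP => j; rewrite coef_take_poly; case: ltnP => [lt|le].
  by have := coef_expo_of_mnm (mnm_expo m e) (Ordinal lt); rewrite mnmE.
by rewrite nth_default // (leq_trans (size_expo_of_mnm _)).
Qed.

Lemma mnm_expoK_id m (e : expo) :
  (size e <= m)%N -> expo_of_mnm (mnm_expo m e) = e.
Proof. by move=> le; rewrite mnm_expoK take_poly_id. Qed.

Lemma edeg_expo_of_mnm m (a : 'X_{1..m}) : edeg (expo_of_mnm a) = mdeg a.
Proof.
rewrite (edeg_sum (size_expo_of_mnm a)) mdegE.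
by apply: eq_bigr => i _; rewrite coef_expo_of_mnm.
Qed.

Lemma monoMn u m : mono (u *+ m) = mono u ^+ m.
Proof. by elim: m => [|m IH] //; rewrite mulrS exprS monoD IH. Qed.

Lemma mono_sum I (r : seq I) (P : pred I) (F : I -> expo) :
  mono (\sum_(i <- r | P i) F i) = \prod_(i <- r | P i) mono (F i).
Proof. exact: (big_morph mono monoD mono0). Qed.

Lemma xmonE k (a : 'X_{1..k}) : xmon a = mono (expo_of_mnm a).
Proof. by rewrite mono_sum; apply: eq_bigr => i _; rewrite monoMn. Qed.

Lemma mono_in_tailE k (v : expo) F (e : expo) : (size v <= k)%N ->
  (mono v * in_tail k F) e = if take_poly k e == v then F (drop_poly k e) else 0.
Proof.
move=> sv.
have [[e' ->]|H] := pselect (exists e', e = v + e').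
  rewrite mono_mul_addE take_polyD drop_polyD (take_poly_id sv).
  rewrite (drop_poly_eq0 sv) add0r -[X in _ == X]addr0 /in_tail.
  by congr (if _ then _ else _); apply/eqP/eqP => [->//|/expo_addI].
rewrite mono_mul_out; last by move=> e' E; apply: H; exists e'.
case: eqP => // E; case: H; exists (drop_poly k e * 'X^k).
by rewrite -E poly_take_drop.
Qed.

Lemma xmon_in_tailE k (a : 'X_{1..k}) F e :
  (xmon a * in_tail k F) e = if take_poly k e == expo_of_mnm a
                             then F (drop_poly k e) else 0.
Proof. by rewrite xmonE mono_in_tailE ?size_expo_of_mnm. Qed.

Lemma take_swap_expo k i e :
  (take_poly k (swap_expo (i + k) e) == 0) = (take_poly k e == 0).
Proof.
congr (_ == _); apply/polyP => j; rewrite !coef_take_poly coef_swap_expo.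
by case: ifP => // lt; rewrite swap_idx_id // ltn_eqF //; lia.
Qed.

Lemma drop_swap_expo k i e :
  drop_poly k (swap_expo (i + k) e) = swap_expo i (drop_poly k e).
Proof.
apply/polyP => j; rewrite coef_swap_expo !coef_drop_poly coef_swap_expo.
congr (_`_ _); rewrite /= -!addSn !eqn_add2r.
by case: (j == i) => //; case: (j == i.+1).
Qed.

Lemma swap_in_tail k i F :
  swap_series (i + k) (in_tail k F) = in_tail k (swap_series i F).
Proof.
apply: funext => e; rewrite !swap_seriesE /reindex_series /= /in_tail.
by rewrite take_swap_expo drop_swap_expo.
Qed.

Definition tail_symmetric k (f : Sqt) :=
  forall i, (k <= i)%N -> swap_series i f = f.

Lemma tail_symmetric_in_tail k F :
  tail_symmetric 0 F -> tail_symmetric k (in_tail k F).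
Proof. by move=> sF i le; rewrite -(subnK le) swap_in_tail sF. Qed.

Lemma tail_symmetric_xs k j : (j < k)%N -> tail_symmetric k (xs j).
Proof.
by move=> lt i le; rewrite swap_xs swap_idx_id // ltn_eqF //; lia.
Qed.

Lemma tail_symmetricM k f g :
  tail_symmetric k f -> tail_symmetric k g -> tail_symmetric k (f * g).
Proof. by move=> sf sg i le; rewrite rmorphM /= sf ?sg. Qed.

Lemma tail_symmetricD k f g :
  tail_symmetric k f -> tail_symmetric k g -> tail_symmetric k (f + g).
Proof. by move=> sf sg i le; rewrite rmorphD /= sf ?sg. Qed.

Lemma tail_symmetricZ k c f : tail_symmetric k f -> tail_symmetric k (c *: f).
Proof. by move=> sf i le; rewrite linearZ /= sf. Qed.

Lemma tail_symmetric0 k : tail_symmetric k 0.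
Proof. by move=> i le; rewrite rmorph0. Qed.

Lemma tail_symmetric1 k : tail_symmetric k 1.
Proof. by move=> i le; rewrite rmorph1. Qed.

Lemma tail_symmetric_sum k I (r : seq I) (P : pred I) (F : I -> Sqt) :
  (forall i, P i -> tail_symmetric k (F i)) ->
  tail_symmetric k (\sum_(i <- r | P i) F i).
Proof.
by move=> H; elim/big_rec: _ => [|i f Pi];
  [exact: tail_symmetric0|apply/tail_symmetricD/H].
Qed.

Lemma tail_symmetric_prod k I (r : seq I) (P : pred I) (F : I -> Sqt) :
  (forall i, P i -> tail_symmetric k (F i)) ->
  tail_symmetric k (\prod_(i <- r | P i) F i).
Proof.
by move=> H; elim/big_rec: _ => [|i f Pi];
  [exact: tail_symmetric1|apply/tail_symmetricM/H].
Qed.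

Lemma tail_symmetricW k l f : (k <= l)%N -> tail_symmetric k f -> tail_symmetric l f.
Proof. by move=> le sf i le'; apply: sf; apply: leq_trans le'. Qed.

Lemma tail_symmetric_exp k f m : tail_symmetric k f -> tail_symmetric k (f ^+ m).
Proof. by move=> sf i le; rewrite rmorphXn /= sf. Qed.

Lemma is_symfunP F : is_symfun F <-> bounded_degree F /\ tail_symmetric 0 F.
Proof. by split=> -[bF sF]; split=> // i *; apply: sF. Qed.

(* A bounded-degree series that is symmetric in the variables of indices k, k+1, ...
   is almost symmetric: expand it along its monomials in the first k variables. *)
Lemma inPas_kP k f : inPas_k k f <-> bounded_degree f /\ tail_symmetric k f.
Proof.
split=> [[s [Hs ->]]|[[d Hd] sf]].
  split; rewrite /expand big_seq.
    apply: bounded_degree_sum => p /Hs [bF _].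
    apply: bounded_degreeM; last exact: bounded_degree_in_tail.
    by rewrite xmonE; apply: bounded_degree_mono.
  apply: tail_symmetric_sum => p /Hs /is_symfunP [_ sF].
  apply: tail_symmetricM; last exact: tail_symmetric_in_tail.
  apply: tail_symmetric_prod => i _; apply: tail_symmetric_exp.
  exact: tail_symmetric_xs.
(* The coefficient in f of the monomial a of the first k variables, as a series in the others with
   indices lowered by k. *)
pose F (a : 'X_{1..k}) : Sqt := fun e => f (expo_of_mnm a + e * 'X^k).
exists [seq (val a, F (val a)) | a <- index_enum 'X_{1..k < d}]; split.
  move=> p /mapP[a _ ->] /=; split.
    exists d => e le; apply: Hd; rewrite edegD edegMXn.
    exact: leq_trans le (leq_addl _ _).
  move=> i; apply: funext => e; rewrite swap_seriesE /reindex_series /= /F.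
  rewrite -[in RHS](sf (i + k)%N) ?leq_addl // swap_seriesE /reindex_series /=.
  congr f; rewrite -[in RHS](poly_take_drop k (swap_expo _ _)).
  have sv := size_expo_of_mnm (val a).
  congr (_ + _); last first.
    rewrite drop_swap_expo drop_polyD (drop_poly_eq0 sv) add0r.
    by rewrite drop_polyMXn_id.
  apply/polyP => j; rewrite coef_take_poly coef_swap_expo.
  case: ltnP => lt; last first.
    by apply: nth_default; apply: leq_trans lt.
  rewrite swap_idx_id ?ltn_eqF //; try lia.
  by rewrite expoD coefMXn lt addn0.
apply: funext => e; rewrite /expand big_map series_sumE.
under eq_bigr => a _ do rewrite xmon_in_tailE.
case: (ltnP (mdeg (mnm_expo k e)) d) => [lt|le].
  rewrite (bigD1 (BMultinom lt)) //= big1 ?addr0 => [|a ne].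
    by rewrite mnm_expoK eqxx /F mnm_expoK poly_take_drop.
  case: eqP => // E; case/eqP: ne; apply/val_inj => /=.
  by rewrite -(expo_of_mnmK (val a)) -E -mnm_expoK expo_of_mnmK.
rewrite big1 => [|a _].
  apply: Hd; rewrite -(poly_take_drop k e) edegD.
  by rewrite -mnm_expoK edeg_expo_of_mnm (leq_trans le) ?leq_addr.
case: eqP => // E; have := bmdeg a; rewrite ltnNge => /negP [].
by rewrite -(expo_of_mnmK (val a)) -E -mnm_expoK expo_of_mnmK.
Qed.

(** * Divided differences of series *)

Definition set_pair i (e : expo) (a b : nat) : expo :=
  \poly_(j < size e + i.+2) (if j == i then a else if j == i.+1 then b else (e`_j)%R).

Lemma coef_set_pair i e a b j :
  (set_pair i e a b)`_j = if j == i then a else if j == i.+1 then b else (e`_j)%R.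
Proof.
rewrite coef_poly; case: ltnP => // lej.
have {lej}le : (size e + i.+2 <= j)%N := lej.
rewrite !gtn_eqF; last by lia.
  by rewrite nth_default // (leq_trans (leq_addr _ _) le).
by lia.
Qed.

Lemma swap_set_pair i e a b : swap_expo i (set_pair i e a b) = set_pair i e b a.
Proof.
apply/polyP => j; rewrite coef_swap_expo !coef_set_pair /=.
case: (eqVneq j i) => [_|ni]; first by rewrite gtn_eqF ?eqxx.
case: (eqVneq j i.+1) => [_|ni1]; first by rewrite eqxx.
by rewrite (negbTE ni) (negbTE ni1).
Qed.

Lemma set_pair_id i (e : expo) : set_pair i e (e`_i)%R (e`_i.+1)%R = e.
Proof.
apply/polyP => j; rewrite coef_set_pair.
by case: (eqVneq j i) => [->//|_]; case: (eqVneq j i.+1) => [->|].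
Qed.

Lemma set_pair_eq i (e e' : expo) a b :
  (forall j, j != i -> j != i.+1 -> (e`_j)%R = (e'`_j)%R) ->
  set_pair i e a b = set_pair i e' a b.
Proof.
move=> H; apply/polyP => j; rewrite !coef_set_pair.
case: (eqVneq j i) => // ni; case: (eqVneq j i.+1) => // ni1; exact: H.
Qed.

Lemma edegMn j m : edeg ('X^j *+ m) = m.
Proof.
elim: m => [|m IH]; first by rewrite mulr0n edeg0.
by rewrite mulrS edegD edegX IH.
Qed.

Lemma edeg_set_pair i (e : expo) a b :
  (edeg (set_pair i e a b) + (e`_i)%R + (e`_i.+1)%R)%N = (edeg e + a + b)%N.
Proof.
have E : set_pair i e a b + 'X^i *+ (e`_i)%R + 'X^(i.+1) *+ (e`_i.+1)%R =
         e + 'X^i *+ a + 'X^(i.+1) *+ b.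
  apply/polyP => j; rewrite !expoD !expoMn coef_set_pair.
  case: (eqVneq j i) => [->|ni]; first by rewrite ltn_eqF //; lia.
  by case: (eqVneq j i.+1) => [->|ni1]; lia.
by have := congr1 edeg E; rewrite !edegD !edegMn.
Qed.

(* Expands (x^a y^b - x^b y^a) / (x - y) for x, y the variables i and i+1. *)
Definition divided_difference i (f : Sqt) : Sqt := fun e =>
  - \sum_(c < (e`_i)%R.+1)
      (f (set_pair i e c ((e`_i)%R + (e`_i.+1)%R + 1 - c)%N)
       - f (set_pair i e ((e`_i)%R + (e`_i.+1)%R + 1 - c)%N c)).

(** At an exponent with a and b in positions i and i+1, multiplying by either variable gives, up to
    sign, a partial sum of one sequence [ph]: over c < a for x_i and over c <= a for x_{i+1}. The
    difference is the term c = a, which is the coefficient of f minus its swap. *)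
Lemma divided_differenceP i f :
  (xs i - xs i.+1) * divided_difference i f = f - swap_series i f.
Proof.
apply: funext => e; rewrite mulrBl !series_addE !series_oppE.
pose a := (e`_i)%R : nat; pose b := (e`_i.+1)%R : nat.
pose ps c := f (set_pair i e c (a + b - c)%N).
pose ph c := ps c - f (set_pair i e (a + b - c)%N c).
have E1 : (xs i * divided_difference i f) e = - \sum_(c < a) ph c.
  case: (posnP (e`_i)%R) => [e0|gt].
    by rewrite xs_mul_out // /a e0 big_ord0 oppr0.
  have [e' Ee] := expo_Xn_sub gt; rewrite {1}Ee xs_mulE /divided_difference.
  have Ea : a = ((e'`_i)%R).+1 :> nat by rewrite /a Ee expoD expoX eqxx.
  have Eb : b = (e'`_i.+1)%R :> nat by rewrite /b Ee expoD expoX gtn_eqF.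
  have sE c d : set_pair i e' c d = set_pair i e c d.
    by apply: set_pair_eq => j ni _; rewrite Ee expoD expoX (negbTE ni).
  rewrite Ea; congr (- _); apply: eq_bigr => c _; rewrite !sE /ph /ps Ea Eb.
  by rewrite addn1 -addSn.
have E2 : (xs i.+1 * divided_difference i f) e = - \sum_(c < a.+1) ph c.
  case: (posnP (e`_i.+1)%R) => [e0|gt].
    rewrite xs_mul_out //; apply/esym/eqP; rewrite oppr_eq0; apply/eqP.
    (* For b = 0 the sequence [ph] changes sign under c -> a - c, so its sum over c <= a vanishes,
       as it must for an exponent not divisible by x_{i+1}. *)
    rewrite sumrB [X in _ - X](reindex_inj rev_ord_inj) /=; apply/eqP.
    rewrite subr_eq0; apply/eqP; apply: eq_bigr => c _; rewrite /ps /b e0 addn0.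
    by rewrite subSS subKn // -ltnS.
  have [e' Ee] := expo_Xn_sub gt; rewrite {1}Ee xs_mulE /divided_difference.
  have Ea : a = (e'`_i)%R :> nat by rewrite /a Ee expoD expoX ltn_eqF.
  have Eb : b = ((e'`_i.+1)%R).+1 :> nat by rewrite /b Ee expoD expoX eqxx.
  have sE c d : set_pair i e' c d = set_pair i e c d.
    by apply: set_pair_eq => j _ ni; rewrite Ee expoD expoX (negbTE ni).
  rewrite Ea; congr (- _); apply: eq_bigr => c _; rewrite !sE /ph /ps Ea Eb.
  by rewrite addn1 addnS.
rewrite E1 E2 opprK big_ord_recr /= addKr /ph /ps addKn set_pair_id.
rewrite swap_seriesE /reindex_series /=.
suff -> : swap_expo i e = set_pair i e b a by [].
by rewrite -{1}(set_pair_id i e) swap_set_pair.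
Qed.

Lemma bounded_divided_difference i f :
  bounded_degree f -> bounded_degree (divided_difference i f).
Proof.
case=> d H; exists d => e le; rewrite /divided_difference big1 ?oppr0 // => c _.
have lec : (c <= (e`_i)%R)%N by rewrite -ltnS.
have aux (D D' a b c' c'' : nat) : (c' + c'' = a + b + 1)%N ->
  (D + a + b)%N = (D' + c' + c'')%N -> (D' <= D)%N by lia.
rewrite !H ?subr0 //; apply: (leq_trans le); apply: aux (edeg_set_pair _ _ _ _).
  by rewrite subnK // -addnA (leq_trans lec) ?leq_addr.
by rewrite subnKC // -addnA (leq_trans lec) ?leq_addr.
Qed.

(** If x_i h = x_{i+1} h, the coefficient of h at e equals the one at e with a unit moved from
    position i+1 to position i. After finitely many moves position i+1 is empty, and there the
    coefficient is 0. *)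
Lemma series_swap_reg i (h : Sqt) : (xs i - xs i.+1) * h = 0 -> h = 0.
Proof.
move=> E; apply: funext => e.
have xE u : (xs i * h) u = (xs i.+1 * h) u.
  have := congr1 (fun f : Sqt => f u) E; rewrite mulrBl series_addE series_oppE.
  by move/eqP; rewrite subr_eq0 => /eqP.
have [m le] := ubnP ((e`_i.+1)%R : nat); elim: m e le => // m IH e le.
rewrite -(xs_mulE i) xE; case: (posnP (e`_i.+1)%R) => [e0|gt].
  by rewrite xs_mul_out // expoD expoX gtn_eqF.
have [e' Ee] := expo_Xn_sub gt; rewrite Ee addrCA xs_mulE IH //.
by move: le; rewrite Ee !expoD !expoX eqxx gtn_eqF.
Qed.

Lemma swap_datum_series i : swap_datum (swap_series i) (xs i) (xs i.+1).
Proof.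
split.
- by move=> c f g; rewrite linearP.
- by move=> f g; rewrite rmorphM.
- move=> f; apply: funext => e; rewrite !swap_seriesE /reindex_series /=.
  by rewrite swap_expoK.
- by rewrite swap_xs swap_idx_l.
- exact: series_swap_reg.
- by move=> f; exists (divided_difference i f); apply: divided_differenceP.
Qed.

(** A chosen quotient has no visible degree; regularity identifies it with the explicit divided
    difference, which raises degrees in a controlled way. *)
Lemma bounded_Ts i f : bounded_degree f -> bounded_degree (Ts i f).
Proof.
move=> bf; rewrite /Ts /demazure_lusztig.
have -> : exact_quot (f - swap_series i f) (xs i - xs i.+1) = divided_difference i f.
  apply: (swap_regI (swap_datum_series i)); rewrite divided_differenceP.
  exact: (epsilon_spec (inhabits 0) _ (swap_div (swap_datum_series i) f)).
apply: bounded_degreeD; first exact: bounded_degree_swap.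
apply/bounded_degree_scale/bounded_degreeM; first exact: bounded_degree_xs.
exact: bounded_divided_difference.
Qed.

Lemma bounded_Ts_inv i f : bounded_degree f -> bounded_degree (Ts_inv i f).
Proof.
move=> bf; apply/bounded_degree_scale/bounded_degreeD; first exact: bounded_Ts.
exact: bounded_degree_scale.
Qed.

Lemma mmap_morph (R : nzRingType) (S S' : comNzRingType) (phi : {rmorphism S -> S'})
    n (h : R -> S) (a : 'I_n -> S) P :
  phi (mmap h a P) = mmap (phi \o h) (phi \o a) P.
Proof.
rewrite /mmap rmorph_sum; apply: eq_bigr => u _; rewrite rmorphM; congr (_ * _).
by rewrite rmorph_prod; apply: eq_bigr => i _; rewrite rmorphXn.
Qed.

Lemma eq_mmap (R : nzRingType) (S : nzRingType) n (h h' : R -> S) (a a' : 'I_n -> S) P :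
  h =1 h' -> a =1 a' -> mmap h a P = mmap h' a' P.
Proof.
move=> Eh Ea; rewrite /mmap; apply: eq_bigr => u _; rewrite Eh; congr (_ * _).
exact: mmap1_eq.
Qed.

Lemma mmap_gen n (R : comNzRingType) (p : {mpoly R[n]}) :
  mmap (@mpolyC n R) (fun i => 'X_i) p = p.
Proof.
rewrite [RHS]mpolyE; apply: eq_bigr => u _; rewrite mul_mpolyC; congr (_ *: _).
by rewrite mpolyXE_id.
Qed.

Lemma mpoly_morph_ext n (R : comNzRingType) (S : comNzRingType)
    (f g : {rmorphism {mpoly R[n]} -> S}) :
  (forall c, f c%:MP = g c%:MP) -> (forall i, f 'X_i = g 'X_i) -> f =1 g.
Proof. by move=> Ec EX p; rewrite -[p]mmap_gen !mmap_morph; apply: eq_mmap. Qed.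

(** * Truncation to finitely many variables *)

Section Incl.
Variable m : nat.
Implicit Types p : {mpoly Qqt[m]}.

Definition incl p : Sqt := mmap (in_alg Sqt) (fun i : 'I_m => xs i) p.

Lemma incl_zmod : zmod_morphism incl.
Proof. by move=> p r; rewrite /incl rmorphB. Qed.
Lemma incl_monoid : monoid_morphism incl.
Proof. by split=> [|p r]; rewrite /incl (rmorph1, rmorphM). Qed.
Lemma incl_scalable : scalable incl.
Proof. by move=> c p; rewrite /incl mmapZ /= mulr_algl. Qed.
HB.instance Definition _ := GRing.isZmodMorphism.Build {mpoly Qqt[m]} Sqt incl incl_zmod.
HB.instance Definition _ :=
  GRing.isMonoidMorphism.Build {mpoly Qqt[m]} Sqt incl incl_monoid.
HB.instance Definition _ :=
  GRing.isScalable.Build Qqt {mpoly Qqt[m]} Sqt *:%R incl incl_scalable.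

Lemma inclX i : incl 'X_i = xs i.
Proof. by rewrite /incl mmapX mmap1U. Qed.

Lemma inclE p e : incl p e = if (size e <= m)%N then p@_(mnm_expo m e) else 0.
Proof.
have -> : incl p = \sum_(a <- msupp p) p@_a *: mono (expo_of_mnm a).
  by apply: eq_bigr => a _; rewrite /= mulr_algl -xmonE.
rewrite series_sumE; case: leqP => [le|lt].
  rewrite -{1}(mnm_expoK_id le).
  have [uin|out] := boolP (mnm_expo m e \in msupp p).
    rewrite (bigD1_seq _ uin) ?msupp_uniq //= big1 ?addr0 => [|a ne].
      by rewrite series_scaleE /mono eqxx mulr1.
    rewrite series_scaleE /mono (inj_eq (can_inj (@expo_of_mnmK m))).
    by rewrite eq_sym (negbTE ne) mulr0.
  rewrite (memN_msupp_eq0 out) big1_seq // => a /= ain.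
  rewrite series_scaleE /mono (inj_eq (can_inj (@expo_of_mnmK m))).
  by case: eqP out => [->|_ _]; [rewrite ain | rewrite mulr0].
rewrite big1 // => a _; rewrite series_scaleE /mono.
case: eqP => [E|_]; last by rewrite mulr0.
by move: lt; rewrite E ltnNge size_expo_of_mnm.
Qed.

Lemma incl_coef p a : incl p (expo_of_mnm a) = p@_a.
Proof. by rewrite inclE size_expo_of_mnm expo_of_mnmK. Qed.

Lemma incl_inj : injective incl.
Proof. by move=> p r E; apply/mpolyP => a; rewrite -!incl_coef E. Qed.

Lemma cut_incl p : cut m (incl p) = incl p.
Proof.
apply: funext => e; rewrite /cut /reindex_series !inclE /=.
by case: (size e <= m)%N.
Qed.

Lemma bounded_incl p : bounded_degree (incl p).
Proof.
exists (msize p) => e le; rewrite inclE; case: ifP => // se.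
apply: memN_msupp_eq0; apply: msize_mdeg_ge.
by rewrite -edeg_expo_of_mnm mnm_expoK_id.
Qed.

(** In bounded degree the truncation has finitely many monomials, so the choice in [Xi] has a
    candidate. Otherwise it may have none, whence the recurring hypotheses of bounded degree. *)
Lemma Xi_coef f a : bounded_degree f -> (Xi m f)@_a = f (expo_of_mnm a).
Proof.
move=> [d Hd]; rewrite /Xi.
apply: (epsilon_spec (inhabits 0) (fun p => forall a, p@_a = f (expo_of_mnm a))).
exists (\sum_(u : 'X_{1..m < d}) f (expo_of_mnm u) *: 'X_[u]) => u.
rewrite raddf_sum /=; case: (ltnP (mdeg u) d) => [lt|le].
  rewrite (bigD1 (BMultinom lt)) //= big1 ?addr0 => [|v ne].
    by rewrite mcoeffZ mcoeffX eqxx mulr1.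
  rewrite mcoeffZ mcoeffX; case: eqP => [E|_]; last by rewrite mulr0.
  by case/eqP: ne; apply: val_inj.
rewrite big1 => [|v _]; first by rewrite Hd // edeg_expo_of_mnm.
rewrite mcoeffZ mcoeffX; case: eqP => [E|_]; last by rewrite mulr0.
by have := bmdeg v; rewrite E ltnNge le.
Qed.

Lemma incl_Xi f : bounded_degree f -> incl (Xi m f) = cut m f.
Proof.
move=> bf; apply: funext => e; rewrite inclE /cut /reindex_series.
by case: ifP => // le; rewrite Xi_coef // mnm_expoK_id.
Qed.

Lemma XiP f p : bounded_degree f -> cut m f = incl p -> Xi m f = p.
Proof. by move=> bf E; apply: incl_inj; rewrite incl_Xi. Qed.

Lemma XiM f g : bounded_degree f -> bounded_degree g ->
  Xi m (f * g) = Xi m f * Xi m g.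
Proof.
by move=> bf bg; apply: XiP; [exact: bounded_degreeM|rewrite !rmorphM /= !incl_Xi].
Qed.

Lemma Xi_linear c f g : bounded_degree f -> bounded_degree g ->
  Xi m (c *: f + g) = c *: Xi m f + Xi m g.
Proof.
move=> bf bg; apply: XiP; last by rewrite !linearP /= !incl_Xi.
exact/bounded_degreeD/bg/bounded_degree_scale.
Qed.

Lemma Xi0 : Xi m 0 = 0.
Proof. by apply: XiP; [exact: bounded_degree0|rewrite !rmorph0]. Qed.

Lemma XiD f g : bounded_degree f -> bounded_degree g ->
  Xi m (f + g) = Xi m f + Xi m g.
Proof. by move=> bf bg; have := Xi_linear 1 bf bg; rewrite !scale1r. Qed.

Lemma XiZ c f : bounded_degree f -> Xi m (c *: f) = c *: Xi m f.
Proof.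
by move=> bf; have := Xi_linear c bf bounded_degree0; rewrite Xi0 !addr0.
Qed.

Lemma Xi_sum I (r : seq I) (P : pred I) (F : I -> Sqt) :
  (forall i, P i -> bounded_degree (F i)) ->
  Xi m (\sum_(i <- r | P i) F i) = \sum_(i <- r | P i) Xi m (F i).
Proof.
move=> H; apply: XiP; first exact: bounded_degree_sum.
by rewrite !rmorph_sum; apply: eq_bigr => i Pi /=; rewrite incl_Xi //; apply: H.
Qed.

Lemma xv_ord (i : 'I_m) : xv m i = 'X_i.
Proof. by rewrite /xv valK. Qed.

Lemma xv_out i : (m <= i)%N -> xv m i = 0.
Proof. by move=> le; rewrite /xv insubF // ltnNge le. Qed.

Lemma incl_xv i : incl (xv m i) = cut m (xs i).
Proof.
rewrite cut_xs; case: ltnP => [lt|le]; last by rewrite xv_out // rmorph0.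
by rewrite (xv_ord (Ordinal lt)) inclX.
Qed.

Lemma Xi_xs i : Xi m (xs i) = xv m i.
Proof. by apply: XiP; [exact: bounded_degree_xs|rewrite incl_xv]. Qed.

Lemma cut_swap i f : (i.+1 < m)%N -> cut m (swap_series i f) = swap_series i (cut m f).
Proof.
move=> lt; apply: funext => e; rewrite /cut !swap_seriesE /reindex_series /=.
have sz (u : expo) : (size u <= m -> size (swap_expo i u) <= m)%N.
  move=> le; apply/leq_sizeP => j lej; rewrite coef_swap_expo.
  by rewrite swap_idx_id ?gtn_eqF // ?nth_default // ?(leq_trans le) //; lia.
congr (if _ then _ else _); apply/idP/idP; first exact: sz.
by rewrite -{2}(swap_expoK i e); apply: sz.
Qed.

Lemma transpE i (lt : (i.+1 < m)%N) :
  transp m i = tperm (Ordinal (ltnW lt)) (Ordinal lt).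
Proof.
by rewrite /transp (insubT (fun j => j < m)%N (ltnW lt)) (insubT (fun j => j < m)%N lt).
Qed.

Lemma transp_val i (j : 'I_m) : (i.+1 < m)%N -> transp m i j = swap_idx i j :> nat.
Proof.
move=> lt; rewrite (transpE lt) /=; case: tpermP => [->|->|].
- by rewrite eqxx.
- by rewrite /= gtn_eqF // eqxx.
move=> n1 n2; rewrite ifN; last by apply/eqP => E; apply: n1; apply: val_inj.
by rewrite ifN //; apply/eqP => E; apply: n2; apply: val_inj.
Qed.

Lemma msym_xv i j : (i.+1 < m)%N -> msym (transp m i) (xv m j) = xv m (swap_idx i j).
Proof.
move=> lt; case: (ltnP j m) => [ltj|le].
  rewrite (xv_ord (Ordinal ltj)) /msym mmapX mmap1U -xv_ord.
  by rewrite transp_val.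
by rewrite swap_idx_id ?gtn_eqF //; try lia; rewrite xv_out // msym0.
Qed.

Lemma incl_msym i p : (i.+1 < m)%N -> incl (msym (transp m i) p) = swap_series i (incl p).
Proof.
move=> lt; apply: (mpoly_morph_ext (f := incl \o msym (transp m i))
  (g := swap_series i \o incl)) => [c|j] /=.
  by rewrite -[c%:MP]mulr1 mul_mpolyC !linearZ /= !rmorph1.
rewrite -xv_ord msym_xv // !incl_xv -cut_swap // swap_xs.
by [].
Qed.

Lemma Xi_swap i f : bounded_degree f -> (i.+1 < m)%N ->
  Xi m (swap_series i f) = msym (transp m i) (Xi m f).
Proof.
move=> bf lt; apply: XiP; first exact: bounded_degree_swap.
by rewrite incl_msym // incl_Xi // cut_swap.
Qed.

Lemma xv_neq i : (i.+1 < m)%N -> xv m i - xv m i.+1 != 0.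
Proof.
move=> lt; apply/eqP => /(congr1 (mcoeff U_(Ordinal (ltnW lt)))).
rewrite (xv_ord (Ordinal (ltnW lt))) (xv_ord (Ordinal lt)) mcoeffB !mcoeffXU mcoeff0.
by rewrite eqxx -val_eqE /= gtn_eqF // subr0 => /eqP; rewrite oner_eq0.
Qed.

Lemma swap_datum_mpoly i : (i.+1 < m)%N ->
  swap_datum (msym (transp m i)) (xv m i) (xv m i.+1).
Proof.
move=> lt; split.
- by move=> c f g; rewrite linearP.
- by move=> f g; rewrite rmorphM.
- by move=> f; rewrite -msymMm (transpE lt) tperm2 msym1m.
- by rewrite msym_xv // swap_idx_l.
- by move=> h /eqP; rewrite mulf_eq0 (negbTE (xv_neq lt)) => /eqP.
(* Division by x_i - x_{i+1} is carried out on series, where the quotient is explicit, and then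
   truncated. *)
move=> p; exists (Xi m (divided_difference i (incl p))).
apply: incl_inj; rewrite rmorphM rmorphB /= !incl_xv.
rewrite incl_Xi; last exact/bounded_divided_difference/bounded_incl.
rewrite -rmorphB -rmorphM divided_differenceP !rmorphB /= cut_swap // cut_incl.
by rewrite incl_msym.
Qed.

Lemma Xi_Ts i f : bounded_degree f -> (i.+1 < m)%N -> Xi m (Ts i f) = Tv i (Xi m f).
Proof.
move=> bf lt; apply: XiP; first exact: bounded_Ts.
rewrite /Ts /Tv (T_morph (swap_datum_series i) (swap_datum_series i) (phi := cut m));
  try by [move=> *; rewrite ?linearP ?rmorphM | rewrite cut_xs ?lt ?(ltnW lt)].
  rewrite (T_morph (swap_datum_mpoly lt) (swap_datum_series i) (phi := incl)).
  - by rewrite incl_Xi.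
  - by move=> *; rewrite linearP.
  - by move=> *; rewrite rmorphM.
  - by rewrite incl_xv cut_xs (ltnW lt).
  - by rewrite incl_xv cut_xs lt.
  - by rewrite incl_msym.
by rewrite cut_swap.
Qed.

Lemma Xi_Ts_inv i f :
  bounded_degree f -> (i.+1 < m)%N -> Xi m (Ts_inv i f) = Tv_inv i (Xi m f).
Proof.
move=> bf lt; have -> : Ts_inv i f = q^-1 *: (Ts i f + (q - 1) *: f) by [].
rewrite XiZ; last first.
  by apply: bounded_degreeD; [exact: bounded_Ts | exact: bounded_degree_scale].
by rewrite XiD ?XiZ ?Xi_Ts //; [exact: bounded_Ts | exact: bounded_degree_scale].
Qed.

End Incl.

(** * Symmetric polynomials and the idempotents *)

Section ReducedWords.
Variable n : nat.
Implicit Types (s : 'S_n) (w : seq nat).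

Definition inversions s : {set 'I_n * 'I_n} :=
  [set p : 'I_n * 'I_n | (p.1 < p.2)%N && (s p.2 < s p.1)%N].

Lemma swap_idx_lt i x y : (x < y)%N -> ~~ ((x == i) && (y == i.+1)) ->
  (swap_idx i x < swap_idx i y)%N.
Proof.
by rewrite /=; case: (x =P i); case: (x =P i.+1); case: (y =P i);
  case: (y =P i.+1) => //=; lia.
Qed.

Lemma transpK i s : (transp n i * (transp n i * s))%g = s.
Proof.
rewrite mulgA /transp; case: (insub i : option 'I_n) => [a|]; last by rewrite !mul1g.
by case: (insub i.+1 : option 'I_n) => [b|]; rewrite ?tperm2 ?mul1g.
Qed.

(** The swap of the positions i and i+1 preserves the order of every pair of positions except (i,
    i+1), so it matches the remaining inversions of both permutations. *)
Lemma inversions_transp i s (lt : (i.+1 < n)%N) :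
  (s (Ordinal lt) < s (Ordinal (ltnW lt)))%N ->
  #|inversions s| = #|inversions (transp n i * s)|.+1.
Proof.
set b := Ordinal lt; set a := Ordinal (ltnW lt) => ltba.
have ta : transp n i a = b by apply: val_inj; rewrite /= transp_val //= eqxx.
have tb : transp n i b = a by apply: val_inj; rewrite /= transp_val //= eqxx gtn_eqF.
have tK x : transp n i (transp n i x) = x.
  by apply: val_inj; rewrite /= !transp_val // swap_idxK.
pose phi (p : 'I_n * 'I_n) := (transp n i p.1, transp n i p.2).
have phiK : cancel phi phi by move=> [x y]; rewrite /phi /= !tK.
have tlt (x y : 'I_n) : (x < y)%N -> (x, y) != (a, b) -> (transp n i x < transp n i y)%N.
  by move=> ltxy ne; rewrite !transp_val //; apply: swap_idx_lt.
rewrite (cardsD1 (a, b)) inE /= ltnSn ltba /= add1n; congr _.+1.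
rewrite -(card_imset _ (can_inj phiK)) (can_imset_pre _ phiK); congr #|pred_of_set _|.
apply/setP => -[x y]; rewrite !inE /phi /= !permM.
have pE : ((transp n i x, transp n i y) == (a, b)) = ((x, y) == (b, a)).
  apply/eqP/eqP => -[E1 E2]; last by rewrite E1 E2 ta tb.
  by rewrite -[x]tK -[y]tK E1 E2 ta tb.
apply/andP/andP => [[ne /andP[l1 l2]]|[l1 l2]].
  by split=> //; rewrite -(tK x) -(tK y); apply: tlt.
have ne : (x, y) != (a, b).
  by apply: contraTneq l2 => -[-> ->]; rewrite ta tb -leqNgt ltnW.
rewrite pE (tlt _ _ l1 ne) l2; split=> //; apply: contraTneq l1 => -[-> ->].
by rewrite /= -leqNgt.
Qed.

Lemma inversions_transp_ge i s (lt : (i.+1 < n)%N) :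
  (s (Ordinal (ltnW lt)) < s (Ordinal lt))%N ->
  #|inversions (transp n i * s)| = #|inversions s|.+1.
Proof.
move=> ltab; rewrite -[in RHS](transpK i s); apply: (@inversions_transp i _ lt).
rewrite !permM; set b := Ordinal lt; set a := Ordinal (ltnW lt).
have -> : transp n i a = b by apply: val_inj; rewrite /= transp_val //= eqxx.
by have -> : transp n i b = a by apply: val_inj; rewrite /= transp_val //= eqxx gtn_eqF.
Qed.

Lemma perm_ltn_total i s (lt : (i.+1 < n)%N) :
  (s (Ordinal lt) < s (Ordinal (ltnW lt)))%N \/ (s (Ordinal (ltnW lt)) < s (Ordinal lt))%N.
Proof.
case: ltngtP => [_|_|/val_inj/perm_inj/(congr1 val) /=]; [by left|by right|].
by move/eqP; rewrite gtn_eqF.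
Qed.

(** Without descents s is increasing, with gaps at least those of the arguments; comparing with the
    least and the greatest index bounds s x by x from both sides. *)
Lemma no_descent_id s :
  (forall i (lt : (i.+1 < n)%N), (s (Ordinal (ltnW lt)) < s (Ordinal lt))%N) -> s = 1%g.
Proof.
move=> H.
have grow d (x y : 'I_n) : y = (x + d)%N :> nat -> (s x + d <= s y)%N.
  elim: d y => [|d IH] y E.
    by have -> : y = x by [apply: val_inj; rewrite /= E addn0]; rewrite addn0.
  have lty : ((x + d).+1 < n)%N by rewrite -addnS -E.
  have := H _ lty; rewrite addnS; rewrite (_ : Ordinal lty = y); last first.
    by apply: val_inj; rewrite /= E addnS.
  by apply: leq_ltn_trans; apply: IH.
apply/permP => x; rewrite perm1; apply: val_inj; apply/eqP; rewrite eqn_leq /=.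
have n0 : (0 < n)%N by apply: leq_ltn_trans (ltn_ord x).
apply/andP; split; last first.
  by have := grow x (Ordinal n0) x erefl; apply: leq_trans; rewrite leq_addl.
have ltm : (n.-1 < n)%N by rewrite prednK.
have := grow (n.-1 - x)%N x (Ordinal ltm); rewrite /= subnKC ?(ltn_predK ltm); last first.
  by rewrite -ltnS prednK.
move=> /(_ erefl) => le; have := ltn_ord (s (Ordinal ltm)); have := ltn_ord x.
by move: (nat_of_ord (s x)) (nat_of_ord (s (Ordinal ltm))) le => *; lia.
Qed.

Lemma word_exists s : exists2 w, is_word s w & size w = #|inversions s|.
Proof.
have [m] := ubnP #|inversions s|; elim: m s => // m IH s le.
have [[i [lt desc]]|nd] := pselect
    (exists i (lt : (i.+1 < n)%N), (s (Ordinal lt) < s (Ordinal (ltnW lt)))%N).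
  have E := inversions_transp desc.
  have [|w [wn ws] sw] := IH (transp n i * s)%g; first by rewrite -E.
  exists (i :: w); last by rewrite /= sw E.
  by split; rewrite /= ?lt // big_cons -ws transpK.
have s1 : s = 1%g.
  apply: no_descent_id => i lt; case: (perm_ltn_total s lt) => // d.
  by case: nd; exists i, lt.
exists [::]; first by split=> //; rewrite big_nil.
apply/esym/eqP; rewrite cards_eq0 -subset0; apply/subsetP => -[x y].
by rewrite !inE s1 !perm1 /= => /andP[/ltn_trans H /H]; rewrite ltnn.
Qed.

Lemma word_size_ge s w : is_word s w -> (#|inversions s| <= size w)%N.
Proof.
elim: w s => [|i w IH] s [/= wn ->].
  rewrite big_nil leqn0 cards_eq0 -subset0; apply/subsetP => -[x y].
  by rewrite !inE !perm1 /= => /andP[/ltn_trans H /H]; rewrite ltnn.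
case/andP: wn => lt wn; rewrite big_cons; set s' := (\prod_(j <- w) _)%g.
have le : (#|inversions s'| <= size w)%N by apply: IH.
case: (perm_ltn_total s' lt) => d; last by rewrite (inversions_transp_ge d).
by apply: leq_trans (leqnSn _); apply: leq_trans le; rewrite (inversions_transp d) leqnSn.
Qed.

(** Removing descents one at a time gives a word as long as the number of inversions, and each
    letter of any word changes that number by one. So the chosen word of least length has exactly
    this length. *)
Lemma reduced_wordP s :
  is_word s (reduced_word s) /\ size (reduced_word s) = #|inversions s|.
Proof.
have [w ww sw] := word_exists s.
have [|rw min] := epsilon_spec (inhabits [::]) (fun w =>
    is_word s w /\ forall w', is_word s w' -> (size w <= size w')%N).
  by exists w; split=> // w' /word_size_ge; rewrite sw.
split=> //; apply/eqP; rewrite eqn_leq -{1}sw (min w ww) /=.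
exact: word_size_ge rw.
Qed.

(* A reduced word only swaps positions carrying an inversion, and a permutation fixing
   the first k points has no inversion involving them. *)
Lemma reduced_word_ge k s w : is_word s w -> size w = #|inversions s| ->
  (forall x : 'I_n, (x < k)%N -> s x = x) -> all (fun i => k <= i)%N w.
Proof.
elim: w s => //= i w IH s [/= /andP[lt wn]]; rewrite big_cons => Es sw fix_s.
have Es' : (\prod_(j <- w) transp n j)%g = (transp n i * s)%g by rewrite Es transpK.
have ww : is_word (transp n i * s)%g w by split.
have d : (s (Ordinal lt) < s (Ordinal (ltnW lt)))%N.
  case: (perm_ltn_total s lt) => // d; have := word_size_ge ww.
  by rewrite (inversions_transp_ge d) -sw ltnNge leqnSn.
have ki : (k <= i)%N.
  rewrite leqNgt; apply/negP => ltik; move: d; rewrite (fix_s (Ordinal (ltnW lt))) //=.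
  move=> d; have /perm_inj E := fix_s _ (ltn_trans d ltik).
  by move: d; rewrite E /= ltnNge leqnSn.
rewrite ki /=; apply: (IH _ ww); first by apply/succn_inj; rewrite sw (inversions_transp d).
move=> x ltx; rewrite permM (_ : transp n i x = x) ?fix_s //.
by apply: val_inj; rewrite /= transp_val // swap_idx_id // ltn_eqF //; lia.
Qed.

End ReducedWords.

Lemma q_eval_neq0 (P : {mpoly rat[2]}) (c : rat) :
  P.@[fun=> c] != 0 -> tofrac P != 0.
Proof. by apply: contra; rewrite tofrac_eq0 => /eqP ->; rewrite meval0. Qed.

(** Multiplied by q^M the sum becomes a polynomial, whose value at q = 1 is the number of
    indices. *)
Lemma sum_qpow_neq0 (I : finType) (P : pred I) (l : I -> nat) (c : nat) i0 :
  P i0 -> \sum_(i | P i) q ^+ c / q ^+ l i != 0.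
Proof.
move=> Pi0; pose M := (\sum_i l i)%N.
have lM i : (l i <= M)%N by rewrite /M (bigD1 i) //= leq_addr.
suff : q ^+ M * (\sum_(i | P i) q ^+ c / q ^+ l i) != 0.
  by rewrite mulf_eq0 negb_or => /andP[].
have -> : q ^+ M * (\sum_(i | P i) q ^+ c / q ^+ l i) =
    tofrac (\sum_(i | P i) 'X_(@Ordinal 2 0 isT) ^+ (c + (M - l i))).
  rewrite mulr_sumr rmorph_sum; apply: eq_bigr => i _; rewrite rmorphXn exprD.
  by rewrite mulrCA expfB_cond ?lM // (negbTE q_neq0) /= lM.
apply: (@q_eval_neq0 _ 1); rewrite raddf_sum /=.
under eq_bigr => i _ do rewrite rmorphXn /= mevalXU expr1n.
by rewrite sumr_const Num.Theory.pnatr_eq0 -lt0n; apply/card_gt0P; exists i0.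
Qed.

Lemma one_sub_qpow_neq0 i : (0 < i)%N -> 1 - q ^+ i != 0.
Proof.
move=> gt; rewrite -tofrac1 -rmorphXn -rmorphB /=.
apply: (@q_eval_neq0 _ 0); rewrite rmorphB rmorph1 rmorphXn /= mevalXU.
by rewrite expr0n gtn_eqF // subr0 oner_eq0.
Qed.

Lemma qfact_neq0 m : qfact m != 0.
Proof.
rewrite /qfact prodf_seq_neq0; apply/allP => i; rewrite mem_index_iota => /andP[gt _].
by rewrite /= mulf_neq0 ?invr_eq0 ?one_sub_qpow_neq0 // -(expr1 q) one_sub_qpow_neq0.
Qed.

(** Reduced words of the permutations fixing the first k points use only letters at least k, and
    such T_i fix g. So eps_k multiplies g by the scalar c, which is not zero, and g is eps_k applied
    to c^-1 g. *)
Lemma inLV_sym n k (g : {mpoly Qqt[n]}) :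
  (forall i, (k <= i)%N -> (i.+1 < n)%N -> msym (transp n i) g = g) ->
  inLV k (\prod_(i < k) xv n i * g).
Proof.
move=> sg; pose c := (qfact (n - k))^-1 * \sum_(s : 'S_n |
   [forall i : 'I_n, (i < k)%N ==> (s i == i)]) (q ^+ 'C(n - k, 2) / q ^+ perm_length s).
have c0 : c != 0.
  rewrite mulf_neq0 ?invr_eq0 ?qfact_neq0 //; apply: (@sum_qpow_neq0 _ _ _ _ 1%g).
  by apply/forallP => i; rewrite perm1 eqxx implybT.
exists (c^-1 *: g); congr (_ * _); rewrite /eps.
transitivity (c *: (c^-1 *: g)); first by rewrite scalerA mulfV // scale1r.
rewrite -scalerA scaler_suml; congr (_ *: _); apply: eq_bigr => s /forallP Hs.
congr (_ *: _); rewrite /Tv_perm; have [ww sw] := reduced_wordP s.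
have fs (x : 'I_n) : (x < k)%N -> s x = x.
  by move=> ltx; have /implyP/(_ ltx)/eqP := Hs x.
have /allP wk := reduced_word_ge ww sw fs; case: ww => /allP wn _.
elim: (reduced_word s) wk wn => //= i w IH wk wn; rewrite -IH; last first.
- by move=> j jw; apply: wn; rewrite inE jw orbT.
- by move=> j jw; apply: wk; rewrite inE jw orbT.
have lt : (i.+1 < n)%N by apply: wn; rewrite inE eqxx.
apply/esym/(T_fix (swap_datum_mpoly lt)).
by rewrite msymZ sg //; apply: wk; rewrite inE eqxx.
Qed.

(** * Uniqueness of the limit *)

Lemma fractionP (R : idomainType) (x : {fraction R}) :
  exists a b, b != 0 /\ x = tofrac a / tofrac b.
Proof.
elim/generic_quotient.quotW: x => r; exists (frac r).1, (frac r).2.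
have d0 := denom_ratioP r; split=> //.
apply: (canRL (mulfK _)); first by rewrite tofrac_eq0.
unlock tofrac; rewrite -[LHS](FracField.pi_mul).
apply/generic_quotient.eqmodP => /=; rewrite /FracField.equivf /FracField.mulf.
by rewrite !numden_Ratio ?mulr1 ?oner_eq0 ?mulf_neq0 ?oner_eq0 // mulrC.
Qed.

Definition polyq (a : {mpoly rat[2]}) : Qqt := tofrac a.

Lemma polyq_zmod : zmod_morphism polyq.
Proof. exact: tofrac_is_zmod_morphism. Qed.
Lemma polyq_monoid : monoid_morphism polyq.
Proof. exact: tofrac_is_monoid_morphism. Qed.
HB.instance Definition _ := GRing.isZmodMorphism.Build {mpoly rat[2]} Qqt polyq polyq_zmod.
HB.instance Definition _ :=
  GRing.isMonoidMorphism.Build {mpoly rat[2]} Qqt polyq polyq_monoid.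

Lemma polyq_eq a b : (polyq a == polyq b) = (a == b).
Proof. exact: tofrac_eq. Qed.

Lemma polyq_eq0 a : (polyq a == 0) = (a == 0).
Proof. exact: tofrac_eq0. Qed.

Lemma polyqP (c : Qqt) : exists a b, b != 0 /\ c = polyq a / polyq b.
Proof. exact: fractionP. Qed.

Section QadicLimit.
Let X0 : {mpoly rat[2]} := 'X_(@Ordinal 2 0 isT).
Implicit Types a b : {mpoly rat[2]}.

(* Evaluation at q = 0; its kernel is the prime ideal (q). *)
Definition eval_q0 : {mpoly rat[2]} -> {mpoly rat[2]} :=
  mmap (@mpolyC 2 rat) (fun i => if i == @Ordinal 2 0 isT then 0 else 'X_i).

Lemma eval_q0P b : exists b', b = eval_q0 b + X0 * b'.
Proof.
elim/mpolyind: b => [|c m p _ _ [b' E]].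
  by exists 0; rewrite /eval_q0 rmorph0 mulr0 addr0.
have Ep : eval_q0 (c *: 'X_[m] + p) = c *: eval_q0 'X_[m] + eval_q0 p.
  by rewrite /eval_q0 rmorphD /= mmapZ mul_mpolyC.
rewrite Ep; suff [b'' E''] : exists b'', 'X_[m] = eval_q0 'X_[m] + X0 * b''.
  exists (c *: b'' + b'); rewrite {1}E'' {1}E scalerDr mulrDr -scalerAr.
  by rewrite -!addrA; congr (_ + _); rewrite addrCA.
rewrite /eval_q0 mmapX; have [m0|mp] := posnP (m (@Ordinal 2 0 isT)).
  exists 0; rewrite mulr0 addr0 {1}mpolyXE_id; apply: eq_bigr => i _.
  by case: eqP => // ->; rewrite m0 !expr0.
exists 'X_[m - U_(@Ordinal 2 0 isT)]; rewrite /mmap1 (bigD1 (@Ordinal 2 0 isT)) //=.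
by rewrite expr0n gtn_eqF // mul0r add0r -mpolyXD addmC submK // lep1mP -lt0n.
Qed.

Lemma eval_q0X : eval_q0 X0 = 0.
Proof. by rewrite /eval_q0 mmapX mmap1U eqxx. Qed.

Lemma eval_q0M a b : eval_q0 (a * b) = eval_q0 a * eval_q0 b.
Proof. by rewrite /eval_q0 rmorphM. Qed.

(** Divisibility by q becomes vanishing at q = 0; primality of q is then the multiplicativity of the
    evaluation. *)
Lemma q_dvdP b : (exists b', b = X0 * b') <-> eval_q0 b = 0.
Proof.
split=> [[b' ->]|E]; first by rewrite eval_q0M eval_q0X mul0r.
by have [b' Eb] := eval_q0P b; exists b'; rewrite {1}Eb E add0r.
Qed.

Lemma q_ndvdP b : ~ (exists b', b = X0 * b') <-> eval_q0 b != 0.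
Proof.
split=> [H|/eqP nE /q_dvdP //]; by apply/eqP => /q_dvdP.
Qed.

Lemma eval_q0_neq0 b : eval_q0 b != 0 -> b != 0.
Proof. by apply: contra => /eqP ->; rewrite /eval_q0 rmorph0. Qed.

Lemma qadic_geP N c : qadic_ge N c <->
  exists a b, eval_q0 b != 0 /\ c = q ^+ N * (polyq a / polyq b).
Proof.
by split=> -[a [b [nb E]]]; exists a, b; split=> //; apply/q_ndvdP.
Qed.

Lemma qadic_ge_add N c d : qadic_ge N c -> qadic_ge N d -> qadic_ge N (c + d).
Proof.
move=> /qadic_geP [a [b [nb ->]]] /qadic_geP [a' [b' [nb' ->]]]; apply/qadic_geP.
exists (a * b' + a' * b), (b * b'); rewrite eval_q0M mulf_neq0 //; split=> //.
have pb : polyq b != 0 by rewrite polyq_eq0; exact: eval_q0_neq0.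
have pb' : polyq b' != 0 by rewrite polyq_eq0; exact: eval_q0_neq0.
by rewrite -mulrDr (addf_div _ _ pb pb') rmorphD !rmorphM.
Qed.

Lemma qadic_ge_mul N c a : qadic_ge N c -> qadic_ge N (c * polyq a).
Proof.
move=> /qadic_geP [a' [b [nb ->]]]; apply/qadic_geP; exists (a' * a), b; split=> //.
by rewrite rmorphM -!mulrA; congr (_ * (_ * _)); rewrite mulrC.
Qed.

Lemma qadic_ge0 N : qadic_ge N 0.
Proof.
by apply/qadic_geP; exists 0, 1; rewrite /eval_q0 !(rmorph0, rmorph1) oner_eq0 mul0r mulr0.
Qed.

(** Write c = u / v. Membership in the M-th power gives u b = q^M a v with b prime to q, so q^M
    divides u. For M = [msize u], which exceeds the degree of u, this forces u = 0. *)
Lemma qadic_ge_eq0 c : (forall N, qadic_ge N c) -> c = 0.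
Proof.
move=> H; have [u [v [v0 Ec]]] := polyqP c.
have [u0|u0] := eqVneq u 0; first by rewrite Ec u0 rmorph0 mul0r.
have /qadic_geP [a [b [nb E]]] := H (msize u).
have pb : polyq b != 0 by rewrite polyq_eq0; exact: eval_q0_neq0.
have pv : polyq v != 0 by rewrite polyq_eq0.
have Eub : u * b = X0 ^+ msize u * (a * v).
  apply/eqP; rewrite -polyq_eq !rmorphM rmorphXn; apply/eqP.
  move: E; rewrite Ec mulrA => /eqP; rewrite (eqr_div _ _ pv pb) => /eqP ->.
  by rewrite -mulrA.
have dvd M w d : w * b = X0 ^+ M * d -> exists w', w = X0 ^+ M * w'.
  elim: M w d => [|M IH] w d Ew; first by exists w; rewrite expr0 mul1r.
  have [d' Ed] : exists d', w = X0 * d'.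
    apply/q_dvdP; have := congr1 eval_q0 Ew.
    rewrite exprS -mulrA !eval_q0M eval_q0X mul0r => /eqP.
    by rewrite mulf_eq0 (negbTE nb) orbF => /eqP.
  have X0n : X0 != 0 by apply: mpolyX_neq0.
  have [|w' Ew'] := IH d' d.
    by apply: (mulfI X0n); rewrite mulrA -Ed Ew exprS mulrA.
  by exists w'; rewrite Ed Ew' exprS mulrA.
have [w' Ew] := dvd _ _ _ Eub; move: (u0).
have w0 : w' != 0 by apply: contraNneq u0 => w0; rewrite Ew w0 mulr0.
have := congr1 (fun p => msize p) Ew.
rewrite /X0 mpolyXn msizeM ?mpolyX_neq0 // msizeX mdegMn mdeg1 mul1n addSn /=.
move/eqP; rewrite -{1}[msize u]addn0 eqn_add2l eq_sym msize_poly_eq0.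
by rewrite (negbTE w0).
Qed.

Lemma common_denominator N (g : 'I_N -> Qqt) :
  exists D, D != 0 /\ forall j, exists G, polyq D * g j = polyq G.
Proof.

have [den dP] : exists den : 'I_N -> {mpoly rat[2]},
    forall j, den j != 0 /\ exists a, g j = polyq a / polyq (den j).
  pose R j b := b != 0 /\ exists a, g j = polyq a / polyq b.
  have RP j : exists b, R j b by have [a [b [b0 E]]] := polyqP (g j); exists b; split=> //; exists a.
  by exists (fun j => projT1 (cid (RP j))) => j; exact: projT2 (cid (RP j)).
exists (\prod_j den j); split.
  by rewrite prodf_seq_neq0; apply/allP => j _ /=; case: (dP j).
move=> j; have [d0 [a ->]] := dP j; exists (a * \prod_(i | i != j) den i).
by rewrite (bigD1 j) //= !rmorphM /= mulrC mulrA mulfVK ?polyq_eq0.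
Qed.

(** The scalars g_j may have q in their denominators. Multiplied by a common denominator, the
    constant d lies in every power of q. *)
Lemma qadic_cvg_sum_eq0 N (cs : 'I_N -> nat -> Qqt) (c g : 'I_N -> Qqt) (d : Qqt) m0 :
  (forall j, qadic_cvg (cs j) (c j)) ->
  (forall m, (m0 <= m)%N -> \sum_j (cs j m - c j) * g j = d) -> d = 0.
Proof.
move=> cvg Hd; have [D [D0 GP]] := common_denominator g.
suff /eqP : polyq D * d = 0 by rewrite mulf_eq0 polyq_eq0 (negbTE D0) => /eqP.
apply: qadic_ge_eq0 => M.
have [m1 m1P] : exists m1, forall j m, (m1 <= m)%N -> qadic_ge M (cs j m - c j).
  pose mj j := projT1 (cid (cvg j M)).
  exists (\max_j mj j) => j m le; apply: (projT2 (cid (cvg j M))).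
  by apply: leq_trans le; apply: (leq_bigmax j).
rewrite -(Hd (maxn m0 m1)) ?leq_maxl // mulr_sumr.
elim/big_rec: _ => [|j x _ gx]; first exact: qadic_ge0.
apply: qadic_ge_add gx; have [G EG] := GP j.
by rewrite mulrCA EG; apply/qadic_ge_mul/m1P/leq_maxr.
Qed.

End QadicLimit.

(** Fix an exponent e. For large m its coefficient in f_m is that of H, so the coefficient of H
    minus the limit is independent of m, and it is a combination of scalars c_j^(m) - c_j tending to
    0. *)
Lemma IW_limit_unique (f : forall m, {mpoly Qqt[m]}) (H l : Sqt) m0 :
  (forall m, (m0 <= m)%N -> cut m H = incl (f m)) ->
  is_IW_limit f l -> l = H.
Proof.
move=> HP [h [N [g [cs [c [[ah ag] cvg [m1 fP] ->]]]]]].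
apply: funext => e; apply/esym/eqP; rewrite -subr_eq0; apply/eqP.
have bP u : inPas u -> bounded_degree u by case=> k /inPas_kP [].
pose M := maxn (size e) (maxn m0 m1).
apply: (@qadic_cvg_sum_eq0 _ cs c (fun j => g j e) _ M) => // m.
rewrite !geq_max => /and3P[le1 le2 le3].
have ceE (u : Sqt) : cut m u e = u e by rewrite /cut /reindex_series le1.
have := congr1 (fun u : Sqt => u e) (HP m le2); rewrite ceE => ->.
rewrite fP // rmorphD rmorph_sum series_addE series_sumE [in RHS]series_addE series_sumE /=.
rewrite incl_Xi ?ceE; last by exact: bP.
rewrite opprD addrACA subrr add0r -sumrB; apply: eq_bigr => j _.
by rewrite linearZ /= series_scaleE incl_Xi ?ceE ?series_scaleE ?mulrBl //; apply: bP.
Qed.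

(** * Cherednik operators *)

(* If h is symmetric in the last two of three variables, T_2 T_1 h is symmetric in the
   first two: clearing denominators, it becomes an expression in h and its two images
   that the swap of the first two variables changes by a sign. *)
Lemma swap_TT (A : comAlgType Qqt) (s r : A -> A) (x y z h : A) :
  swap_datum s x y -> swap_datum r y z -> s z = z -> r x = x ->
  s (r (s h)) = r (s (r h)) -> r h = h ->
  let F := demazure_lusztig r y z (demazure_lusztig s x y h) in s F = F.
Proof.
move=> ds dr sz rx braid rh F; pose B := s h; pose C := r (s h).
have sB : s B = h by rewrite /B (swapK ds).
have sC : s C = C by rewrite /C braid rh.
have sx := swap_x ds; have sy := swap_y ds; have ry := swap_x dr.
set G := demazure_lusztig s x y h in F *.
have E1 : (x - y) * G = (q *: x - y) * B + (1 - q) *: (x * h).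
  exact: demazure_lusztigP.
have E2 : (y - z) * F = (q *: y - z) * r G + (1 - q) *: (y * G).
  exact: demazure_lusztigP.
have E3 : (x - z) * r G = (q *: x - z) * C + (1 - q) *: (x * h).
  have := congr1 r E1; rewrite (swapD dr) !(swapZ dr, swapM dr, swapB dr) rx ry rh.
  by [].
have sh : s h = B by [].
clearbody F G C B.
(* The factor x - z is not covered by either datum, but r turns it into x - y. *)
have reg u : (x - y) * (x - z) * (y - z) * u = 0 -> u = 0.
  rewrite -!mulrA => /(swap_reg ds) /(congr1 r).
  rewrite (swapM dr) (swapB dr) rx (swap_y dr) (swap0 dr) => /(swap_reg ds) /(congr1 r).
  by rewrite (swapK dr) (swap0 dr) => /(swap_reg dr).
have EF : (x - y) * (x - z) * (y - z) * F =
   (q *: y - z) * (x - y) * ((q *: x - z) * C + (1 - q) *: (x * h))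
   + (1 - q) *: (y * ((x - z) * ((q *: x - y) * B + (1 - q) *: (x * h)))).
  have -> : (x - y) * (x - z) * (y - z) * F = (x - y) * (x - z) * ((y - z) * F) by ring.
  by rewrite E2 -E1 -E3 !scale_in_alg; ring.
have EsF := congr1 s EF.
rewrite (swapD ds) !(swapZ ds, swapM ds, swapB ds, swapD ds) in EsF.
rewrite sx sy sz sB sC sh in EsF.
apply/eqP; rewrite -subr_eq0; apply/eqP; apply: reg; rewrite mulrBr EF.
have -> : (x - y) * (x - z) * (y - z) * s F = - ((y - x) * (y - z) * (x - z) * s F).
  by ring.
rewrite EsF !scale_in_alg !(rmorphB, rmorph1) /=; ring.
Qed.

Lemma foldr_rev_iota_addS (T : Type) (f : nat -> T -> T) x k m :
  foldr f x (rev (iota k m.+1)) = f (k + m)%N (foldr f x (rev (iota k m))).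
Proof. by rewrite -addn1 iotaD rev_cat. Qed.

Lemma foldr_rev_iotaS (T : Type) (f : nat -> T -> T) x m :
  foldr f x (rev (iota 0 m.+1)) = f m (foldr f x (rev (iota 0 m))).
Proof. exact: foldr_rev_iota_addS. Qed.

Section MpolyT.
Variable n : nat.
Implicit Types p g h : {mpoly Qqt[n]}.
Local Notation x := (xv n).
Local Notation s i := (msym (transp n i)).

Lemma xv_neq0 i : (i < n)%N -> x i != 0.
Proof. by move=> lt; rewrite (xv_ord (Ordinal lt)) mpolyX_neq0. Qed.

Lemma Tv_mull i g h : (i.+1 < n)%N -> s i g = g -> Tv i (g * h) = g * Tv i h.
Proof. by move=> lt; apply: (T_mull (swap_datum_mpoly lt)). Qed.

Lemma Tv_inv_mull i g h : (i.+1 < n)%N -> s i g = g -> Tv_inv i (g * h) = g * Tv_inv i h.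
Proof. by move=> lt; apply: (Tinv_mull (swap_datum_mpoly lt)). Qed.

Lemma Tv_inv_x i g : (i.+1 < n)%N -> Tv_inv i (x i * g) = q^-1 *: (x i.+1 * Tv i g).
Proof. by move=> lt; apply: (Tinv_x (swap_datum_mpoly lt)). Qed.

Lemma Tv_invZ i c p : (i.+1 < n)%N -> Tv_inv i (c *: p) = c *: Tv_inv i p.
Proof. by move=> lt; apply: (Tinv_Z (swap_datum_mpoly lt)). Qed.

Lemma msym_xv_id i j : (i.+1 < n)%N -> j != i -> j != i.+1 -> s i (x j) = x j.
Proof. by move=> lt ji ji1; rewrite msym_xv // swap_idx_id. Qed.

Lemma mpoly_morph_xv (m : nat) (f g : {rmorphism {mpoly Qqt[n]} -> {mpoly Qqt[m]}}) :
  (forall c, f c%:MP = g c%:MP) ->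
  (forall i, (i < n)%N -> f (x i) = g (x i)) -> f =1 g.
Proof.
by move=> Ec Ex; apply: mpoly_morph_ext => // i; rewrite -xv_ord Ex.
Qed.

Lemma msymC i (c : Qqt) : s i c%:MP = c%:MP.
Proof. exact: mmapC. Qed.

Lemma msym_comm i j p : (i.+1 < n)%N -> (j.+1 < i)%N -> s i (s j p) = s j (s i p).
Proof.
move=> lti ltj; have ltj' : (j.+1 < n)%N by lia.
apply: (mpoly_morph_xv (f := s i \o s j) (g := s j \o s i)) => [c|l _] /=.
  by rewrite !msymC.
rewrite !msym_xv //; congr x; rewrite /=.
by case: (l =P i); case: (l =P i.+1); case: (l =P j); case: (l =P j.+1) => //= *;
  repeat case: eqP => //; lia.
Qed.

Lemma msym_braid j p : (j.+2 < n)%N ->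
  s j (s j.+1 (s j p)) = s j.+1 (s j (s j.+1 p)).
Proof.
move=> lt; have lt' : (j.+1 < n)%N by lia.
apply: (mpoly_morph_xv (f := s j \o s j.+1 \o s j) (g := s j.+1 \o s j \o s j.+1))
  => [c|l _] /=.
  by rewrite !msymC.
rewrite !msym_xv //; congr x; rewrite /=.
by case: (l =P j); case: (l =P j.+1); case: (l =P j.+2) => //= *;
  repeat case: eqP => //; lia.
Qed.

Lemma msym_Tv i j p : (i.+1 < n)%N -> (j.+1 < n)%N -> (j.+1 < i)%N || (i.+1 < j)%N ->
  s i (Tv j p) = Tv j (s i p).
Proof.
move=> lti ltj far; rewrite /Tv.
apply: (T_morph (swap_datum_mpoly ltj) (swap_datum_mpoly ltj) (phi := s i)).
- by move=> c f g; rewrite linearP.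
- by move=> f g; rewrite rmorphM.
- by rewrite msym_xv_id //; lia.
- by rewrite msym_xv_id //; lia.
by case/orP: far => far; [apply: msym_comm | apply/esym/msym_comm].
Qed.

Lemma msym_TvTv j h : (j.+2 < n)%N -> s j.+1 h = h ->
  s j (Tv j.+1 (Tv j h)) = Tv j.+1 (Tv j h).
Proof.
move=> lt rh; have lt' : (j.+1 < n)%N by lia.
have sz : s j (x j.+2) = x j.+2 by rewrite msym_xv_id //; lia.
have rx : s j.+1 (x j) = x j by rewrite msym_xv_id //; lia.
exact: (swap_TT (swap_datum_mpoly lt') (swap_datum_mpoly lt) sz rx (msym_braid h lt) rh).
Qed.

#[local] Opaque msym mmap demazure_lusztig demazure_lusztig_inv.

Definition Tv_chain m p : {mpoly Qqt[n]} := foldr (@Tv n) p (rev (iota 0 m)).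

Lemma Tv_chainS m p : Tv_chain m.+1 p = Tv m (Tv_chain m p).
Proof. exact: foldr_rev_iotaS. Qed.

Lemma msym_Tv_chain_far i m g : (i.+1 < n)%N -> (m < i)%N -> s i g = g ->
  s i (Tv_chain m g) = Tv_chain m g.
Proof.
move=> lti; elim: m => [|m IH] ltm sg.
  exact: sg.
rewrite Tv_chainS.
have e1 : (m.+1 < n)%N by lia.
have e2 : (m.+1 < i)%N || (i.+1 < m)%N by rewrite ltm.
rewrite (msym_Tv _ lti e1 e2).
by rewrite (IH (ltnW ltm) sg).
Qed.

(** The chain lowers the index of a symmetry by one, and [piv] raises it again ([msym_piv]); this is
    why Y_1 preserves symmetry in the last variables. The shift happens at the letters j and j+1, by
    [msym_TvTv]; the other letters commute with the swap in question. *)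
Lemma msym_Tv_chain j m g : (j.+1 < m)%N -> (m < n)%N -> s j.+1 g = g ->
  s j (Tv_chain m g) = Tv_chain m g.
Proof.
elim: m => [|m IH] ltj ltm sg; first by case: (notF ltj).
have [E|ne] := eqVneq j.+1 m.
  subst m; rewrite 2!Tv_chainS; apply: (msym_TvTv ltm).
  exact: (msym_Tv_chain_far ltm (ltnSn _) sg).
rewrite Tv_chainS.
have e2 : (j.+1 < n)%N by lia.
have e3 : (m.+1 < n)%N by lia.
have e4 : (m.+1 < j)%N || (j.+1 < m)%N by lia.
have e5 : (j.+1 < m)%N by lia.
by rewrite (msym_Tv _ e2 e3 e4) (IH e5 (ltnW ltm) sg).
Qed.

(** Each T_i^-1 meets the factor x_i and turns it into q^-1 x_{i+1} T_i. So on multiples of x_1 the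
    inverses in Y_1 become the T_i themselves. *)
Lemma Tv_inv_chain m g : (m < n)%N ->
  foldr (@Tv_inv n) (x 0 * g) (rev (iota 0 m)) = q ^- m *: (x m * Tv_chain m g).
Proof.
elim: m => [|m IH] lt; first by rewrite expr0 invr1 scale1r.
rewrite foldr_rev_iotaS IH; last exact: ltnW.
rewrite Tv_invZ // Tv_inv_x // Tv_chainS scalerA.
by rewrite exprSr invfM mulrC.
Qed.

End MpolyT.

Section Piv.
Variable n : nat.
Implicit Types p g h : {mpoly Qqt[n]}.
Local Notation x := (xv n).
Local Notation s i := (msym (transp n i)).

#[local] Transparent mmap.
Lemma piv_zmod : zmod_morphism (@piv n).
Proof. by move=> p r; rewrite /piv rmorphB. Qed.
Lemma piv_monoid : monoid_morphism (@piv n).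
Proof. by split=> [|p r]; rewrite /piv (rmorph1, rmorphM). Qed.
Lemma piv_scalable : scalable (@piv n).
Proof. by move=> c p; rewrite /piv mmapZ mul_mpolyC. Qed.
HB.instance Definition _ :=
  GRing.isZmodMorphism.Build {mpoly Qqt[n]} {mpoly Qqt[n]} (@piv n) piv_zmod.
HB.instance Definition _ :=
  GRing.isMonoidMorphism.Build {mpoly Qqt[n]} {mpoly Qqt[n]} (@piv n) piv_monoid.
HB.instance Definition _ :=
  GRing.isScalable.Build Qqt {mpoly Qqt[n]} {mpoly Qqt[n]} *:%R (@piv n) piv_scalable.

Lemma pivC (c : Qqt) : piv c%:MP = c%:MP :> {mpoly Qqt[n]}.
Proof. exact: mmapC. Qed.

Lemma piv_xv j : (j < n)%N -> piv (x j) = if j.+1 == n then t *: x 0 else x j.+1.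
Proof. by move=> lt; rewrite (xv_ord (Ordinal lt)) /piv mmapX mmap1U. Qed.

#[local] Opaque mmap.
Lemma msym_piv i p : (i.+2 < n)%N -> s i.+1 (piv p) = piv (s i p).
Proof.
move=> lt; have lt' : (i.+1 < n)%N by lia.
apply: (mpoly_morph_xv (f := s i.+1 \o @piv n) (g := @piv n \o s i)) => [c|j ltj] /=.
  by rewrite pivC !msymC pivC.
have ltsw : (swap_idx i j < n)%N by rewrite /=; repeat case: eqP => //; lia.
rewrite (msym_xv j lt') (piv_xv ltj) (piv_xv ltsw).
have [E|ne] := eqVneq j.+1 n.
  have sw : swap_idx i j = j by rewrite swap_idx_id //; lia.
  have sx0 : s i.+1 (x 0) = x 0 := @msym_xv_id n i.+1 0 lt isT isT.
  by rewrite sw E eqxx linearZ /= sx0.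
have -> : ((swap_idx i j).+1 == n) = false.
  by apply/eqP; rewrite /=; repeat case: eqP => //; lia.
rewrite (msym_xv _ lt); congr (xv n _).
by rewrite /=; repeat case: eqP => //; lia.
Qed.

(** Of q^n, the n-1 letters cancel all but one q, and t comes from pi(x_n) = t x_1. This is the
    scalar that the normalization of z_i divides out. *)
Lemma Yv0E g : (0 < n)%N ->
  Yv0 (x 0 * g) = (q * t) *: (x 0 * piv (Tv_chain n.-1 g)).
Proof.
move=> n0; have ltn : (n.-1 < n)%N by rewrite prednK.
rewrite /Yv0 (Tv_inv_chain _ ltn) linearZ rmorphM /= (piv_xv ltn) (prednK n0) eqxx.
rewrite -scalerAl !scalerA; congr (_ *: _).
by rewrite -{1}(prednK n0) exprS mulfK // expf_neq0 // q_neq0.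
Qed.

(* The polynomial counterpart of inLpol. *)
Definition Lshape k p :=
  (exists g, p = \prod_(i < k) x i * g) /\
  (forall i, (k <= i)%N -> (i.+1 < n)%N -> s i p = p).

Lemma msym_prod_xv k i : (i.+1 < n)%N -> (i.+1 < k)%N || (k <= i)%N ->
  s i (\prod_(j < k) x j) = \prod_(j < k) x j.
Proof.
move=> lt far; rewrite rmorph_prod /=; case/orP: far => [ltk|le]; last first.
  apply: eq_bigr => j _; have ltj := ltn_ord j.
  by rewrite (msym_xv_id lt) //; apply/eqP; lia.
rewrite (reindex_inj (perm_inj (s := transp k i))) /=; apply: eq_bigr => j _.
rewrite (msym_xv _ lt) (transp_val _ ltk) swap_idxK; exact: erefl.
Qed.

Lemma Lshape_Tv k i p : (k <= n)%N -> (i.+1 < k)%N -> Lshape k p -> Lshape k (Tv i p).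
Proof.
move=> le lt [[g Eg] sp]; have lt' : (i.+1 < n)%N by lia.
split.
  have e : s i (\prod_(j < k) x j) = \prod_(j < k) x j.
    by apply: msym_prod_xv; rewrite ?lt.
  by exists (Tv i g); rewrite Eg (Tv_mull _ lt' e).
move=> j lej ltj; have far : (i.+1 < j)%N || (j.+1 < i)%N by lia.
by rewrite (msym_Tv _ ltj lt' far) (sp _ lej ltj).
Qed.

Lemma Lshape_Z k c p : Lshape k p -> Lshape k (c *: p).
Proof.
move=> [[g Eg] sp]; split; first by exists (c *: g); rewrite Eg scalerAr.
by move=> i le lt; rewrite linearZ /= (sp i le lt).
Qed.

Lemma Lshape_Yv0 k p : (0 < k <= n)%N -> Lshape k p -> Lshape k (Yv0 p).
Proof.
case: k => // k /= lek [[g Eg] sp]; have n0 : (0 < n)%N by lia.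
split; last first.
  case=> [|i] le lt; first by case: (notF le).
  have [g' Eg'] : exists g', p = x 0 * g'.
    by exists (\prod_(i < k) x i.+1 * g); rewrite Eg big_ord_recl mulrA.
  have sg' j : (k < j)%N -> (j.+1 < n)%N -> s j g' = g'.
    move=> lej ltj; apply: (mulfI (xv_neq0 n0)); rewrite -Eg' -[RHS](sp j lej ltj).
    rewrite [in RHS]Eg' rmorphM /=.
    have e : s j (x 0) = x 0 by apply: (msym_xv_id ltj); lia.
    by rewrite e.
  have e : s i.+1 (x 0) = x 0 := @msym_xv_id n i.+1 0 lt isT isT.
  have lti : (i.+1 < n.-1)%N by lia.
  have ltn : (n.-1 < n)%N by lia.
  rewrite Eg' (Yv0E _ n0) linearZ rmorphM /= e (msym_piv _ lt).
  by rewrite (msym_Tv_chain lti ltn (sg' _ le lt)).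
(* Here k+1 is the vertex: the first k letters permute variables among x_1, ..., x_{k+1} and leave
   their product outside. *)
have pre m : (m <= k)%N -> foldr (@Tv_inv n) p (rev (iota 0 m)) =
    \prod_(i < k.+1) x i * foldr (@Tv_inv n) g (rev (iota 0 m)).
  elim: m => [|m IH] lem; first exact: Eg.
  have lt1 : (m.+1 < n)%N by lia.
  have e : s m (\prod_(i < k.+1) x i) = \prod_(i < k.+1) x i.
    by apply: (msym_prod_xv lt1); lia.
  by rewrite !foldr_rev_iotaS (IH (ltnW lem)) (Tv_inv_mull _ lt1 e).
(* The later letters carry only the last factor, from x_{k+1} up to x_n. Then pi moves x_1, ..., x_k
   to x_2, ..., x_{k+1} and x_n to t x_1, which restores the product. *)
have post m : (k + m < n)%N -> exists G, foldr (@Tv_inv n) p (rev (iota 0 (k + m))) =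
    \prod_(i < k) x i * (x (k + m) * G).
  elim: m => [|m IH] ltm.
    exists (foldr (@Tv_inv n) g (rev (iota 0 k))).
    by rewrite addn0 (pre k (leqnn k)) big_ord_recr /= -mulrA.
  have [|G EG] := IH; first by lia.
  have lt1 : ((k + m).+1 < n)%N by lia.
  have e : s (k + m) (\prod_(i < k) x i) = \prod_(i < k) x i.
    by apply: (msym_prod_xv lt1); rewrite leq_addr orbT.
  rewrite addnS foldr_rev_iotaS EG (Tv_inv_mull _ lt1 e) (Tv_inv_x _ lt1).
  by exists (q^-1 *: Tv (k + m) G); congr (_ * _); rewrite scalerAr.
have [|G EG] := post (n.-1 - k)%N; first by rewrite subnKC //; lia.
rewrite subnKC in EG; last by lia.
exists (q ^+ n *: (t *: piv G)); rewrite /Yv0 EG !rmorphM /= rmorph_prod /=.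
have ltn : (n.-1 < n)%N by lia.
rewrite (piv_xv ltn) (prednK n0) eqxx big_ord_recl /= -!scalerAl -!scalerAr.
congr (_ *: (_ *: _)); rewrite mulrCA -mulrA; congr (_ * (_ * _)).
apply: eq_bigr => i _; have lti := ltn_ord i.
have lt1 : (i < n)%N by lia.
by rewrite (piv_xv lt1) ltn_eqF //; lia.
Qed.

Lemma Lshape_Yv k i p : (i < k <= n)%N -> Lshape k p -> Lshape k (Yv i p).
Proof.
move=> /andP[+ le]; elim: i p => [|i IH] p lt Lp.
  by apply: Lshape_Yv0 Lp; rewrite lt.
apply/Lshape_Z/(Lshape_Tv le lt)/(IH _ (ltnW lt)).
exact: Lshape_Tv le lt Lp.
Qed.

Lemma rho_id p : (exists g, p = x 0 * g) -> (0 < n)%N -> rho p = p.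
Proof.
move=> [g Eg] n0; rewrite /rho [RHS]mpolyE big_mkcond /=; apply: eq_big_seq => a ain.
case: ifP => // /existsPn /(_ (Ordinal n0)); rewrite eqxx /= -eqn0Ngt => /eqP a0.
suff -> : p@_a = 0 by rewrite scale0r.
have := incl_coef p a => <-; rewrite Eg rmorphM /= incl_xv cut_xs n0.
by rewrite xs_mul_out // (coef_expo_of_mnm a (Ordinal n0)).
Qed.

Lemma Lshape_dvd0 k p : (0 < k)%N -> Lshape k p -> exists g, p = x 0 * g.
Proof.
case: k => // k _ [[g Eg] _]; exists (\prod_(i < k) x i.+1 * g).
by rewrite Eg big_ord_recl mulrA.
Qed.

Lemma YdefE k i p : (i < k <= n)%N -> Lshape k p -> Ydef i p = Yv i p.
Proof.
move=> /andP[+ le]; elim: i p => [|i IH] p lt Lp /=.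
  have n0 : (0 < n)%N by lia.
  apply: rho_id n0; apply: (Lshape_dvd0 lt); apply: Lshape_Yv0 Lp.
  by rewrite lt.
by rewrite (IH _ (ltnW lt)) //; exact: Lshape_Tv le lt Lp.
Qed.

End Piv.

(** * Stability of the Cherednik operators *)

Section Restriction.
Variable n : nat.
Implicit Types p g h : {mpoly Qqt[n.+1]}.

Definition res p : {mpoly Qqt[n]} := mmap (@mpolyC n Qqt) (fun i => xv n i) p.

Lemma res_zmod : zmod_morphism res.
Proof. by move=> p r; rewrite /res rmorphB. Qed.
Lemma res_monoid : monoid_morphism res.
Proof. by split=> [|p r]; rewrite /res (rmorph1, rmorphM). Qed.
Lemma res_scalable : scalable res.
Proof. by move=> c p; rewrite /res mmapZ mul_mpolyC. Qed.
HB.instance Definition _ :=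
  GRing.isZmodMorphism.Build {mpoly Qqt[n.+1]} {mpoly Qqt[n]} res res_zmod.
HB.instance Definition _ :=
  GRing.isMonoidMorphism.Build {mpoly Qqt[n.+1]} {mpoly Qqt[n]} res res_monoid.
HB.instance Definition _ :=
  GRing.isScalable.Build Qqt {mpoly Qqt[n.+1]} {mpoly Qqt[n]} *:%R res res_scalable.

Lemma resC (c : Qqt) : res c%:MP = c%:MP.
Proof. exact: mmapC. Qed.

Lemma res_xv j : res (xv n.+1 j) = xv n j.
Proof.
case: (ltnP j n.+1) => [lt|le].
  by rewrite (xv_ord (Ordinal lt)) /res mmapX mmap1U.
by rewrite (xv_out le) (xv_out (ltnW le)) rmorph0.
Qed.

#[local] Opaque msym mmap demazure_lusztig demazure_lusztig_inv.

Lemma incl_res p : incl (res p) = cut n (incl p).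
Proof.
apply: (mpoly_morph_ext (f := @incl n \o res) (g := cut n \o @incl n.+1)) => [c|i] /=.
  by rewrite -[c%:MP]mulr1 mul_mpolyC !linearZ /= !rmorph1.
by rewrite -xv_ord res_xv !incl_xv !cut_xs ltn_ord cut_xs.
Qed.

Lemma cut_cut m f : (n <= m)%N -> cut n (cut m f) = cut n f.
Proof.
move=> le; apply: funext => e; rewrite /cut /reindex_series /=.
by case: ifP => // le'; rewrite (leq_trans le' le).
Qed.

Lemma res_Xi f : bounded_degree f -> res (Xi n.+1 f) = Xi n f.
Proof.
move=> bf; apply: incl_inj.
by rewrite incl_res (incl_Xi _ bf) (incl_Xi _ bf) (cut_cut _ (leqnSn n)).
Qed.

Lemma res_msym i p : (i.+1 < n)%N ->
  res (msym (transp n.+1 i) p) = msym (transp n i) (res p).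
Proof.
move=> lt; have lt' : (i.+1 < n.+1)%N by lia.
apply: (mpoly_morph_xv (f := res \o msym (transp n.+1 i))
  (g := msym (transp n i) \o res)) => [c|j _] /=.
  by rewrite resC !msymC resC.
by rewrite (msym_xv _ lt') !res_xv (msym_xv _ lt).
Qed.

Lemma res_Tv i p : (i.+1 < n)%N -> res (Tv i p) = Tv i (res p).
Proof.
move=> lt; have lt' : (i.+1 < n.+1)%N by lia.
apply: (T_morph (swap_datum_mpoly lt') (swap_datum_mpoly lt) (phi := res)).
- by move=> c f g; rewrite linearP.
- by move=> f g; rewrite rmorphM.
- exact: res_xv.
- exact: res_xv.
exact: res_msym.
Qed.

(** With variables counted from 1, s_n sends x_n to x_{n+1}, which pi^(n+1) wraps round to t x_1, as
    pi^(n) does with x_n. It sends x_{n+1} to x_n, which pi^(n+1) moves to x_{n+1}, and this is set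
    to 0. *)
Lemma res_piv_msym h : (0 < n)%N ->
  res (piv (msym (transp n.+1 n.-1) h)) = piv (res h).
Proof.
move=> n0; have lt : (n.-1.+1 < n.+1)%N by lia.
apply: (mpoly_morph_xv (f := res \o @piv n.+1 \o msym (transp n.+1 n.-1))
  (g := @piv n \o res)) => [c|j ltj] /=.
  by rewrite msymC pivC !resC pivC.
rewrite (msym_xv _ lt) res_xv; have [->|jn] := eqVneq j n.
  have -> : swap_idx n.-1 n = n.-1 by rewrite -{2}(prednK n0) swap_idx_r.
  have lt1 : (n.-1 < n.+1)%N by lia.
  rewrite (piv_xv lt1) ifN ?res_xv; last by lia.
  by rewrite (prednK n0) (xv_out (leqnn n)) rmorph0.
have ltjn : (j < n)%N by lia.
have [E|jn1] := eqVneq j n.-1.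
  rewrite E swap_idx_l (prednK n0) (piv_xv (ltnSn n)) eqxx linearZ /= res_xv.
  have lt1 : (n.-1 < n)%N by lia.
  by rewrite (piv_xv lt1) (prednK n0) eqxx.
have -> : swap_idx n.-1 j = j by rewrite swap_idx_id //; lia.
rewrite (piv_xv ltj) (piv_xv ltjn) ifN ?ifN ?res_xv //; lia.
Qed.

(** Under r pi^(n+1) the variable x_n becomes 0 and x_{n+1} becomes t x_1. The cleared equation for
    T_n h loses its term in (1 - q) x_n h and keeps the factor -t x_1 on both sides; cancelling it
    leaves the case of the swap, [res_piv_msym]. *)
Lemma res_piv_Tv h : (0 < n)%N -> res (piv (Tv n.-1 h)) = piv (res h).
Proof.
move=> n0; have lt : (n.-1.+1 < n.+1)%N by lia.
have ltn1 : (n.-1 < n.+1)%N by lia.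
pose R p := res (piv p).
have RM a b : R (a * b) = R a * R b by rewrite /R !rmorphM.
have RD a b : R (a + b) = R a + R b by rewrite /R !rmorphD.
have RB a b : R (a - b) = R a - R b by rewrite /R !rmorphB.
have RZ c a : R (c *: a) = c *: R a by rewrite /R !linearZ.
have Rx : R (xv n.+1 n.-1) = 0.
  by rewrite /R (piv_xv ltn1) (prednK n0) (ltn_eqF (ltnSn n)) res_xv (xv_out (leqnn n)).
have Ry : R (xv n.+1 n.-1.+1) = t *: xv n 0.
  by rewrite /R (prednK n0) (piv_xv (ltnSn n)) eqxx linearZ /= res_xv.
have Rs : R (msym (transp n.+1 n.-1) h) = piv (res h) by exact: res_piv_msym.
have E0 := demazure_lusztigP (swap_datum_mpoly lt) h.
rewrite -[demazure_lusztig _ _ _ h]/(Tv n.-1 h) in E0.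
rewrite -[LHS]/(R (Tv n.-1 h)); clearbody R.
move: (Tv n.-1 h) E0 => TH /(congr1 R).
rewrite RM RB RD RM RB !RZ RM Rx Ry Rs.
rewrite !(scaler0, sub0r, mul0r, addr0) => E.
apply: (mulfI _ E); rewrite oppr_eq0 scaler_eq0 negb_or t_neq0.
exact: xv_neq0.
Qed.

Lemma res_Tv_chain m g : (m < n)%N -> res (Tv_chain m g) = Tv_chain m (res g).
Proof.
elim: m => [|m IH] lt; first by [].
by rewrite !Tv_chainS (res_Tv _ lt) (IH (ltnW lt)).
Qed.

(** In the form of [Yv0E], one more variable means one more letter T_n next to pi^(n+1), and
    [res_piv_Tv] absorbs it. *)
Lemma res_Yv0 p : (0 < n)%N -> (exists g, p = xv n.+1 0 * g) ->
  res (Yv0 p) = Yv0 (res p).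
Proof.
move=> n0 [g ->]; rewrite (Yv0E _ (ltn0Sn n)) linearZ !rmorphM /= res_xv (Yv0E _ n0).
have -> : Tv_chain n.+1.-1 g = Tv n.-1 (Tv_chain n.-1 g).
  by rewrite -Tv_chainS (prednK n0).
by rewrite (res_piv_Tv _ n0) res_Tv_chain ?(prednK n0).
Qed.

Lemma res_Yv k i p : (i < k <= n)%N -> Lshape k p -> res (Yv i p) = Yv i (res p).
Proof.
move=> /andP[+ le]; elim: i p => [|i IH] p lt Lp.
  by apply: res_Yv0; [lia | exact: Lshape_dvd0 lt Lp].
have lt1 : (i.+1 < n)%N by lia.
have LT : Lshape k (Tv i p) by apply: Lshape_Tv lt Lp; lia.
by rewrite /= linearZ /= (res_Tv _ lt1) (IH _ (ltnW lt) LT) (res_Tv _ lt1).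
Qed.

End Restriction.

(** * Degree bounds for T_i, pi and Y_i, uniform in the number of variables *)

Section Degree.
Variable n : nat.
Implicit Types p g h : {mpoly Qqt[n]}.
Local Notation deg_le d p := (msize p <= d.+1)%N.
#[local] Opaque mmap demazure_lusztig demazure_lusztig_inv.

Lemma deg_leM d d' p r : deg_le d p -> deg_le d' r -> deg_le (d + d') (p * r).
Proof.
move=> le le'; have [->|p0] := eqVneq p 0; first by rewrite mul0r msize0.
have [->|r0] := eqVneq r 0; first by rewrite mulr0 msize0.
have aux (a b : nat) : (a <= d.+1)%N -> (b <= d'.+1)%N -> ((a + b).-1 <= (d + d').+1)%N.
  by lia.
by rewrite msizeM //; exact: aux.
Qed.

Lemma deg_leD d p r : deg_le d p -> deg_le d r -> deg_le d (p + r).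
Proof.
by move=> le le'; apply: leq_trans (msizeD_le _ _) _; rewrite geq_max le.
Qed.

Lemma deg_leZ d c p : deg_le d p -> deg_le d (c *: p).
Proof. by move=> le; apply: leq_trans (msizeZ_le _ _) _. Qed.

Lemma deg_le_xv i : deg_le 1 (xv n i).
Proof.
case: (ltnP i n) => [lt|le]; last by rewrite (xv_out le) msize0.
by rewrite (xv_ord (Ordinal lt)) msizeX mdeg1.
Qed.

Lemma deg_le_msym d s p : deg_le d p -> deg_le d (msym s p).
Proof.
move=> le; rewrite msizeE; apply/bigmax_leqP_seq => u uin _.
have : p@_[multinom u (s i) | i < n] != 0 by rewrite -mcoeff_sym -mcoeff_msupp.
by rewrite -mcoeff_msupp => /msize_mdeg_lt; rewrite mdeg_mperm => /leq_trans; apply.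
Qed.

(** Degrees are additive under products, so the bound is read off the cleared equation: its right
    side has degree at most d + 1 and x_i - x_{i+1} accounts for at least 1. *)
Lemma deg_le_Tv d i p : (i.+1 < n)%N -> deg_le d p -> deg_le d (Tv i p).
Proof.
move=> lt le; have [->|T0] := eqVneq (Tv i p) 0; first by rewrite msize0.
have E := demazure_lusztigP (swap_datum_mpoly lt) p.
have lex := deg_le_xv i; have ley := deg_le_xv i.+1.
have : deg_le (1 + d) ((xv n i - xv n i.+1) * Tv i p).
  rewrite [X in msize X]E; apply: deg_leD; last exact/deg_leZ/deg_leM.
  apply: deg_leM; last exact: deg_le_msym.
  by apply: deg_leD; [exact: deg_leZ | rewrite msizeN].
rewrite msizeM //; last exact: xv_neq.
have aux (a b : nat) : (1 < a)%N -> ((a + b).-1 <= (1 + d).+1)%N -> (b <= d.+1)%N by lia.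
suff /aux : (1 < msize (xv n i - xv n i.+1))%N by apply.
rewrite -(mdeg1 (Ordinal lt)); apply: msize_mdeg_lt; rewrite mcoeff_msupp.
rewrite (xv_ord (Ordinal (ltnW lt))) (xv_ord (Ordinal lt)) mcoeffB !mcoeffXU eqxx.
by rewrite -val_eqE /= ltn_eqF // sub0r oppr_eq0 oner_eq0.
Qed.

Lemma deg_le_Tv_inv d i p : (i.+1 < n)%N -> deg_le d p -> deg_le d (Tv_inv i p).
Proof.
by move=> lt le; apply/deg_leZ/deg_leD; [exact: deg_le_Tv | exact: deg_leZ].
Qed.

#[local] Transparent mmap.
Lemma deg_le_piv d p : deg_le d p -> deg_le d (piv p).
Proof.
move=> le; rewrite /piv /mmap; apply: leq_trans (msize_sum _ _ _) _.
apply/bigmax_leqP_seq => u uin _; rewrite mul_mpolyC; apply: deg_leZ.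
have le1 : deg_le (mdeg u) (mmap1 (fun i : 'I_n => if i.+1 == n then t *: xv n 0 else xv n i.+1) u).
  rewrite mdegE /mmap1; elim/big_rec2: _ => [|i p' m _ IH]; first by rewrite msize1.
  apply: deg_leM IH; elim: (u i) => [|l IHl]; first by rewrite expr0 msize1.
  rewrite exprS; apply: (@deg_leM 1 l _ _ _ IHl).
  by case: ifP => _; [apply: deg_leZ|]; apply: deg_le_xv.
apply: leq_trans le1 _; exact: leq_trans (msize_mdeg_lt uin) le.
Qed.
#[local] Opaque mmap.

Lemma deg_le_Yv d i p : (i < n)%N -> deg_le d p -> deg_le d (Yv i p).
Proof.
elim: i p => [|i IH] p lt le; last first.
  by apply/deg_leZ/deg_le_Tv/IH/deg_le_Tv => //; apply: ltnW.
apply/deg_leZ/deg_le_piv.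
have : (n.-1 < n)%N by lia.
elim: (n.-1) => [|m IH] ltm; first exact: le.
by rewrite foldr_rev_iotaS; apply: deg_le_Tv_inv ltm (IH (ltnW ltm)).
Qed.

End Degree.

(** * The components L_k of series and the limit defining z_i *)

Definition ones k : expo := \sum_(i < k) 'X^i.

Lemma mono_ones k : \prod_(i < k) xs i = mono (ones k).
Proof. by rewrite mono_sum. Qed.

Lemma coef_ones k j : (ones k)`_j = nat_of_bool (j < k)%N.
Proof.
rewrite expo_sumE; case: (ltnP j k) => [lt|le].
  rewrite (bigD1 (Ordinal lt)) //= expoX eqxx big1 // => i ne.
  by rewrite expoX; case: eqP => // E; case/eqP: ne; apply: val_inj.
by rewrite big1 // => i _; rewrite expoX gtn_eqF // (leq_trans (ltn_ord i)).
Qed.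

Lemma swap_ones i k : (i.+1 < k)%N || (k <= i)%N -> swap_expo i (ones k) = ones k.
Proof.
move=> far; apply/polyP => j; rewrite coef_swap_expo !coef_ones /=.
by case: (j =P i); case: (j =P i.+1) => //= *; congr nat_of_bool; lia.
Qed.

(** The quotient by x_1 ... x_k is obtained by shifting exponents by [ones k]. The criterion speaks
    of coefficients only, so it can be checked on series given by truncations or as products. *)
Lemma inLpol_intro k f : bounded_degree f -> tail_symmetric k f ->
  (forall (e : expo) i, (i < k)%N -> (e`_i)%R = 0%N -> f e = 0) -> inLpol k f.
Proof.
move=> [d bf] sf vf; pose g : Sqt := fun e => f (ones k + e).
exists g; last first.
  rewrite mono_ones; apply: funext => e.
  have [[e' ->]|H] := pselect (exists e', e = ones k + e').
    by rewrite mono_mul_addE.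
  rewrite mono_mul_out; last by move=> e' E; apply: H; exists e'.
  have [[i lt e0]|H'] := pselect (exists2 i, (i < k)%N & (e`_i)%R = 0%N).
    exact: vf lt e0.
  case: H; apply: expo_sub => j; rewrite coef_ones; case: ltnP => // lt.
  by rewrite lt0n; apply/eqP => e0; apply: H'; exists j.
apply/inPas_kP; split.
  by exists d => e le; apply: bf; rewrite edegD (leq_trans le) ?leq_addl.
move=> i le; apply: funext => e; rewrite swap_seriesE /reindex_series /= /g.
rewrite -[in RHS](sf i le) swap_seriesE /reindex_series /= swap_expoD.
by rewrite swap_ones // le orbT.
Qed.

Lemma inLpolP k f : inLpol k f -> [/\ bounded_degree f, tail_symmetric k f &
  exists g, [/\ bounded_degree g, tail_symmetric k g & f = \prod_(i < k) xs i * g]].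
Proof.
move=> [g /inPas_kP[bg sg] ->]; split; last by exists g.
  by apply: bounded_degreeM bg; apply: bounded_degree_prod => i _; apply: bounded_degree_xs.
apply: tail_symmetricM sg; apply: tail_symmetric_prod => i _.
exact: tail_symmetric_xs.
Qed.

Lemma inLpol_vanish k f (e : expo) i :
  inLpol k f -> (i < k)%N -> (e`_i)%R = 0%N -> f e = 0.
Proof.
move=> [g _ ->] lt e0; rewrite (bigD1 (Ordinal lt)) //= -mulrA.
exact: xs_mul_out.
Qed.

Lemma inLpol0 k : inLpol k 0.
Proof.
by apply: inLpol_intro; [exact: bounded_degree0 | exact: tail_symmetric0 | ].
Qed.

Lemma inLpol_linear k c f g : inLpol k f -> inLpol k g -> inLpol k (c *: f + g).
Proof.
move=> Lf Lg; have [bf sf _] := inLpolP Lf; have [bg sg _] := inLpolP Lg.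
apply: inLpol_intro; first exact/bounded_degreeD/bg/bounded_degree_scale.
  exact/tail_symmetricD/sg/tail_symmetricZ.
move=> e i lt e0; rewrite series_addE series_scaleE.
by rewrite (inLpol_vanish Lf lt e0) (inLpol_vanish Lg lt e0) mulr0 addr0.
Qed.

Lemma inLpolZ k c f : inLpol k f -> inLpol k (c *: f).
Proof. by move=> Lf; have := inLpol_linear c Lf (inLpol0 k); rewrite addr0. Qed.

Lemma inLpolD k f g : inLpol k f -> inLpol k g -> inLpol k (f + g).
Proof. by move=> Lf Lg; have := inLpol_linear 1 Lf Lg; rewrite scale1r. Qed.

Section XiLpol.

#[local] Opaque msym mmap demazure_lusztig demazure_lusztig_inv.

Lemma Xi_prod_xs m k : Xi m (\prod_(i < k) xs i) = \prod_(i < k) xv m i.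
Proof.
apply: XiP; first by apply: bounded_degree_prod => i _; apply: bounded_degree_xs.
by rewrite !rmorph_prod /=; apply: eq_bigr => i _; rewrite incl_xv.
Qed.

Lemma Xi_Lpol m k f : inLpol k f ->
  exists2 g, Xi m f = \prod_(i < k) xv m i * g &
    forall i, (k <= i)%N -> (i.+1 < m)%N -> msym (transp m i) g = g.
Proof.
case/inLpolP => bf sf [g [bg sg ->]]; exists (Xi m g).
  rewrite XiM ?Xi_prod_xs //.
  by apply: bounded_degree_prod => i _; apply: bounded_degree_xs.
by move=> i le lt; rewrite -(Xi_swap bg lt) (sg i le).
Qed.

Lemma Lshape_Xi m k f : inLpol k f -> Lshape k (Xi m f).
Proof.
move=> Lf; have [g Eg _] := Xi_Lpol m Lf; split; first by exists g.
have [bf sf _] := inLpolP Lf.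
by move=> i le lt; rewrite -(Xi_swap bf lt) (sf i le).
Qed.

Lemma msize_Xi m d f : (forall e, (d <= edeg e)%N -> f e = 0) -> (msize (Xi m f) <= d)%N.
Proof.
move=> Hd; have bf : bounded_degree f by exists d.
rewrite msizeE; apply/bigmax_leqP_seq => u; rewrite mcoeff_msupp (Xi_coef u bf) => nz _.
by rewrite -edeg_expo_of_mnm ltnNge; apply: contra nz => /Hd ->.
Qed.

(* The truncations of Y_i f to the variables 1, ..., m are exactly compatible, so the
   limit of Ion and Wu is an inverse limit on L_k. *)
Lemma Yv_limit k i f : (i < k)%N -> inLpol k f ->
  exists2 H, inLpol k H & forall m, (k <= m)%N -> cut m H = incl (Yv i (Xi m f)).
Proof.
move=> ltik Lf; have [bf sf _] := inLpolP Lf.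
pose F m : Sqt := incl (Yv i (Xi m f)).
have LF m : (k <= m)%N -> Lshape k (Yv i (Xi m f)).
  by move=> le; apply: Lshape_Yv (Lshape_Xi m Lf); rewrite ltik.
have FS m : (k <= m)%N -> cut m (F m.+1) = F m.
  move=> le; have e : (i < k <= m)%N by rewrite ltik.
  by rewrite /F -incl_res (res_Yv e (Lshape_Xi m.+1 Lf)) (res_Xi _ bf).
have Fle m M (e : expo) : (k <= m <= M)%N -> (size e <= m)%N -> F M e = F m e.
  move=> /andP[le leM] se; rewrite -(subnK leM); elim: (M - m)%N => [//|d IH].
  rewrite addSn -IH -(FS (d + m)%N); last by rewrite (leq_trans le) ?leq_addl.
  by rewrite /cut /reindex_series (leq_trans se) ?leq_addl.
(* Compatible truncations agree on the exponents they share, so the coefficient at e can be read in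
   any of them with m at least k and at least the size of e. *)
pose H : Sqt := fun e => F (maxn k (size e)) e.
have HF m (e : expo) : (k <= m)%N -> (size e <= m)%N -> H e = F m e.
  by move=> le se; rewrite /H -(@Fle _ m) // ?leq_maxl ?leq_maxr // geq_max le se.
exists H; last first.
  move=> m le; apply: funext => e; rewrite /cut /reindex_series /=.
  case: ifP => [se|nse]; first exact: HF.
  by rewrite inclE nse.
case: bf => d Hd; apply: inLpol_intro.
(* Y_i does not raise the degree, so one bound serves all the truncations and the inverse limit has
   bounded degree. *)
- exists d.+1 => e le; rewrite /H /F inclE leq_maxr; apply: memN_msupp_eq0.
  apply: msize_mdeg_ge; rewrite -edeg_expo_of_mnm (mnm_expoK_id (leq_maxr _ _)).
  apply: leq_trans le; apply: deg_le_Yv; first by rewrite (leq_trans ltik) ?leq_maxl.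
  exact: leq_trans (msize_Xi _ Hd) (leqnSn d).
- move=> j lej; apply: funext => e; rewrite swap_seriesE /reindex_series /=.
  (* Large enough for one truncation to contain e, its swap and both swapped variables. *)
  pose m := maxn (maxn k j.+2) (maxn (size e) (size (swap_expo j e))).
  have km : (k <= m)%N by rewrite /m; lia.
  have jm : (j.+1 < m)%N by rewrite /m; lia.
  rewrite (HF m _ km); last by rewrite /m !leq_max leqnn !orbT.
  rewrite (HF m _ km); last by rewrite /m !leq_max leqnn !orbT.
  have [_ sF] := LF m km.
  by rewrite /F -[in RHS](sF j lej jm) (incl_msym _ jm).
- move=> e j ltj e0; have [[g Eg] _] := LF _ (leq_maxl k (size e)).
  rewrite /H /F Eg rmorphM rmorph_prod /= (bigD1 (Ordinal ltj)) //= incl_xv cut_xs.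
  by rewrite (leq_trans ltj (leq_maxl _ _)) -mulrA xs_mul_out.
Qed.

Lemma zs_limit k i f : (i < k)%N -> inLpol k f ->
  exists2 H, inLpol k H & zs i f = (q * t)^-1 *: H /\
    forall m, (k <= m)%N -> Xi m H = Yv i (Xi m f).
Proof.
move=> ltik Lf; have [H LH HP] := Yv_limit ltik Lf; exists H => //.
have [bH sH _] := inLpolP LH.
have HX m : (k <= m)%N -> Xi m H = Yv i (Xi m f).
  by move=> le; apply: XiP bH (HP m le).
split; last exact: HX.
have YE m : (k <= m)%N -> Ydef i (Xi m f) = Yv i (Xi m f).
  by move=> le; apply: (@YdefE m k); [rewrite ltik | exact: Lshape_Xi].
rewrite /zs; congr (_ *: _); apply: (@IW_limit_unique (fun m => Ydef i (Xi m f)) H _ k).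
  by move=> m le; rewrite YE // HP.
apply: (epsilon_spec (inhabits 0) (is_IW_limit _)); exists H.
(* The presentation of the limit has h = H and an empty family of convergent scalars, since the
   truncations of H are exactly the terms of the sequence. *)
exists H, 0%N, (fun=> 0), (fun _ _ => 0), (fun=> 0); split.
- split; last by case.
  by exists k; apply/inPas_kP.
- by case.
- exists k => m le; rewrite big_ord0 addr0 YE //; apply/esym/HX.
  exact: le.
- by rewrite big_ord0 addr0.
Qed.

End XiLpol.

(** * Symmetric functions as polynomials in the power sums *)

Lemma expoMn_inj r i j : (0 < r)%N -> 'X^i *+ r = 'X^j *+ r :> expo -> i = j.
Proof.
move=> r0 /polyP /(_ i); rewrite !expoMn eqxx mul1n.
by have [//|_] := eqVneq i j; rewrite mul0n => E; rewrite E in r0.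
Qed.

Lemma size_expoMn r i : (size ('X^i *+ r : expo) <= i.+1)%N.
Proof. by apply/leq_sizeP => j lt; rewrite expoMn gtn_eqF. Qed.

Lemma expoMn_size r i : (0 < r)%N -> (i < size ('X^i *+ r : expo))%N.
Proof.
move=> r0; rewrite ltnNge; apply/negP => le; have := expoMn i r i.
by rewrite (nth_default _ le) eqxx mul1n => E; rewrite -E in r0.
Qed.

Lemma psumE r (e : expo) N : (0 < r)%N -> (size e <= N)%N ->
  psum r e = \sum_(i < N) (xs i ^+ r) e.
Proof.
move=> r0 le; have xr i : (xs i ^+ r) e = (e == 'X^i *+ r)%:R.
  by rewrite xsE -monoMn.
under eq_bigr => i _ do rewrite xr.
rewrite /psum; case: existsP => [[i /eqP Ei]|H].
  have lti : (i < N)%N by apply: leq_trans le.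
  rewrite (bigD1 (Ordinal lti)) //= big1 ?addr0; first by rewrite -Ei eqxx.
  move=> j ne; case: eqP => // Ej; case/eqP: ne; apply: val_inj => /=.
  by apply: (expoMn_inj r0); rewrite -Ej -Ei.
rewrite big1 // => i _; case: eqP => // Ei; case: H.
have lti : (i < size e)%N by rewrite Ei expoMn_size.
by exists (Ordinal lti); rewrite -Ei.
Qed.

Lemma bounded_psum r : (0 < r)%N -> bounded_degree (psum r).
Proof.
move=> r0; exists r.+1 => e le; rewrite (psumE r0 (leqnn _)) big1 // => i _.
rewrite xsE -monoMn /mono; case: eqP => // E.
by move: le; rewrite E edegMn ltnn.
Qed.

Lemma cut_psum n r : (0 < r)%N -> cut n (psum r) = \sum_(i < n) xs i ^+ r.
Proof.
move=> r0; apply: funext => e; rewrite /cut /reindex_series series_sumE.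
case: leqP => [le|lt]; first exact: psumE.
rewrite big1 // => i _; rewrite xsE -monoMn /mono; case: eqP => // E.
move: lt; rewrite E ltnNge => /negP [].
exact: leq_trans (size_expoMn r i) _.
Qed.

Lemma series_cut_ext (f g : Sqt) m0 :
  (forall n, (m0 <= n)%N -> cut n f = cut n g) -> f = g.
Proof.
move=> H; apply: funext => e.
have := congr1 (fun h : Sqt => h e) (H (m0 + size e)%N (leq_addr _ _)).
by rewrite /cut /reindex_series leq_addl.
Qed.

Lemma cut_in_tail n k f : cut (n + k) (in_tail k f) = in_tail k (cut n f).
Proof.
apply: funext => e; rewrite /cut /reindex_series /in_tail size_drop_poly leq_subLR addnC.
by do 2!case: ifP.
Qed.

Lemma cut_in_tail_psum m k r : (0 < r)%N ->
  cut (m + k) (in_tail k (psum r)) = \sum_(i < m) xs (i + k) ^+ r.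
Proof.
move=> r0; rewrite cut_in_tail cut_psum // rmorph_sum; apply: eq_bigr => i _ /=.
by rewrite rmorphXn /= in_tail_xs.
Qed.

Lemma in_tail_psumS k r : (0 < r)%N ->
  in_tail k (psum r) = xs k ^+ r + in_tail k.+1 (psum r).
Proof.
move=> r0; apply: (@series_cut_ext _ _ k.+1) => n le.
rewrite -(subnK le); set m := (n - k.+1)%N.
rewrite rmorphD /= cut_in_tail_psum // addnS -addSn cut_in_tail_psum //.
rewrite big_ord_recl /= add0n rmorphXn /= cut_xs addSn ltnS leq_addl; congr (_ + _).
by apply: eq_bigr => i _; rewrite /bump /= add1n addSnnS.
Qed.

Lemma swap_psum i r : (0 < r)%N -> swap_series i (psum r) = psum r.
Proof.
move=> r0; apply: (@series_cut_ext _ _ i.+2) => n le.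
rewrite cut_swap // cut_psum // rmorph_sum /=.
rewrite (reindex_inj (perm_inj (s := transp n i))) /=; apply: eq_bigr => j _.
by rewrite rmorphXn /= swap_xs transp_val // swap_idxK.
Qed.

Lemma tail_symmetric_psum k r : (0 < r)%N -> tail_symmetric k (psum r).
Proof. by move=> r0 i _; apply: swap_psum. Qed.

Definition eval_psum N (P : {mpoly Qqt[N]}) : Sqt :=
  mmap (in_alg Sqt) (fun j : 'I_N => psum j.+1) P.

Definition psum_poly (F : Sqt) := exists N (P : {mpoly Qqt[N]}), F = eval_psum P.

Section EvalPsum.
Variable N : nat.

Lemma eval_psum_zmod : zmod_morphism (@eval_psum N).
Proof. by move=> p r; rewrite /eval_psum rmorphB. Qed.
Lemma eval_psum_monoid : monoid_morphism (@eval_psum N).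
Proof. by split=> [|p r]; rewrite /eval_psum (rmorph1, rmorphM). Qed.
Lemma eval_psum_scalable : scalable (@eval_psum N).
Proof. by move=> c p; rewrite /eval_psum mmapZ /= mulr_algl. Qed.
HB.instance Definition _ :=
  GRing.isZmodMorphism.Build {mpoly Qqt[N]} Sqt (@eval_psum N) eval_psum_zmod.
HB.instance Definition _ :=
  GRing.isMonoidMorphism.Build {mpoly Qqt[N]} Sqt (@eval_psum N) eval_psum_monoid.
HB.instance Definition _ :=
  GRing.isScalable.Build Qqt {mpoly Qqt[N]} Sqt *:%R (@eval_psum N) eval_psum_scalable.

Lemma eval_psumX (j : 'I_N) : eval_psum 'X_j = psum j.+1.
Proof. by rewrite /eval_psum mmapX mmap1U. Qed.

Lemma eval_psumC c : eval_psum c%:MP_[N] = c%:A.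
Proof. by rewrite -[c%:MP]mulr1 mul_mpolyC linearZ /= rmorph1. Qed.

End EvalPsum.

Lemma eval_psum_widen N M (P : {mpoly Qqt[N]}) : (N <= M)%N ->
  exists P' : {mpoly Qqt[M]}, eval_psum P = eval_psum P'.
Proof.
move=> le; exists (mmap (@mpolyC M Qqt) (fun j => 'X_(widen_ord le j)) P).
rewrite mmap_morph; apply: eq_mmap => [c|j] /=; first by rewrite eval_psumC.
by rewrite eval_psumX.
Qed.

Lemma psum_poly2 F G : psum_poly F -> psum_poly G ->
  exists N (P Q : {mpoly Qqt[N]}), F = eval_psum P /\ G = eval_psum Q.
Proof.
move=> [N [P ->]] [M [Q ->]]; exists (maxn N M).
have [P' EP] := eval_psum_widen P (leq_maxl N M).
by have [Q' EQ] := eval_psum_widen Q (leq_maxr N M); exists P', Q'.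
Qed.

Lemma psum_polyD F G : psum_poly F -> psum_poly G -> psum_poly (F + G).
Proof.
move=> HF HG; have [N [P [Q [-> ->]]]] := psum_poly2 HF HG.
by exists N, (P + Q); rewrite rmorphD.
Qed.

Lemma psum_polyM F G : psum_poly F -> psum_poly G -> psum_poly (F * G).
Proof.
move=> HF HG; have [N [P [Q [-> ->]]]] := psum_poly2 HF HG.
by exists N, (P * Q); rewrite rmorphM.
Qed.

Lemma psum_polyZ c F : psum_poly F -> psum_poly (c *: F).
Proof. by move=> [N [P ->]]; exists N, (c *: P); rewrite linearZ. Qed.

Lemma psum_poly1 : psum_poly 1.
Proof. by exists 0%N, 1; rewrite rmorph1. Qed.

Lemma psum_poly0 : psum_poly 0.
Proof. by exists 0%N, 0; rewrite rmorph0. Qed.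

Lemma psum_poly_psum r : (0 < r)%N -> psum_poly (psum r).
Proof.
case: r => // r _; exists r.+1, 'X_ord_max.
by rewrite eval_psumX.
Qed.

Lemma psum_poly_sum I (r : seq I) (P : pred I) (F : I -> Sqt) :
  (forall i, P i -> psum_poly (F i)) -> psum_poly (\sum_(i <- r | P i) F i).
Proof.
by move=> H; elim/big_rec: _ => [|i f Pi]; [exact: psum_poly0|apply/psum_polyD/H].
Qed.

(* The polynomial F[X - u] in u, for F = P(p_1, p_2, ...) in all the variables X. *)
Definition pleth_sub0 N (P : {mpoly Qqt[N]}) : {poly Sqt} :=
  mmap (fun c => (c%:A)%:P) (fun j : 'I_N => (psum j.+1)%:P - 'X^(j.+1)) P.

Lemma pleth_sub0_coef N (P : {mpoly Qqt[N]}) r : psum_poly (pleth_sub0 P)`_r.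
Proof.
pose good (p : {poly Sqt}) := forall r, psum_poly p`_r.
have goodC F : psum_poly F -> good F%:P.
  by move=> HF i; rewrite coefC; case: ifP => // _; apply: psum_poly0.
have goodM p p' : good p -> good p' -> good (p * p').
  by move=> gp gp' i; rewrite coefM; apply: psum_poly_sum => j _; apply: psum_polyM.
suff : good (pleth_sub0 P) by apply.
rewrite /pleth_sub0 /mmap; elim/big_rec: _ => [|u p _ gp]; first by rewrite -polyC0; apply/goodC/psum_poly0.
move=> i; rewrite coefD; apply: psum_polyD (gp i).
apply: (goodM); first exact/goodC/psum_polyZ/psum_poly1.
rewrite /mmap1; elim/big_rec: _ => [|j p' _ gp']; first by rewrite -polyC1; apply/goodC/psum_poly1.
apply: (goodM _ _ _ gp'); elim: (u j) => [|l IH]; first by rewrite expr0 -polyC1; apply/goodC/psum_poly1.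
rewrite exprS; apply: goodM IH => i'; rewrite coefB -scaleN1r; apply: psum_polyD.
  by apply: goodC; apply: psum_poly_psum.
apply: psum_polyZ; rewrite coefXn; case: eqP => _; [exact: psum_poly1|exact: psum_poly0].
Qed.

Lemma map_pleth_sub0 k N (P : {mpoly Qqt[N]}) :
  map_poly (in_tail k) (pleth_sub0 P) =
  mmap (fun c => (c%:A)%:P) (fun j : 'I_N => (in_tail k (psum j.+1))%:P - 'X^(j.+1)) P.
Proof.
rewrite /pleth_sub0 mmap_morph; apply: eq_mmap => [c|j] /=.
  by rewrite map_polyC /= linearZ /= rmorph1.
by rewrite rmorphB /= map_polyC map_polyXn.
Qed.

(** On power sums, p_r[X_k] - x_{k+1}^r = p_r[X_{k+1}]. So F[X_k - u] at u = x_{k+1} rewrites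
    F[X_{k+1}] as a polynomial in x_{k+1} with coefficients symmetric in X_k. *)
Lemma horner_pleth_sub0 k N (P : {mpoly Qqt[N]}) :
  (map_poly (in_tail k) (pleth_sub0 P)).[xs k] = in_tail k.+1 (eval_psum P).
Proof.
rewrite map_pleth_sub0 -horner_evalE mmap_morph mmap_morph.
apply: eq_mmap => [c|j] /=; first by rewrite horner_evalE hornerC linearZ /= rmorph1.
by rewrite horner_evalE hornerD hornerN hornerC hornerXn in_tail_psumS // addrC addKr.
Qed.

Lemma psum_poly_symfun F : psum_poly F -> is_symfun F.
Proof.
move=> [N [P ->]]; apply/is_symfunP; rewrite /eval_psum /mmap; split.
  apply: bounded_degree_sum => u _; apply: bounded_degreeM.
    exact/bounded_degree_scale/bounded_degree1.
  apply: bounded_degree_prod => j _; elim: (u j) => [|l IH].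
    exact: bounded_degree1.
  by rewrite exprS; apply: bounded_degreeM IH; apply: bounded_psum.
apply: tail_symmetric_sum => u _; apply: tail_symmetricM.
  exact/tail_symmetricZ/tail_symmetric1.
apply: tail_symmetric_prod => j _; apply: tail_symmetric_exp.
exact: tail_symmetric_psum.
Qed.

Lemma natr_Qqt_neq0 m : (m.+1)%:R != 0 :> Qqt.
Proof.
rewrite -(rmorph_nat polyq) polyq_eq0; apply/eqP => /(congr1 (meval (fun=> 0))) /eqP.
by rewrite rmorph_nat rmorph0 Num.Theory.pnatr_eq0.
Qed.

Definition homogeneous_series d (F : Sqt) := forall e, edeg e != d -> F e = 0.

(* Euler's identity d F = sum_i x_i dF/dx_i for F homogeneous of degree d: expanding F
   along x_1, the first summand is a combination of the x_1^a F_a[X - x_1] with F_a of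
   lower degree, so the sum over i is a polynomial in the power sums by induction. *)
Lemma homogeneous_psum_poly d F :
  homogeneous_series d F -> tail_symmetric 0 F -> psum_poly F.
Proof.
have [m] := ubnP d; elim: m d F => // m IH d F led hF sF.
have [d0|d0] := posnP d.
  have -> : F = F 0 *: 1.
    apply: funext => e; rewrite series_scaleE series_1E; case: eqP => [->|/eqP ne].
      by rewrite mulr1.
    by rewrite mulr0 hF // d0 edeg_eq0.
  exact/psum_polyZ/psum_poly1.
(* The coefficient of x_1^a in F, renumbered as a series in all the variables. *)
pose Fa a : Sqt := fun e => F ('X^0 *+ a + e * 'X^1).
(* The polynomial y_a is F_a[X - u]. Its coefficients involve the full alphabet and are fixed by
   every swap, so the formula found for x_1 can be carried to each x_i. *)
have [y yP] : exists y : nat -> {poly Sqt}, forall a, (0 < a <= d)%N ->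
    [/\ (y a).[xs 0] = in_tail 1 (Fa a),
        forall i, map_poly (swap_series i) (y a) = y a &
        forall r, psum_poly (y a)`_r].
  suff H a : exists p : {poly Sqt}, (0 < a <= d)%N -> [/\ p.[xs 0] = in_tail 1 (Fa a),
        forall i, map_poly (swap_series i) p = p & forall r, psum_poly p`_r].
    by exists (fun a => projT1 (cid (H a))) => a; apply: (projT2 (cid (H a))).
  have [lea|nle] := boolP (0 < a <= d)%N; last by exists 0.
  have [|||N [P EP]] := IH (d - a)%N (Fa a); first by lia.
  - move=> e ne; apply: hF; apply: contra ne; rewrite edegD edegMn edegMXn.
    by move/eqP => <-; rewrite addKn.
  - move=> i _; apply: funext => e; rewrite swap_seriesE /reindex_series /Fa /=.
    rewrite -[in RHS](sF i.+1 isT) swap_seriesE /reindex_series /= swap_expoD.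
    congr (F (_ + _)).
      apply/polyP => j; rewrite coef_swap_expo !expoMn /=.
      by case: (j =P i.+1) => [->|_] //; case: (j =P i.+2) => [->|].
    apply/polyP => j; rewrite coef_swap_expo !coefMXn coef_swap_expo.
    case: j => [//|j]; rewrite /= !eqSS !subn1 /=.
    by case: (j == i) => //; case: (j == i.+1).
  exists (pleth_sub0 P) => _; split=> [|i|r]; last exact: pleth_sub0_coef.
    have := horner_pleth_sub0 0 P; rewrite -EP (_ : map_poly _ _ = pleth_sub0 P) //.
    apply/polyP => r; rewrite coef_map /=; apply: funext => e.
    by rewrite /in_tail take_poly0l eqxx drop_poly0l.
  rewrite /pleth_sub0 mmap_morph; apply: eq_mmap => [c|j] /=.
    by rewrite map_polyC /= linearZ /= rmorph1.
  by rewrite rmorphB /= map_polyC map_polyXn /= swap_psum.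
(* This is x_i dF/dx_i, to be written as the sum of a x_i^a F_a[X - x_i] over a > 0. *)
pose D i : Sqt := fun e => ((e`_i)%R : nat)%:R * F e.
pose Y i := \sum_(a < d.+1 | (0 < a)%N) (a : nat)%:R *: (xs i ^+ a * (y a).[xs i]).
have DY i : D i = Y i.
  elim: i => [|i IHi].
    apply: funext => e; rewrite /Y series_sumE.
    transitivity (\sum_(a < d.+1 | (0 < a)%N)
        if (e`_0)%R == a :> nat then (a : nat)%:R * F e else 0); last first.
      apply: eq_bigr => a a0; have [|-> _ _] := yP a; first by rewrite a0 -ltnS /=.
      rewrite series_scaleE xsE -monoMn mono_in_tailE ?size_expoMn // /Fa.
      have tE : take_poly 1 e = 'X^0 *+ (e`_0)%R.
        by apply/polyP => -[|j]; rewrite coef_take_poly expoMn /= ?mul1n.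
      rewrite tE; case: eqP => [Ea|ne].
        by rewrite -Ea eqxx -tE poly_take_drop.
      case: eqP => [/polyP/(_ 0%N)|_]; last by rewrite mulr0.
      by rewrite !expoMn !mul1n.
    rewrite /D; have [lt|ge] := ltnP (e`_0)%R d.+1; last first.
      rewrite hF ?mulr0 ?big1 // => [a _|]; first by case: ifP => //; rewrite mulr0.
      have [->|e0] := eqVneq e 0; first by rewrite edeg0 ltn_eqF.
      rewrite gtn_eqF // (leq_trans ge) //.
      rewrite (@edeg_sum (size e)) // -(big_mkord xpredT (fun i => (e`_i)%R : nat)).
      by rewrite big_ltn ?leq_addr // lt0n size_poly_eq0.
    have [z|p0] := posnP (e`_0)%R.
      by rewrite z mul0r big1 // => a a0; rewrite ltn_eqF.
    rewrite (bigD1 (Ordinal lt)) //= eqxx big1 ?addr0 // => a /andP[_ ne].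
    by case: eqP => // E; case/eqP: ne; apply: val_inj.
  (* By symmetry of F the swap carries the formula from x_i to x_{i+1}, which propagates it from the
     first variable. *)
  have -> : D i.+1 = swap_series i (D i).
    apply: funext => e; rewrite swap_seriesE /reindex_series /D /= coef_swap_expo swap_idx_l.
    by rewrite -{1}(sF i (leq0n i)) swap_seriesE.
  rewrite IHi /Y rmorph_sum; apply: eq_bigr => a a0.
  rewrite /= linearZ /= rmorphM rmorphXn /= swap_xs swap_idx_l; congr (_ *: (_ * _)).
  have [|_ sy _] := yP a; first by rewrite a0 -ltnS /=.
  by rewrite -horner_map /= sy swap_xs swap_idx_l.
(* Summation over i replaces x_i^(r + a) by a power sum, the coefficients of y_a being independent
   of i. *)
have EF : d%:R *: F = \sum_(a < d.+1 | (0 < a)%N) (a : nat)%:R *: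
    \sum_(r < size (y a)) (y a)`_r * psum (r + a).
  apply: funext => e; rewrite series_scaleE.
  transitivity (\sum_(i < size e) D i e).
    rewrite /D -mulr_suml -natr_sum; case: (eqVneq (edeg e) d) => [<-//|ne].
    by rewrite hF // !mulr0.
  under eq_bigr => i _ do rewrite DY /Y series_sumE.
  rewrite exchange_big series_sumE; apply: eq_bigr => a a0.
  rewrite series_scaleE series_sumE.
  under eq_bigr => i _ do rewrite series_scaleE.
  rewrite -mulr_sumr; congr (_ * _).
  transitivity (\sum_(i < size e) \sum_(r < size (y a)) ((y a)`_r * xs i ^+ (r + a)) e).
    apply: eq_bigr => i _.
    transitivity ((\sum_(r < size (y a)) (y a)`_r * xs i ^+ (r + a)) e); last first.
      by rewrite series_sumE.
    rewrite horner_coef mulr_sumr; congr (_ e); apply: eq_bigr => r _.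
    by rewrite mulrCA -exprD addnC.
  rewrite exchange_big; apply: eq_bigr => r _; rewrite series_mulE.
  transitivity (\sum_(p <- splits e) (y a)`_r p.1 * (\sum_(i < size e) (xs i ^+ (r + a)) p.2)).
    under [RHS]eq_bigr => p _ do rewrite mulr_sumr.
    by rewrite exchange_big; apply: eq_bigr => i _.
  rewrite big_seq [RHS]big_seq; apply: eq_bigr => p; rewrite mem_splits => /eqP E.
  congr (_ * _); apply/esym/psumE; first by rewrite addn_gt0 a0 orbT.
  have := leqnn (size e); rewrite -{1}E size_expoD => /andP[_ le].
  exact: le.
have dn0 : d%:R != 0 :> Qqt by rewrite -(prednK d0) natr_Qqt_neq0.
have -> : F = d%:R^-1 *: (d%:R *: F) by rewrite scalerA mulVf // scale1r.
rewrite EF; apply/psum_polyZ/psum_poly_sum => a a0; apply/psum_polyZ/psum_poly_sum => r _.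
have [|_ _ cy] := yP a; first by rewrite a0 -ltnS /=.
by apply: psum_polyM (cy r) _; apply: psum_poly_psum; rewrite addn_gt0 a0 orbT.
Qed.

Lemma symfun_psum_poly F : is_symfun F -> psum_poly F.
Proof.
move/is_symfunP => [[D HD] sF].
pose Fd d : Sqt := fun e => if edeg e == d then F e else 0.
have -> : F = \sum_(d < D) Fd d.
  apply: funext => e; rewrite series_sumE; have [lt|le] := ltnP (edeg e) D.
    rewrite (bigD1 (Ordinal lt)) //= /Fd eqxx big1 ?addr0 // => i ne.
    by case: eqP => // E; case/eqP: ne; apply: val_inj.
  by rewrite HD // big1 // => i _; rewrite /Fd HD // if_same.
apply: psum_poly_sum => d _; apply: (@homogeneous_psum_poly d).
  by move=> e; rewrite /Fd => /negbTE ->.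
move=> i _; apply: funext => e; rewrite swap_seriesE /reindex_series /Fd /= edeg_swap.
by rewrite -{2}(sF i (leq0n i)) swap_seriesE.
Qed.

(** * The operator d_- on powers of a variable *)

(** In characteristic 0 the naturals are infinitely many roots. This is what extends identities in
    the multiplicity of an alphabet from natural numbers to -1. *)
Lemma poly_nat_roots0 (A : idomainType) (W : {poly A}) :
  (forall m, (m.+1)%:R != 0 :> A) -> (forall m : nat, W.[m%:R] = 0) -> W = 0.
Proof.
move=> char0 W0; apply/eqP; apply: contraT => nz.
have := max_poly_roots nz (rs := [seq m%:R | m <- iota 0 (size W)]).
rewrite size_map size_iota ltnn; apply.
  by apply/allP => _ /mapP [m _ ->]; apply/eqP/W0.
rewrite map_inj_uniq ?iota_uniq // => i j E.
wlog le : i j E / (i <= j)%N.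
  by move=> H; case: (leqP i j) => [/(H _ _ E)//|/ltnW /(H _ _ (esym E)) ->].
have : (j - i)%:R = 0 :> A by rewrite natrB // E subrr.
case: (posnP (j - i)%N) => [/eqP|gt]; last first.
  by rewrite -(prednK gt) => /eqP; rewrite (negbTE (char0 _)).
by rewrite subn_eq0 => le' _; apply/eqP; rewrite eqn_leq le.
Qed.

Lemma natr_mpoly_neq0 n m : (m.+1)%:R != 0 :> {mpoly Qqt[n]}.
Proof. by rewrite -(rmorph_nat (@mpolyC n Qqt)) mpolyC_eq0 natr_Qqt_neq0. Qed.

Lemma hsym_symfun b : is_symfun (hsym b).
Proof.
apply/is_symfunP; split.
  by exists b.+1 => e le; rewrite /hsym gtn_eqF.
by move=> i _; apply: funext => e; rewrite swap_seriesE /reindex_series /hsym edeg_swap.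
Qed.

(** The monomials of degree b + 1 are separated according to whether x_1 divides them. *)
Lemma hsymS b : hsym b.+1 = in_tail 1 (hsym b.+1) + xs 0 * hsym b.
Proof.
apply: funext => e; rewrite series_addE; have [e0|gt] := posnP (e`_0)%R.
  have t0 : take_poly 1 e == 0.
    apply/eqP/polyP => -[|j]; rewrite coef_take_poly coef0 //.
  rewrite xs_mul_out // addr0 /in_tail t0 /hsym {1}(tail_expo t0) edegMXn.
  by [].
have [e' ->] := expo_Xn_sub gt; rewrite xs_mulE /in_tail ifF.
  by rewrite add0r /hsym edegD edegX.
apply/negbTE/eqP => /polyP /(_ 0%N) /eqP.
by rewrite coef_take_poly coef0 expoD expoX.
Qed.

Lemma hsym0 : hsym 0 = 1.
Proof. by apply: funext => e; rewrite /hsym edeg_eq0. Qed.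

Lemma inclC m c : incl c%:MP_[m] = c%:A.
Proof. by rewrite -[c%:MP]mulr1 mul_mpolyC linearZ /= rmorph1. Qed.

Lemma Xi_eval_psum M N (Q : {mpoly Qqt[N]}) :
  Xi M (eval_psum Q) =
  mmap (@mpolyC M Qqt) (fun j : 'I_N => \sum_(i < M) 'X_i ^+ j.+1) Q.
Proof.
apply: XiP.
  by have [] : is_symfun (eval_psum Q) by apply: psum_poly_symfun; exists N, Q.
rewrite /eval_psum !mmap_morph; apply: eq_mmap => [c|j] /=.
  by rewrite linearZ /= rmorph1 inclC.
rewrite cut_psum // rmorph_sum; apply: eq_bigr => i _ /=.
by rewrite rmorphXn /= inclX.
Qed.

Lemma Xi_in_tail1 M f : bounded_degree f ->
  Xi M.+1 (in_tail 1 f) = mmap (@mpolyC M.+1 Qqt) (fun i => 'X_(lift ord0 i)) (Xi M f).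
Proof.
move=> bf; apply: XiP; first exact: bounded_degree_in_tail.
have -> : cut M.+1 (in_tail 1 f) = in_tail 1 (incl (Xi M f)).
  by rewrite -addn1 cut_in_tail incl_Xi.
apply: (mpoly_morph_ext (f := in_tail 1 \o @incl M)
  (g := @incl M.+1 \o mmap (@mpolyC M.+1 Qqt) (fun i => 'X_(lift ord0 i)))) => [c|i] /=.
  by rewrite mmapC !inclC linearZ /= rmorph1.
by rewrite mmapX mmap1U !inclX in_tail_xs addn1.
Qed.

(** Here k2, k1, k0 stand for h_b, h_{b-1}, h_{b-2} of the alphabet to which y and z have both been
    added. The hypotheses remove z and y, or replace the removal of a letter by that of q times
    it. *)
Lemma letters_identity (A : comAlgType Qqt) (y z k2 k1 k0 S0 Sy Sz Syz : A) :
  S0 = k2 - z * k1 - y * (k1 - z * k0) ->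
  Sy = k2 - z * k1 - (q *: y) * (k1 - z * k0) ->
  Sz = k2 - y * k1 - (q *: z) * (k1 - y * k0) ->
  Syz = k2 - (q *: z) * k1 - (q *: y) * (k1 - (q *: z) * k0) ->
  (y - z) * (Syz - Sy) = (q *: y - z) * (Sz - S0) + (1 - q) *: (z * (Sy - S0)).
Proof. by move=> -> -> -> ->; rewrite !scale_in_alg !(rmorphB, rmorph1) /=; ring. Qed.

(** With u = s v, the right side is (y - z) times q T^-1 v, by q T^-1 = T + q - 1 and the cleared
    equation. *)
Lemma hdiff_identity (A : comAlgType Qqt) (y z u v : A) :
  (q *: y - z) * u + (1 - q) *: (z * v) =
  (q *: y - z) * u + (1 - q) *: (y * v) + (y - z) * ((q - 1) *: v).
Proof. by rewrite !scale_in_alg !(rmorphB, rmorph1) /=; ring. Qed.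

Section Alphabets.
Variable n : nat.
Local Notation A := {mpoly Qqt[n]}.
Variables (N : nat -> nat) (P : forall b, {mpoly Qqt[N b]}).
Hypothesis hP : forall b, hsym b = eval_psum (P b).

(** The plethysm h_b[a] of an alphabet known by its power sums. [P b] is whichever expression of h_b
    in power sums was chosen, so the properties of [hval] are derived from its values on lists of
    letters. *)
Definition hval b (a : nat -> A) : A :=
  mmap (@mpolyC n Qqt) (fun j : 'I_(N b) => a j.+1) (P b).

Definition pval (L : seq A) j : A := \sum_(y <- L) y ^+ j.

Lemma pval_cons y L j : pval (y :: L) j = y ^+ j + pval L j.
Proof. exact: big_cons. Qed.

Lemma hval_ext b a a' : (forall j, a j.+1 = a' j.+1) -> hval b a = hval b a'.
Proof. by move=> E; apply: eq_mmap => // j; apply: E. Qed.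

Definition evalL (L : seq A) : {mpoly Qqt[size L]} -> A :=
  mmap (@mpolyC n Qqt) (fun i => L`_i).

Lemma hval_list b L : hval b (pval L) = evalL (Xi (size L) (hsym b)).
Proof.
rewrite hP Xi_eval_psum /evalL mmap_morph; apply: eq_mmap => [c|j] /=.
  by rewrite mmapC.
rewrite rmorph_sum /= /pval (big_nth 0) big_mkord; apply: eq_bigr => i _.
by rewrite rmorphXn /= mmapX mmap1U.
Qed.

Lemma hval_cons b y L :
  hval b.+1 (pval (y :: L)) = hval b.+1 (pval L) + y * hval b (pval (y :: L)).
Proof.
have [bh _] := hsym_symfun b; have [bh1 _] := hsym_symfun b.+1.
rewrite !hval_list hsymS /= XiD; last 2 first.
- exact: bounded_degree_in_tail.
- exact: bounded_degreeM (bounded_degree_xs 0) bh.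
rewrite (XiM _ (bounded_degree_xs 0) bh) Xi_xs Xi_in_tail1 // -hsymS.
rewrite /evalL rmorphD rmorphM /=; congr (_ + _ * _).
  rewrite mmap_morph; apply: eq_mmap => [c|i] /=; first by rewrite mmapC.
  by rewrite mmapX mmap1U.
by rewrite (xv_ord ord0) mmapX mmap1U.
Qed.

Lemma hval0_list L : hval 0 (pval L) = 1.
Proof.
rewrite hval_list hsym0 (_ : Xi _ 1 = 1) /evalL ?rmorph1 //.
by apply: XiP; [exact: bounded_degree1 | rewrite !rmorph1].
Qed.

Lemma hval_nil b : hval b.+1 (pval [::]) = 0.
Proof.
rewrite hval_list (_ : Xi _ _ = 0) /evalL ?rmorph0 //.
apply/mpolyP => u; rewrite mcoeff0 Xi_coef; last by case: (hsym_symfun b.+1).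
by rewrite /hsym edeg_expo_of_mnm mdegE big_ord0.
Qed.

(* Differences of finite alphabets, given by their power sums of positive degree. *)
Definition virtual (a : nat -> A) :=
  exists L1 L2, forall j, a j.+1 = pval L1 j.+1 - pval L2 j.+1.

Definition add_letter (a : nat -> A) (y : A) j := a j + y ^+ j.
Definition sub_letter (a : nat -> A) (y : A) j := a j - y ^+ j.

Lemma add_letterE a y j : add_letter a y j = a j + y ^+ j. Proof. by []. Qed.
Lemma sub_letterE a y j : sub_letter a y j = a j - y ^+ j. Proof. by []. Qed.

Let hvalX b (v : nat -> {poly A}) : {poly A} :=
  mmap (polyC \o @mpolyC n Qqt) (fun j : 'I_(N b) => v j.+1) (P b).

Let hvalX_horner b v c : (hvalX b v).[c] = hval b (fun j => (v j).[c]).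
Proof.
rewrite /hvalX -horner_evalE mmap_morph; apply: eq_mmap => [d|j] //=.
by rewrite horner_evalE hornerC.
Qed.

Let mult_list (L1 L2 : seq A) m := L1 ++ flatten (nseq m L2).

Let pval_mult L1 L2 m j : pval (mult_list L1 L2 m) j = pval L1 j + m%:R * pval L2 j.
Proof.
rewrite /pval /mult_list big_cat; congr (_ + _); elim: m => [|m IH] /=.
  by rewrite big_nil mul0r.
by rewrite big_cat IH /= -[m.+1]addn1 natrD mulrDl mul1r addrC.
Qed.

(* Both sides are polynomial in the multiplicity m of L2 in the alphabet L1 + m L2. *)
Lemma hval_add_letter b a y : virtual a ->
  hval b.+1 (add_letter a y) = hval b.+1 a + y * hval b (add_letter a y).
Proof.
move=> [L1 [L2 Ea]].
pose v1 j := (pval L1 j)%:P + 'X * (pval L2 j)%:P; pose v2 j := v1 j + (y ^+ j)%:P.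
pose W := hvalX b.+1 v2 - hvalX b.+1 v1 - y%:P * hvalX b v2.
have v1E c j : (v1 j).[c] = pval L1 j + c * pval L2 j.
  by rewrite /v1 hornerD hornerM hornerX !hornerC.
have v2E c j : (v2 j).[c] = pval L1 j + c * pval L2 j + y ^+ j.
  by rewrite /v2 hornerD v1E hornerC.
have WE c : W.[c] = hval b.+1 (fun j => (v2 j).[c]) - hval b.+1 (fun j => (v1 j).[c])
                    - y * hval b (fun j => (v2 j).[c]).
  by rewrite /W !hornerD !hornerN hornerM hornerC !hvalX_horner.
have W0 : W = 0.
  apply: poly_nat_roots0 (natr_mpoly_neq0 n) _ => m; rewrite WE.
  have E2 d : hval d (fun j => (v2 j).[m%:R]) = hval d (pval (y :: mult_list L1 L2 m)).
    by apply: hval_ext => j; rewrite v2E pval_cons pval_mult addrC.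
  have E1 d : hval d (fun j => (v1 j).[m%:R]) = hval d (pval (mult_list L1 L2 m)).
    by apply: hval_ext => j; rewrite v1E pval_mult.
  by rewrite !E2 E1 hval_cons addrAC addrK subrr.
(* Multiplicity -1 is the alphabet L1 - L2, that is, a. *)
have := WE (-1); rewrite W0 horner0.
rewrite (@hval_ext b.+1 (fun j => (v2 j).[-1]) (add_letter a y)); last first.
  by move=> j; rewrite v2E add_letterE Ea mulN1r.
rewrite (@hval_ext b.+1 (fun j => (v1 j).[-1]) a); last first.
  by move=> j; rewrite v1E Ea mulN1r.
rewrite (@hval_ext b (fun j => (v2 j).[-1]) (add_letter a y)); last first.
  by move=> j; rewrite v2E add_letterE Ea mulN1r.
by move/esym/eqP; rewrite subr_eq0 subr_eq addrC => /eqP.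
Qed.

Lemma hval0 a : virtual a -> hval 0 a = 1.
Proof.
move=> [L1 [L2 Ea]].
pose v1 j := (pval L1 j)%:P + 'X * (pval L2 j)%:P.
pose W := hvalX 0 v1 - 1.
have v1E c j : (v1 j).[c] = pval L1 j + c * pval L2 j.
  by rewrite /v1 hornerD hornerM hornerX !hornerC.
have WE c : W.[c] = hval 0 (fun j => (v1 j).[c]) - 1.
  by rewrite /W hornerD hornerN -polyC1 hornerC hvalX_horner.
have W0 : W = 0.
  apply: poly_nat_roots0 (natr_mpoly_neq0 n) _ => m; rewrite WE.
  rewrite (@hval_ext 0 _ (pval (mult_list L1 L2 m))) ?hval0_list ?subrr //.
  by move=> j; rewrite v1E pval_mult.
have := WE (-1); rewrite W0 horner0.
rewrite (@hval_ext 0 _ a); last by move=> j; rewrite v1E Ea mulN1r.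
by move/esym/eqP; rewrite subr_eq0 => /eqP.
Qed.

Lemma hvalE b a : hval b a = mmap (@mpolyC n Qqt) (fun j : 'I_(N b) => a j.+1) (P b).
Proof. by []. Qed.

#[local] Opaque hval.

(* hval shifted by two indices, so that the recursion has no boundary case. *)
Definition hshift b a := if b is b'.+2 then hval b' a else 0.

Lemma hshift_ext b a a' : (forall j, a j.+1 = a' j.+1) -> hshift b a = hshift b a'.
Proof. by case: b => [|[|b]] E; [exact: erefl | exact: erefl | exact: hval_ext]. Qed.

Lemma virtual_add a y : virtual a -> virtual (add_letter a y).
Proof.
move=> [L1 [L2 E]]; exists (y :: L1), L2 => j.
by rewrite add_letterE E pval_cons addrC addrA.
Qed.

Lemma virtual_sub a y : virtual a -> virtual (sub_letter a y).
Proof.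
move=> [L1 [L2 E]]; exists L1, (y :: L2) => j.
by rewrite sub_letterE E pval_cons opprD addrA addrAC.
Qed.

Lemma hshift_add b a y : virtual a ->
  hshift b.+1 (add_letter a y) = hshift b.+1 a + y * hshift b (add_letter a y).
Proof.
move=> va; case: b => [|[|b]]; last exact: hval_add_letter.
  by rewrite /= mulr0 addr0.
by rewrite /= (hval0 va) (hval0 (virtual_add y va)) mulr0 addr0.
Qed.

(** This is [hshift_add] for the alphabet a - y, to which adding y gives back a. *)
Lemma hshift_sub b a y : virtual a ->
  hshift b.+1 (sub_letter a y) = hshift b.+1 a - y * hshift b a.
Proof.
move=> va; have E d : hshift d (add_letter (sub_letter a y) y) = hshift d a.
  by apply: hshift_ext => j; rewrite add_letterE sub_letterE subrK.
by have := hshift_add b y (virtual_sub y va); rewrite !E => ->; rewrite addrK.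
Qed.

(* With E(y) = (1 - q y w) / (1 - y w) and H the generating function of a, the
   generating functions of the four alphabets are H, H E(y), H E(z), H E(y) E(z). *)
Lemma hval_letters b a y z : virtual a ->
  let a1 y := sub_letter (add_letter a y) (q *: y) in
  (y - z) * (hval b (sub_letter (add_letter (a1 y) z) (q *: z)) - hval b (a1 y)) =
  (q *: y - z) * (hval b (a1 z) - hval b a) + (1 - q) *: (z * (hval b (a1 y) - hval b a)).
Proof.
move=> va a1; pose u := add_letter (add_letter a y) z; pose K b := hshift b u.
have vy := virtual_add y va; have vz := virtual_add z va.
have vu : virtual u := virtual_add z vy.
have Ky d : hshift d.+1 (add_letter a y) = K d.+1 - z * K d.
  by apply: (canRL (addrK _)); apply/esym/hshift_add.
have Kz d : hshift d.+1 (add_letter a z) = K d.+1 - y * K d.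
  have E d' : K d' = hshift d' (add_letter (add_letter a z) y).
    by apply: hshift_ext => j; exact (addrAC (a j.+1) (y ^+ j.+1) (z ^+ j.+1)).
  by rewrite !E; apply: (canRL (addrK _)); apply/esym/hshift_add.
have K0 : hval b a = K b.+2 - z * K b.+1 - y * (K b.+1 - z * K b).
  apply: etrans (canRL (addrK _) (esym (hshift_add b.+1 y va))) _.
  exact: (congr2 (fun u v => u - y * v) (Ky b.+1) (Ky b)).
have K1 : hval b (a1 y) = K b.+2 - z * K b.+1 - (q *: y) * (K b.+1 - z * K b).
  apply: etrans (hshift_sub b.+1 (q *: y) vy) _.
  exact: (congr2 (fun u v => u - q *: y * v) (Ky b.+1) (Ky b)).
have K1z : hval b (a1 z) = K b.+2 - y * K b.+1 - (q *: z) * (K b.+1 - y * K b).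
  apply: etrans (hshift_sub b.+1 (q *: z) vz) _.
  exact: (congr2 (fun u v => u - q *: z * v) (Kz b.+1) (Kz b)).
have K2 : hval b (sub_letter (add_letter (a1 y) z) (q *: z)) =
    K b.+2 - (q *: z) * K b.+1 - (q *: y) * (K b.+1 - (q *: z) * K b).
  have Kq d : hshift d.+1 (sub_letter u (q *: z)) = K d.+1 - (q *: z) * K d.
    exact: hshift_sub vu.
  apply: etrans (etrans (hshift_sub b.+1 (q *: y) (virtual_sub (q *: z) vu)) _); last first.
    exact: (congr2 (fun u v => u - q *: y * v) (Kq b.+1) (Kq b)).
  apply: (@hshift_ext b.+2) => j.
  have rearr (p r s r' s' : A) : p + r - r' + s - s' = p + r + s - s' - r' by ring.
  exact (rearr (a j.+1) (y ^+ j.+1) (z ^+ j.+1) ((q *: y) ^+ j.+1) ((q *: z) ^+ j.+1)).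
exact: letters_identity K0 K1 K1z K2.
Qed.

Section Letters.
Variable k : nat.
Local Notation x := (xv n).

(** The power sums of (1 - q)(x_{k+1} + ... + x_{k+m}). The factor 1 - q^j says that each letter x
    is added together with the removal of q x. *)
Definition alphabet m j : A := (1 - q ^+ j) *: \sum_(i < m) x (k + i) ^+ j.

Lemma alphabetS m j :
  alphabet m.+1 j = sub_letter (add_letter (alphabet m) (x (k + m))) (q *: x (k + m)) j.
Proof.
rewrite sub_letterE add_letterE /alphabet big_ord_recr /= scalerDr -addrA.
by rewrite exprZn; congr (_ + _); rewrite scalerBl scale1r.
Qed.

Lemma virtual_alphabet m : virtual (alphabet m).
Proof.
elim: m => [|m IH].
  by exists [::], [::] => j; rewrite /alphabet big_ord0 scaler0 /pval big_nil subr0.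
have [L1 [L2 E]] := virtual_sub (q *: x (k + m)) (virtual_add (x (k + m)) IH).
by exists L1, L2 => j; rewrite alphabetS E.
Qed.

Definition hdiff b m := hval b (alphabet m.+1) - hval b (alphabet m).

Lemma hval_alphabet0 b : hval b.+1 (alphabet 0) = 0.
Proof.
rewrite -(hval_nil b); apply: hval_ext => j.
by rewrite /alphabet big_ord0 scaler0 /pval big_nil.
Qed.

(** For a single letter y, h_{b+1}[y - q y] = h_{b+1}[y] - q y h_b[y] = (1 - q) y^(b+1). *)
Lemma hdiff0 b : hdiff b.+1 0 = (1 - q) *: x k ^+ b.+1.
Proof.
have v0 := virtual_alphabet 0; rewrite -[in RHS](addn0 k); set y := x (k + 0).
have E d : hval d (add_letter (alphabet 0) y) = y ^+ d.
  elim: d => [|d IH]; first by rewrite (hval0 (virtual_add _ v0)).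
  by rewrite (hval_add_letter _ _ v0) hval_alphabet0 add0r IH exprS.
rewrite /hdiff hval_alphabet0 subr0.
apply: etrans (hval_ext b.+1 (fun j => alphabetS 0 j.+1)) _.
apply: etrans (hshift_sub b.+2 (q *: y) (virtual_add y v0)) _.
apply: etrans (congr2 (fun u v => u - q *: y * v) (E b.+1) (E b)) _.
by rewrite -scalerAl -exprS scalerBl scale1r.
Qed.

#[local] Opaque msym demazure_lusztig.

Local Notation sk m := (msym (transp n (k + m))).

(** The swap of y = x_{k+m+1} and z = x_{k+m+2} fixes the alphabet of the first m letters and turns
    its extension by y into its extension by z. Multiplied by y - z, the claim is thus
    [hval_letters], rearranged by [hdiff_identity]. *)
Lemma hdiffS b m : (k + m.+1 < n)%N -> hdiff b m.+1 = q *: Tv_inv (k + m) (hdiff b m).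
Proof.
rewrite addnS => lt; have ds := swap_datum_mpoly lt.
apply: (swap_regI ds); rewrite -[Tv_inv _ _]/(demazure_lusztig_inv _ _ _ _) qTinvP.
set y := x (k + m) in ds *; set z := x (k + m).+1 in ds *.
have s_alph i : (i <= m)%N -> sk m (x (k + i)) = if i == m then z else x (k + i).
  move=> le; case: (eqVneq i m) => [->|ne]; first exact: swap_x ds.
  by apply: (msym_xv_id lt); lia.
have s_hval a a' : (forall j, sk m (a j.+1) = a' j.+1) -> sk m (hval b a) = hval b a'.
  move=> E; rewrite !hvalE.
  apply: etrans (mmap_morph (sk m) _ _ _) _.
  by apply: eq_mmap => [c|j]; [exact: msymC | exact: E].
have s_al j : sk m (alphabet m j) = alphabet m j.
  rewrite /alphabet linearZ rmorph_sum; congr (_ *: _); apply: eq_bigr => i _.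
  rewrite rmorphXn /= s_alph; last exact: ltnW.
  by rewrite ltn_eqF.
have sS0 : sk m (hval b (alphabet m)) = hval b (alphabet m) by apply: s_hval.
have sS1 : sk m (hval b (alphabet m.+1)) =
    hval b (sub_letter (add_letter (alphabet m) z) (q *: z)).
  apply: s_hval => j; apply: etrans (congr1 (sk m) (alphabetS m j.+1)) _.
  transitivity (sk m (alphabet m j.+1 + y ^+ j.+1 - (q *: y) ^+ j.+1)); first exact: erefl.
  rewrite rmorphB rmorphD /= s_al.
  have sX (u : A) : sk m (u ^+ j.+1) = (sk m u) ^+ j.+1 by exact: rmorphXn.
  have sZ : sk m (q *: y) = q *: sk m y by exact: linearZ.
  have sy := etrans (sX y) (congr1 (fun w => w ^+ j.+1) (swap_x ds)).
  have sqy := etrans (sX (q *: y)) (congr1 (fun w => w ^+ j.+1)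
    (etrans sZ (congr1 (fun w => q *: w) (swap_x ds)))).
  exact (congr2 (fun u v => alphabet m j.+1 + u - v) sy sqy).
have E1 : hval b (alphabet m.+1) = hval b (sub_letter (add_letter (alphabet m) y) (q *: y)).
  exact: hval_ext (fun j => alphabetS m j.+1).
have E2 : hval b (alphabet m.+2) = hval b (sub_letter (add_letter
    (sub_letter (add_letter (alphabet m) y) (q *: y)) z) (q *: z)).
  apply: hval_ext => j; apply: etrans (alphabetS m.+1 j.+1) _; rewrite addnS.
  exact: (congr1 (fun u => u + z ^+ j.+1 - (q *: z) ^+ j.+1) (alphabetS m j.+1)).
pose a1 u := sub_letter (add_letter (alphabet m) u) (q *: u).
have gen S2 S1 Sz : S2 = hval b (sub_letter (add_letter (a1 y) z) (q *: z)) ->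
    S1 = hval b (a1 y) -> Sz = hval b (a1 z) -> (y - z) * (S2 - S1) =
    (q *: y - z) * (Sz - hval b (alphabet m)) + (1 - q) *: (z * (S1 - hval b (alphabet m))).
  by move=> -> -> ->; apply: hval_letters; apply: virtual_alphabet.
have H := gen _ _ _ E2 E1 sS1; rewrite /hdiff.
move: (hval b (alphabet m.+2)) (hval b (alphabet m.+1)) (hval b (alphabet m)) sS0 H.
move=> S2 S1 S0 sS0 H; rewrite H [RHS]mulrDr (demazure_lusztigP ds) (swapB ds) sS0.
exact: hdiff_identity.
Qed.

Lemma hdiff_chain b m : (k + m < n)%N ->
  hdiff b.+1 m =
  (1 - q) *: (q ^+ m *: foldr (@Tv_inv n) (x k ^+ b.+1) (rev (iota k m))).
Proof.
elim: m => [|m IH] lt; first by rewrite hdiff0 /= expr0 scale1r.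
have lt1 : ((k + m).+1 < n)%N by lia.
rewrite (hdiffS _ lt) IH; last by lia.
rewrite (Tv_invZ _ _ lt1) (Tv_invZ _ _ lt1) foldr_rev_iota_addS.
move: (Tv_inv (k + m) _) => W; rewrite !scalerA; congr (_ *: _).
by rewrite exprS mulrA [q * (1 - q)]mulrC -mulrA.
Qed.

Lemma dminusv_pow b : (k < n)%N ->
  dminusv k (x k ^+ b.+1) = - hval b.+1 (alphabet (n - k)).
Proof.
move=> lt; rewrite /dminusv -opprB scaleNr scaler_sumr; congr (- _).
have -> : hval b.+1 (alphabet (n - k)) = \sum_(j < n - k) hdiff b.+1 j.
  rewrite -(big_mkord xpredT (hdiff b.+1)) /hdiff.
  rewrite (telescope_sumr (fun m => hval b.+1 (alphabet m)) (leq0n _)).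
  by rewrite hval_alphabet0 subr0.
apply: eq_bigr => j _; apply/esym/hdiff_chain.
by have := ltn_ord j; lia.
Qed.

End Letters.
End Alphabets.

(** * The operator d_- on almost symmetric functions *)

(** A candidate exists by [symfun_psum_poly]. The conclusion returns the expression actually chosen,
    which represents F and gives the value at the same time. *)
Lemma plethysmP (A : comNzRingType) (h : Qqt -> A) (a : nat -> A) F : is_symfun F ->
  exists N (P : {mpoly Qqt[N]}), F = eval_psum P /\
    plethysm h a F = mmap h (fun j : 'I_N => a j.+1) P.
Proof.
move=> /symfun_psum_poly [N [P EP]].
have evE M (Q : {mpoly Qqt[M]}) :
    mmap (fun c => c%:A) (fun j : 'I_M => psum j.+1) Q = eval_psum Q.
  by apply: eq_mmap => // c; rewrite in_algE.
have [|M [Q [EQ E]]] := epsilon_spec (inhabits 0) (fun y => exists N (P : {mpoly Qqt[N]}),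
    F = mmap (fun c => c%:A) (fun j : 'I_N => psum j.+1) P /\
    y = mmap h (fun j : 'I_N => a j.+1) P).
  by eexists; exists N, P; rewrite evE.
exists M, Q; split; first by rewrite -evE.
exact: E.
Qed.

Lemma pleth_subP k F : is_symfun F -> exists N (P : {mpoly Qqt[N]}),
  F = eval_psum P /\ pleth_sub k F = map_poly (in_tail k) (pleth_sub0 P).
Proof.
move=> sF; have [N [P [EF E]]] := plethysmP (fun c => (c%:A)%:P)
  (fun r => (in_tail k (psum r))%:P - 'X^r) sF.
by exists N, P; rewrite map_pleth_sub0.
Qed.

(** The expressions are gathered into one family over all b, because the recursions for h_b relate
    different b. *)
Lemma pleth_h_spec k : exists (N : nat -> nat) (P : forall b, {mpoly Qqt[N b]}),
  (forall b, hsym b = eval_psum (P b)) /\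
  (forall b, pleth_h k b = mmap (fun c => c%:A)
     (fun j : 'I_(N b) => (1 - q ^+ j.+1) *: in_tail k (psum j.+1)) (P b)).
Proof.
have H b := plethysmP (fun c => (c%:A : Sqt))
  (fun r => (1 - q ^+ r) *: in_tail k (psum r)) (hsym_symfun b).
have {}H b : exists x : {N & {mpoly Qqt[N]}}, hsym b = eval_psum (projT2 x) /\
    pleth_h k b = mmap (fun c => c%:A)
      (fun j : 'I_(projT1 x) => (1 - q ^+ j.+1) *: in_tail k (psum j.+1)) (projT2 x).
  by have [N [P HP]] := H b; exists (existT _ N P); exact: HP.
have [f Hf] := choice H.
exists (fun b => projT1 (f b)), (fun b => projT2 (f b)).
by split=> b; case: (Hf b).
Qed.

Lemma pleth_h_tail k b : exists2 G, is_symfun G & pleth_h k b = in_tail k G.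
Proof.
have [N [P [_ ->]]] := pleth_h_spec k.
exists (eval_psum (mmap (@mpolyC _ Qqt) (fun j => (1 - q ^+ j.+1) *: 'X_j) (P b))).
  by apply: psum_poly_symfun; eexists; eexists.
rewrite [eval_psum _](mmap_morph (@eval_psum (N b) : {rmorphism _ -> _})).
rewrite [RHS](mmap_morph (in_tail k : {rmorphism _ -> _})); apply: eq_mmap => [c|j] /=.
  by rewrite eval_psumC linearZ /= rmorph1.
by rewrite linearZ /= eval_psumX linearZ.
Qed.

Lemma Xi_pleth_h k n : (k <= n)%N -> exists (N : nat -> nat) (P : forall b, {mpoly Qqt[N b]}),
  (forall b, hsym b = eval_psum (P b)) /\
  forall b, Xi n (pleth_h k b) = hval P b (alphabet n k (n - k)).
Proof.
move=> le; have [N [P [hP phE]]] := pleth_h_spec k; exists N, P; split=> // b.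
apply: XiP.
  by have [G [bG _] ->] := pleth_h_tail k b; apply: bounded_degree_in_tail.
rewrite phE /hval !mmap_morph; apply: eq_mmap => [c|j] /=.
  by rewrite inclC linearZ /= rmorph1.
rewrite /alphabet !linearZ /= -{1}(subnK le) cut_in_tail_psum // rmorph_sum.
congr (_ *: _); apply: eq_bigr => i _ /=; rewrite rmorphXn /= incl_xv cut_xs addnC.
by have lti := ltn_ord i; rewrite ifT //; lia.
Qed.

Section Dminusv.
Variables (n k : nat).
Implicit Types p u : {mpoly Qqt[n]}.
#[local] Opaque msym mmap demazure_lusztig demazure_lusztig_inv.

Lemma foldr_Tv_inv_linear m c p r : (k + m < n)%N ->
  foldr (@Tv_inv n) (c *: p + r) (rev (iota k m)) =
  c *: foldr (@Tv_inv n) p (rev (iota k m)) + foldr (@Tv_inv n) r (rev (iota k m)).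
Proof.
elim: m => [//|m IH] lt; have lt1 : ((k + m).+1 < n)%N by lia.
have lt2 : (k + m < n)%N by lia.
by rewrite !foldr_rev_iota_addS (IH lt2); apply: (Tinv_linear (swap_datum_mpoly lt1)).
Qed.

Lemma dminusv_linear c p r : dminusv k (c *: p + r) = c *: dminusv k p + dminusv k r.
Proof.
rewrite /dminusv scalerA mulrC -scalerA -scalerDr; congr (_ *: _).
rewrite scaler_sumr -big_split; apply: eq_bigr => j _ /=.
have lt : (k + j < n)%N by have := ltn_ord j; lia.
by rewrite (foldr_Tv_inv_linear _ _ _ lt) scalerDr !scalerA mulrC.
Qed.

Lemma dminusv0 : dminusv k (0 : {mpoly Qqt[n]}) = 0.
Proof.
have := dminusv_linear 1 0 0; rewrite !scale1r addr0 => /eqP.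
by rewrite -subr_eq0 opprD addrA subrr sub0r oppr_eq0 => /eqP.
Qed.

Lemma dminusv_sum I (r : seq I) (F : I -> {mpoly Qqt[n]}) :
  dminusv k (\sum_(i <- r) F i) = \sum_(i <- r) dminusv k (F i).
Proof.
elim: r => [|i r IH]; first by rewrite !big_nil dminusv0.
by rewrite !big_cons -IH; have := dminusv_linear 1 (F i) (\sum_(i <- r) F i); rewrite !scale1r.
Qed.

Lemma dminusv_mull u p :
  (forall i, (k <= i)%N -> (i.+1 < n)%N -> msym (transp n i) u = u) ->
  dminusv k (u * p) = u * dminusv k p.
Proof.
move=> su; rewrite /dminusv -scalerAr mulr_sumr; congr (_ *: _).
apply: eq_bigr => j _; rewrite -scalerAr; congr (_ *: _).
have : (k + j < n)%N by have := ltn_ord j; lia.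
elim: (j : nat) => [|m IH] lt; first by [].
have lt1 : ((k + m).+1 < n)%N by lia.
have lt2 : (k + m < n)%N by lia.
rewrite !foldr_rev_iota_addS (IH lt2).
exact: (Tv_inv_mull _ lt1 (su _ (leq_addr _ _) lt1)).
Qed.

End Dminusv.

Section DminusTerm.
Variables (k : nat) (a : 'X_{1..k.+1}) (F : Sqt).
Hypotheses (a_gt0 : forall i, (0 < a i)%N) (sF : is_symfun F).
Let M := \prod_(i < k) xs i ^+ a (widen_ord (leqnSn k) i).
Let U := 'X^(a ord_max) * pleth_sub k F.

Let bM : bounded_degree M.
Proof.
by apply: bounded_degree_prod => i _; rewrite xsE -monoMn; apply: bounded_degree_mono.
Qed.

Let sM : tail_symmetric k M.
Proof.
apply: tail_symmetric_prod => i _; apply: tail_symmetric_exp.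
exact: tail_symmetric_xs.
Qed.

Let U_tail r : exists2 G, is_symfun G & U`_r = in_tail k G.
Proof.
have [N [P [_ E]]] := pleth_subP k sF; rewrite /U E coefXnM.
case: ifP => _.
  exists 0; last by rewrite rmorph0.
  by apply: psum_poly_symfun; exact: psum_poly0.
exists (pleth_sub0 P)`_(r - a ord_max); last by rewrite coef_map.
by apply: psum_poly_symfun; exact: pleth_sub0_coef.
Qed.

Let bU r : bounded_degree U`_r.
Proof. by have [G [bG _] ->] := U_tail r; apply: bounded_degree_in_tail. Qed.

Let sU r : tail_symmetric k U`_r.
Proof.
have [G /is_symfunP [_ sG] ->] := U_tail r.
exact: tail_symmetric_in_tail.
Qed.

Let U0 : U`_0 = 0.
Proof. by rewrite coefXnM a_gt0. Qed.

Let bph r : bounded_degree (pleth_h k r).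
Proof. by have [G [bG _] ->] := pleth_h_tail k r; apply: bounded_degree_in_tail. Qed.

Lemma dminus_termE :
  dminus_term a F = - (M * \sum_(r < size U) U`_r * pleth_h k r).
Proof. by []. Qed.

(** By [horner_pleth_sub0] the term is a polynomial in x_{k+1} whose coefficients M and U_r are
    symmetric in X_k. Compared with [dminus_termE], the plethystic d_- replaces each x_{k+1}^r by
    -h_r[(1 - q) X_k]. *)
Lemma expand_termE : xmon a * in_tail k.+1 F = M * \sum_(r < size U) U`_r * xs k ^+ r.
Proof.
rewrite -horner_coef /U /xmon big_ord_recr /= -mulrA; congr (_ * _).
have [N [P [EF E]]] := pleth_subP k sF.
by rewrite hornerM hornerXn E horner_pleth_sub0 -EF.
Qed.

Lemma inLpol_dminus_term : inLpol k (dminus_term a F).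
Proof.
have bS : bounded_degree (\sum_(r < size U) U`_r * pleth_h k r).
  by apply: bounded_degree_sum => r _; apply: bounded_degreeM.
rewrite dminus_termE -scaleN1r; apply: inLpolZ; apply: inLpol_intro.
- exact: bounded_degreeM.
- apply: tail_symmetricM => //; apply: tail_symmetric_sum => r _.
  apply: tail_symmetricM => //; have [G /is_symfunP [_ sG] ->] := pleth_h_tail k r.
  exact: tail_symmetric_in_tail.
move=> e i lt e0; rewrite /M (bigD1 (Ordinal lt)) //= -(prednK (a_gt0 _)) exprS.
by rewrite -!mulrA xs_mul_out.
Qed.

#[local] Opaque msym mmap demazure_lusztig demazure_lusztig_inv.

Lemma Xi_dminus_term n : (k < n)%N ->
  Xi n (dminus_term a F) = dminusv k (Xi n (xmon a * in_tail k.+1 F)).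
Proof.
move=> ltkn; have bx r : bounded_degree (xs k ^+ r).
  by rewrite xsE -monoMn; apply: bounded_degree_mono.
have symXi f : bounded_degree f -> tail_symmetric k f ->
    forall i, (k <= i)%N -> (i.+1 < n)%N -> msym (transp n i) (Xi n f) = Xi n f.
  by move=> bf sf i le lt; rewrite -(Xi_swap bf lt) (sf i le).
have Xix r : Xi n (xs k ^+ r) = xv n k ^+ r.
  by elim: r => [|r IH]; rewrite ?exprS ?(XiM _ (bounded_degree_xs k) (bx r)) ?Xi_xs ?IH //;
     apply: XiP; rewrite ?rmorph1 //; apply: bounded_degree1.
have bS (G : nat -> Sqt) : (forall r, bounded_degree (G r)) ->
    bounded_degree (\sum_(r < size U) U`_r * G r).
  by move=> bG; apply: bounded_degree_sum => r _; apply: bounded_degreeM.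
have XiS (G : nat -> Sqt) : (forall r, bounded_degree (G r)) ->
    Xi n (M * \sum_(r < size U) U`_r * G r) =
    Xi n M * \sum_(r < size U) Xi n U`_r * Xi n (G r).
  move=> bG; rewrite (XiM _ bM (bS G bG)); congr (_ * _).
  rewrite Xi_sum; last by move=> r _; apply: bounded_degreeM.
  by apply: eq_bigr => r _; apply: XiM.
rewrite dminus_termE expand_termE -scaleN1r XiZ; last exact: bounded_degreeM bM (bS _ bph).
rewrite (XiS _ bph) (XiS _ bx) (dminusv_mull _ (symXi M bM sM)) scaleN1r -mulrN.
congr (_ * _); rewrite dminusv_sum -sumrN; apply: eq_bigr => r _.
rewrite (dminusv_mull _ (symXi _ (bU r) (sU r))) Xix.
have [N [P [hP phE]]] := Xi_pleth_h (ltnW ltkn).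
(* For r = 0 the two operators differ: d_- in n variables sends 1 to q^(n-k) - 1, whereas -h_0 = -1.
   The coefficient U_0 is 0 because the exponent of x_{k+1} is positive. *)
case: (nat_of_ord r) => [|b]; first by rewrite U0 Xi0 !mul0r oppr0.
by rewrite phE (dminusv_pow hP b ltkn) mulrN.
Qed.

End DminusTerm.

(** [dminus_s] chooses an expansion of f. For every admissible expansion the result truncates to
    [dminusv] of the truncation of f, in which the expansion no longer appears. *)
Lemma dminus_sP k f : inLpol k.+1 f -> inLpol k (dminus_s k f) /\
  forall n, (k < n)%N -> Xi n (dminus_s k f) = dminusv k (Xi n f).
Proof.
move=> Lf.
rewrite /dminus_s; have [|s [Hs Ef ->]] := epsilon_spec (inhabits 0) (fun g => exists s : seq ('X_{1..k.+1} * Sqt),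
    [/\ forall p, p \in s -> (forall i, (0 < p.1 i)%N) /\ is_symfun p.2,
        f = expand s
      & g = \sum_(p <- s) dminus_term p.1 p.2]).
  have [g [s [Hs Eg]] Ef] := Lf; eexists.
  (* An expansion exists: multiplying one of the cofactor by x_1 ... x_{k+1} raises each exponent by
     one and makes it positive. *)
  exists [seq ([multinom ((p : 'X_{1..k.+1} * Sqt).1 i).+1 | i < k.+1], p.2) | p <- s]; split; last by [].
    by move=> _ /mapP [p /Hs sp ->] /=; split=> // i; rewrite mnmE.
  rewrite Ef Eg /expand big_map mulr_sumr; apply: eq_bigr => p _ /=.
  rewrite mulrA; congr (_ * _); rewrite /xmon -big_split; apply: eq_bigr => i _ /=.
  by rewrite mnmE exprS.
split.
  rewrite big_seq; elim/big_rec: _ => [|p h ps Lh]; first exact: inLpol0.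
  by have [a0 sp] := Hs p ps; apply: inLpolD Lh; apply: inLpol_dminus_term.
move=> n lt; rewrite Ef /expand.
have bE p : p \in s -> bounded_degree (xmon p.1 * in_tail k.+1 p.2).
  move=> /Hs [_ [bF _]]; apply: bounded_degreeM; last exact: bounded_degree_in_tail.
  by rewrite xmonE; apply: bounded_degree_mono.
have bD p : p \in s -> bounded_degree (dminus_term p.1 p.2).
  by move=> /Hs [a0 sp]; have [] := inLpolP (inLpol_dminus_term a0 sp).
rewrite big_seq Xi_sum // [in RHS]big_seq Xi_sum // -!big_seq dminusv_sum.
rewrite big_seq [RHS]big_seq; apply: eq_bigr => p /Hs [a0 sp].
exact: Xi_dminus_term.
Qed.

(** * The module map *)

Definition divisible i (f : Sqt) := exists g, f = xs i * g.

Lemma divisibleP i f : (forall e : expo, (e`_i)%R = 0%N -> f e = 0) -> divisible i f.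
Proof.
move=> vf; exists (fun e => f ('X^i + e)); apply: funext => e.
case: (posnP (e`_i)%R) => [e0|/expo_Xn_sub [e' ->]]; last by rewrite xs_mulE.
by rewrite (vf _ e0) xs_mul_out.
Qed.

Lemma Ts_invE j f : Ts_inv j f = q^-1 *: (Ts j f + (q - 1) *: f).
Proof. by []. Qed.

#[local] Opaque msym mmap demazure_lusztig demazure_lusztig_inv.

Lemma swap_seriesC i j f : (j.+1 < i)%N ->
  swap_series i (swap_series j f) = swap_series j (swap_series i f).
Proof.
move=> lt; apply: funext => e; rewrite !swap_seriesE /reindex_series /=.
congr (f _); apply/polyP => l; rewrite !coef_swap_expo; congr (_`_ _).
rewrite /swap_idx /=; do ! case: eqP => //=; lia.
Qed.

Lemma swap_Ts i j f : (j.+1 < i)%N -> swap_series i (Ts j f) = Ts j (swap_series i f).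
Proof.
move=> lt; apply: (T_morph (swap_datum_series j) (swap_datum_series j)).
- by move=> c g h; rewrite linearP.
- by move=> g h; rewrite rmorphM.
- by rewrite swap_xs swap_idx_id // ltn_eqF //; lia.
- by rewrite swap_xs swap_idx_id // ltn_eqF //; lia.
- exact: swap_seriesC.
Qed.

Lemma tail_symmetric_Ts k j f : (j.+1 < k)%N -> tail_symmetric k f -> tail_symmetric k (Ts j f).
Proof. by move=> lt sf i le; rewrite (swap_Ts _ (leq_trans lt le)) sf. Qed.

Lemma tail_symmetric_Ts_inv k j f :
  (j.+1 < k)%N -> tail_symmetric k f -> tail_symmetric k (Ts_inv j f).
Proof.
move=> lt sf; rewrite Ts_invE; apply/tail_symmetricZ/tail_symmetricD.
  exact: tail_symmetric_Ts.
exact: tail_symmetricZ.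
Qed.

(** T_j^-1 turns a factor x_j into x_{j+1} and lets the other variables through. If x_{j+1} was the
    only one of these variables that might not divide f, that place is now taken by x_j. *)
Lemma divisible_Ts_inv k j f : (j < k)%N ->
  (forall i, (i <= k)%N -> i != j.+1 -> divisible i f) ->
  forall i, (i <= k)%N -> i != j -> divisible i (Ts_inv j f).
Proof.
move=> lt df i le ne; have [E|ne1] := eqVneq i j.+1.
  have [|g ->] := df j (ltnW lt); first by rewrite ltn_eqF.
  exists (q^-1 *: Ts j g); rewrite E -scalerAr.
  exact: (Tinv_x (swap_datum_series j)).
have [g ->] := df i le ne1; exists (Ts_inv j g).
apply: (Tinv_mull (swap_datum_series j)).
by rewrite swap_xs swap_idx_id.
Qed.

Section FoldTsInv.
Variables (k : nat) (f : Sqt).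
Implicit Types m l : nat.

Lemma divisible_foldr_Ts_inv m l : (m + l <= k)%N ->
  (forall i, (i <= k)%N -> i != (m + l)%N -> divisible i f) ->
  forall i, (i <= k)%N -> i != m -> divisible i (foldr Ts_inv f (iota m l)).
Proof.
elim: l m => [|l IH] m le df; first by rewrite addn0 in df.
apply: divisible_Ts_inv; first by lia.
by apply: IH; rewrite addSnnS.
Qed.

Lemma tail_symmetric_foldr_Ts_inv m l : (m + l < k)%N ->
  tail_symmetric k f -> tail_symmetric k (foldr Ts_inv f (iota m l)).
Proof.
elim: l m => [//|l IH] m lt sf; apply: tail_symmetric_Ts_inv; first by lia.
by apply: IH; rewrite ?addSnnS.
Qed.

Lemma bounded_foldr_Ts_inv m l :
  bounded_degree f -> bounded_degree (foldr Ts_inv f (iota m l)).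
Proof. by elim: l m => [//|l IH] m bf; apply/bounded_Ts_inv/IH. Qed.

Lemma Xi_foldr_Ts_inv n m l : (m + l < n)%N -> bounded_degree f ->
  Xi n (foldr Ts_inv f (iota m l)) = foldr (@Tv_inv n) (Xi n f) (iota m l).
Proof.
elim: l m => [|l IH] m lt bf; first by [].
have lt1 : (m.+1 < n)%N by lia.
have lt2 : (m.+1 + l < n)%N by rewrite addSnnS.
have E := IH m.+1 lt2 bf.
have E' := Xi_Ts_inv (bounded_foldr_Ts_inv m.+1 l bf) lt1.
by apply: (etrans E'); rewrite E.
Qed.

End FoldTsInv.

Lemma inLpol_Ts k i f : (i.+1 < k)%N -> inLpol k f -> inLpol k (Ts i f).
Proof.
move=> lt Lf; have [bf sf [g [_ _ Ef]]] := inLpolP Lf.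
apply: inLpol_intro; [exact: bounded_Ts | exact: tail_symmetric_Ts |].
have E : Ts i f = \prod_(j < k) xs j * Ts i g.
  rewrite Ef; apply: (T_mull (swap_datum_series i)).
  by rewrite mono_ones swap_mono swap_ones ?lt.
move=> e j ltj e0; rewrite E (bigD1 (Ordinal ltj)) //= -mulrA.
exact: xs_mul_out.
Qed.

(** Among x_1, ..., x_{k+1}, an element of L_k may lack only the divisor x_{k+1}. The k inverses,
    T_k^-1 acting first, bring the gap down to x_1, where the multiplication by x_1 fills it. *)
Lemma inLpol_dplus k f : inLpol k f -> inLpol k.+1 (dplus_s k f).
Proof.
move=> Lf; have [bf sf _] := inLpolP Lf; apply: inLpolZ; apply: inLpol_intro.
- apply: bounded_degreeM; first exact: bounded_degree_xs.
  exact: bounded_foldr_Ts_inv.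
- apply: tail_symmetricM; first exact: tail_symmetric_xs.
  apply: tail_symmetric_foldr_Ts_inv; first exact: ltnSn.
  exact: tail_symmetricW (leqnSn k) sf.
move=> e i lt e0; case: (posnP i) => [i0|gt]; first by apply: xs_mul_out; rewrite i0 in e0.
have [j le ne||g ->] := @divisible_foldr_Ts_inv k f 0 k (leqnn k) _ i lt.
- apply: divisibleP => e' e'0; apply: (inLpol_vanish Lf) e'0.
  by rewrite ltn_neqAle ne.
- by rewrite -lt0n.
by rewrite mulrCA xs_mul_out.
Qed.

Lemma Xi_dplus n k f : (k < n)%N -> bounded_degree f ->
  Xi n (dplus_s k f) = dplusv k (Xi n f).
Proof.
move=> lt bf; have bT := bounded_foldr_Ts_inv 0 k bf.
have bx := bounded_degree_xs 0.
rewrite /dplus_s (XiZ _ _ (bounded_degreeM bx bT)) (XiM _ bx bT) Xi_xs.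
have E : Xi n (foldr Ts_inv f (iota 0 k)) = foldr (@Tv_inv n) (Xi n f) (iota 0 k).
  exact: Xi_foldr_Ts_inv.
by rewrite E.
Qed.

Lemma inLpol_op g f : inLpol (source g) f -> inLpol (target g) (@op Lpol g f).
Proof.
case: g => [k|k i|k i|k|k] /= Lf.
- exact: Lf.
- by apply: inLpol_Ts Lf; have := ltn_ord i; lia.
- by have [H LH [-> _]] := zs_limit (ltn_ord i) Lf; apply: inLpolZ.
- exact: inLpol_dplus.
- by have [] := dminus_sP Lf.
Qed.

Lemma Xi_op n g f : (source g <= n)%N -> (target g <= n)%N -> inLpol (source g) f ->
  Xi n (@op Lpol g f) = @op (LV n) g (Xi n f).
Proof.
case: g => [k|k i|k i|k|k] /= les let' Lf; have [bf _ _] := inLpolP Lf.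
- by [].
- by apply: Xi_Ts; [exact: bf|have := ltn_ord i; lia].
- have [H LH [-> HX]] := zs_limit (ltn_ord i) Lf; have [bH _ _] := inLpolP LH.
  by rewrite (XiZ _ _ bH) (HX n les).
- exact: Xi_dplus.
- by have [_ ->] := dminus_sP Lf.
Qed.

(** In a product the second factor to act receives the result of the first, which must again lie in
    the direct sum for the compatibility to apply. The components also supply the bounded degree
    under which [Xi] is additive. *)
Lemma in_dsum_act a (F : nat -> carrier Lpol) : in_dsum F -> in_dsum (Defs.act a F).
Proof.
elim: a F => [g|a IHa b IHb|c a IHa|a IHa b IHb] F FL.
- split=> [k|] /=; last first.
    by exists (target g).+1 => k lt; rewrite gtn_eqF.
  have [LF _] := FL; case: eqP => [->|_]; last exact: inLpol0.
  exact: inLpol_op (LF _).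
- have [La [da Ha]] := IHa F FL; have [Lb [db Hb]] := IHb F FL; split=> [k|] /=.
    exact: inLpolD (La k) (Lb k).
  by exists (maxn da db) => k; rewrite geq_max => /andP[lea leb]; rewrite Ha ?Hb ?addr0.
- have [La [da Ha]] := IHa F FL; split=> [k|] /=; first exact: inLpolZ (La k).
  by exists da => k le; rewrite Ha ?scaler0.
- exact/IHa/IHb.
Qed.

(** [between] keeps the source and target of each generator at most n, so the action reads only
    components on which [Xi_bullet] is the truncation, never those above n that it sends to 0. *)
Lemma Xi_bullet_act n a (F : nat -> carrier Lpol) : between n a -> in_dsum F ->
  Xi_bullet n (Defs.act a F) = Defs.act a (Xi_bullet n F).
Proof.
have bL k f : inLpol k f -> bounded_degree f by case/inLpolP.
elim: a F => [g|a IHa b IHb|c a IHa|a IHa b IHb] F /= Ba FL; apply: funext => k.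
- have [les let'] := Ba; have [LF _] := FL; rewrite /Xi_bullet les.
  case: (eqVneq k (target g)) => [->|_]; last by rewrite Xi0 if_same.
  by rewrite let' (Xi_op les let' (LF _)).
- have [Baa Bab] := Ba; rewrite -(IHa F Baa FL) -(IHb F Bab FL) /Xi_bullet.
  have [La _] := in_dsum_act a FL; have [Lb _] := in_dsum_act b FL.
  case: ifP => _; last by rewrite addr0.
  exact: XiD (bL _ _ (La k)) (bL _ _ (Lb k)).
- rewrite -(IHa F Ba FL) /Xi_bullet; have [La _] := in_dsum_act a FL.
  case: ifP => _; last by rewrite scaler0.
  exact: XiZ (bL _ _ (La k)).
- have [Baa Bab] := Ba.
  by rewrite -(IHb F Bab FL) -(IHa _ Baa (in_dsum_act b FL)).
Qed.

Theorem proposition3p7 (n : nat) (hn : (1 <= n)%N) :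
  is_Bn_module_map n (M := Lpol) (N := LV n) (@Xi_bullet n).
Proof.
split=> [F [LF _]|c F G [LF _] [LG _] k|_ a _ Ba F FL k].
- split=> [k|] /=; last first.
    by exists n.+1 => k lt; rewrite /Xi_bullet leqNgt lt.
  rewrite /Xi_bullet; case: leqP => // _; have [g -> sg] := Xi_Lpol n (LF k).
  exact: inLV_sym.
- rewrite /Xi_bullet; case: ifP => _; last by rewrite scaler0 addr0.
  by have [bF _ _] := inLpolP (LF k); have [bG _ _] := inLpolP (LG k); apply: Xi_linear.
- by rewrite Xi_bullet_act.
Qed.
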